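(* There exist absolute constants $c$ and $b$ such that the following hold for all positive integers $m,k$ with $k$ dividing $m$. (i) Let $f_*:\mathbb{R}^d\to\mathbb{R}$ be convex, let $x^{(1)},\dots,x^{(n)}$ be i.i.d. in $\mathbb{R}^d$ with distribution $\mu$, and let $y^{(i)}=f_*(x^{(i)})+\varepsilon_i$ with $\varepsilon_i$ i.i.d. mean zero Gaussian with variance $\sigma^2$. Assume $f_*$ and all functions in $\mathcal{F}_{m,k}$ are uniformly bounded by $\Gamma\in(0,\infty)$. Then the $(m,k)$-spectrahedral least squares estimator $\hat f_{m,k}$ satisfies $$\mathbb{E}\,\|\hat f_{m,k}-f_*\|_\mu^2\le c\left(\inf_{f\in\mathcal{F}_{m,k}}\|f-f_*\|_\mu^2+\max\{\sigma^2,\Gamma^2\}\,km(d+1)\frac{\log(bn/k)}{n}\right).$$ (ii) Let $K_*$ be a convex body in $\mathbb{R}^d$, let $u^{(1)},\dots,u^{(n)}$ be i.i.d. in $\mathbb{S}^{d-1}$ with distribution $\nu$, and let $y^{(i)}=h_{K_*}(u^{(i)})+\varepsilon_i$ with $\varepsilon_i$ i.i.d. mean zero Gaussian with variance $\sigma^2$. Assume $K_*$ and all elements of $\mathcal{L}(\mathcal{S}_{m,k})$ are contained in $B_d(0,\Gamma)$. Then the $(m,k)$-spectratope least squares estimator $\hat K_{m,k}$ satisfies $$\mathbb{E}\,\ell_\nu^2(\hat K_{m,k},K_* )\le c\left(\inf_{S\in\mathcal{L}(\mathcal{S}_{m,k})}\ell_\nu^2(S,K_* )+\max\{\sigma^2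,\Gamma^2\}\frac{mk}{n}d\log(bn)\right).$$
   Context: $\mathbb{S}^m_k$ is the set of $m\times m$ real symmetric matrices that are block diagonal with blocks of size at most $k\times k$ ($k$ dividing $m$). An $(m,k)$-spectrahedral function is $f(x)=\lambda_{\max}\left(\sum_{i=1}^dx_iA_i+B\right)$ with $A_1,\dots,A_d,B\in\mathbb{S}^m_k$. The $(m,k)$-spectraplex is $\mathcal{S}_{m,k}=\{M\in\mathbb{S}^m_k:\mathrm{tr}(M)=1,\ M\succeq0\}$. A convex body is a compact convex set, $h_K(u)=\sup_{x\in K}\langle u,x\rangle$ is the support function, and $B_d(0,\Gamma)$ is the Euclidean ball of radius $\Gamma$ centered at $0$. The standing boundedness assumption is understood as follows: $\mathcal{F}_{m,k}$ denotes the class of $(m,k)$-spectrahedral functions that are bounded in absolute value by $\Gamma$ on the support of $\mu$ (and $|f_*|\le\Gamma$ there); $\mathcal{L}(\mathcal{S}_{m,k})$ denotes the class of linear images of $\mathcal{S}_{m,k}$ in $\mathbb{R}^d$ that are contained in $B_d(0,\Gamma)$. The support function of the linear image $\{(\langle A_1,M\rangle,\dots,\langle A_d,M\rangle):M\in\mathcal{S}_{m,k}\}$, $A_i\in\mathbb{S}^m_k$, is $u\mapsto\lambda_{\max}\left(\sum_iu_iA_i\right)$. Estimators: $\hat f_{m,k}\in\arg\min_{f\in\mathcal{F}_{m,k}}\sum_{i=1}^n(y^{(i)}-f(x^{(i)}))^2$ and $\hat K_{m,k}\in\arg\min_{S\in\mathcal{L}(\mathcal{S}_{m,k})}\sum_{i=1}^n(y^{(i)}-h_S(u^{(i)}))^2$.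 Losses: $\|f-g\|_\mu^2=\int_{\mathbb{R}^d}(f(x)-g(x))^2\,d\mu(x)$ and $\ell_\nu^2(S,K)=\int_{\mathbb{S}^{d-1}}(h_S(u)-h_K(u))^2\,d\nu(u)$. The expectation $\mathbb{E}$ is over the sample (covariates and noise, which are independent).
   Formalization: Part (i) is proved for sample sizes n ≥ k: for bn < k the logarithm log(bn/k) is negative and the stated bound fails (e.g. f_* = 0, n = 1, k > b), whatever the absolute constant b. *)

(* Defs.v *)
From HB Require Import structures.
From mathcomp Require Import all_boot all_order all_algebra.
From mathcomp Require Import all_classical all_reals all_analysis measurable_realfun.

Set Implicit Arguments.
Unset Strict Implicit.
Unset Printing Implicit Defensive.

Import Order.TTheory GRing.Theory Num.Theory.
Import numFieldNormedType.Exports.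

Local Open Scope classical_set_scope.
Local Open Scope ring_scope.

(* R^d with its Borel sigma-algebra; convertible to 'rV[R]_d. *)
Notation borel_rV R d := (g_sigma_algebraType (@open 'rV[R]_d)).

Section Euclidean.
Context {R : realType} {d : nat}.
Implicit Types (x u : 'rV[R]_d) (K : set 'rV[R]_d).

Definition dotp x u : R := \sum_(i < d) x ord0 i * u ord0 i.

(* The library norm on 'rV[R]_d is the max norm, hence this definition. *)
Definition enorm x : R := Num.sqrt (dotp x x).

Definition eball (r : R) : set 'rV[R]_d := [set x | enorm x <= r].

Definition esphere : set 'rV[R]_d := [set u | enorm u = 1].

(* Nonemptiness keeps the support function finite. *)
Definition convex_body K := [/\ compact K, convex_set K & K !=set0].

Definition support_fun K u : R := sup [set dotp u x | x in K].

Definition msupport (mu : set (borel_rV R d) -> \bar R) : set 'rV[R]_d :=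
  [set x | forall U : set 'rV[R]_d, open U -> U x -> (0 < mu U)%E].

End Euclidean.

Section Spectrahedral.
Context {R : realType}.

(* The k x k blocks are consecutive: the index i lies in block i %/ k. *)
Definition block_sym (m k : nat) : set 'M[R]_m :=
  [set A | A^T = A /\ forall i j : 'I_m, (i %/ k != j %/ k)%N -> A i j = 0].

(* The set of eigenvalues of a symmetric matrix of positive size is finite and
   nonempty, so that this supremum is a maximum. *)
Definition lambda_max (m : nat) (A : 'M[R]_m) : R :=
  sup [set a : R | eigenvalue A a].

Definition psd (m : nat) (M : 'M[R]_m) :=
  forall v : 'cV[R]_m, 0 <= (v^T *m M *m v) ord0 ord0.

Definition spectraplex (m k : nat) : set 'M[R]_m :=
  [set M | [/\ block_sym k M, \tr M = 1 & psd M]].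

Definition spectrahedral_fun (m k d : nat) : set ('rV[R]_d -> R) :=
  [set f | exists (A : 'I_d -> 'M[R]_m) (B : 'M[R]_m),
    [/\ forall i, block_sym k (A i), block_sym k B
      & forall x : 'rV[R]_d, f x = lambda_max (\sum_(i < d) x ord0 i *: A i + B)]].

Definition spectrahedral_class (m k d : nat)
    (mu : set (borel_rV R d) -> \bar R) (Gamma : R) : set ('rV[R]_d -> R) :=
  [set f | spectrahedral_fun m k f /\
           forall x, msupport mu x -> `|f x| <= Gamma].

(* A linear map defined on the subspace of block diagonal symmetric matrices
   extends to all of 'M[R]_m, with the same image of the spectraplex. *)
Definition spectratope_class (m k d : nat) (Gamma : R) :
    set (set 'rV[R]_d) :=
  [set S | (exists L : {linear 'M[R]_m -> 'rV[R]_d},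
              S = L @` spectraplex k) /\
           S `<=` eball Gamma].

End Spectrahedral.

Section Regression.
Local Open Scope ereal_scope.
Context {R : realType} {d : nat}.

Definition loss_fun (mu : {measure set (borel_rV R d) -> \bar R})
    (f g : 'rV[R]_d -> R) : \bar R :=
  \int[mu]_x (((f x - g x) ^+ 2)%R)%:E.

Definition loss_set (nu : {measure set (borel_rV R d) -> \bar R})
    (S K : set 'rV[R]_d) : \bar R :=
  \int[nu]_(u in esphere) (((support_fun S u - support_fun K u) ^+ 2)%R)%:E.

Definition is_argmin (T : Type) (C : set T) (crit : T -> R) (t : T) :=
  C t /\ forall s, C s -> (crit t <= crit s)%R.

Definition sum_sq (n : nat) (x : 'I_n -> 'rV[R]_d) (y : 'I_n -> R)
    (f : 'rV[R]_d -> R) : R :=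
  (\sum_(i < n) (y i - f (x i)) ^+ 2)%R.

(* i.i.d. covariates with law mu, i.i.d. N(0, sigma^2) noise, and all 2n of
   them mutually independent.  Events of subfamilies are obtained by taking
   some of the A i, B i to be the whole space.  The second argument of
   normal_prob is the standard deviation. *)
Definition regression_design (disp : measure_display)
    (Omega : measurableType disp) (P : probability Omega R) (n : nat)
    (mu : probability (borel_rV R d) R) (sigma : R)
    (X : 'I_n -> {RV P >-> borel_rV R d}) (eps : 'I_n -> {RV P >-> R}) :=
  [/\ forall i (A : set (borel_rV R d)), measurable A ->
        distribution P (X i) A = mu A,
      forall i (B : set R), measurable B ->
        distribution P (eps i) B = normal_prob 0%R sigma B
    & forall (A : 'I_n -> set (borel_rV R d)) (B : 'I_n -> set R),
        (forall i, measurable (A i)) -> (forall i, measurable (B i)) ->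
        P [set w | forall i, A i (X i w) /\ B i (eps i w)] =
        (\prod_(i < n) P (X i @^-1` A i)) * \prod_(i < n) P (eps i @^-1` B i)].

End Regression.

(* Main.v *)
(* Both estimators minimize the empirical risk over a class of functions
   x |-> lambda_max(sum_l c_l(x) A_l) with N = q m k real parameters, so that
   everything rests on a covering bound for such a class on a finite sample and
   on a localized concentration argument.

   Covering.  At generic levels t_j, the sign patterns "t_j I - M(z_i) is
   positive semidefinite" determine the values of the functions at the sample
   points up to the mesh of the levels.  The parameters having a given pattern
   form a closed set, which is also open wherever the product g of the
   determinants det(t_j I - M(z_i)) does not vanish.  Hence g^2, perturbed by a
   small generic linear form, has a critical point in each of them, and a linear
   algebra argument bounds the number of these critical points polynomially, as
   Bezout's theorem would.

   Concentration.  With the factor 2 in front of the empirical loss, the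
   supremum over the class of (population loss - 2 empirical loss) has
   expectation O(Gamma^2 log(cover) / n): introduce a ghost sample, exchange the
   two samples by random signs, and bound exponential moments.  The Gaussian term
   is handled likewise, its quadratic penalty absorbing the variance.  A countable
   dense set of parameters makes the suprema measurable. *)
Require Import Defs.
From HB Require Import structures.
From mathcomp Require Import all_boot all_order all_algebra.
From mathcomp Require Import all_classical all_reals all_analysis measurable_realfun.
From mathcomp Require Import ring lra zify.

Set Implicit Arguments.
Unset Strict Implicit.
Unset Printing Implicit Defensive.

Import Order.TTheory GRing.Theory Num.Theory.
Import numFieldNormedType.Exports.

Local Open Scope classical_set_scope.
Local Open Scope ring_scope.

(** In the count of critical points the order of choices is the delicate point. The perturbation
    must be generic for every candidate separating form, because the critical points to be separated
    depend on it; hence the candidates form a finite set fixed beforehand.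

    The cover is used only when N <= n. Otherwise the remainder already exceeds 4 Gamma^2, which
    bounds every loss. When N = (d + 1) m k <= n, divisibility gives k <= m, so k^2 <= n and log n
    <= 2 log(n / k); this is how the logarithm of n / k in part (i) arises.

    Constants: the minimizing property and the parallelogram identity give 2 emp(fhat) <= 6 emp(f0)
    + 4 noise, where emp is the empirical loss and the noise term carries the penalty (f - f0)^2 /
    4. The expectations of the two suprema add up to 120 max(sigma^2, Gamma^2) (log(cover) + 1) / n,
    and log(cover) + 1 <= 6 N (1 + log n) <= 12 N l, with l the logarithmic factor of the statement.
    Hence c = 120 * 12 = 1440, and b = e absorbs the 1 in 1 + log n. *)

Section ContinuousBig.
Context {R : realType} {T : topologicalType} (I : Type).
Implicit Types (r : seq I) (f : I -> T -> R).

Lemma sum_continuous r f : (forall i, continuous (f i)) ->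
  continuous (fun x => \sum_(i <- r) f i x).
Proof.
move=> fc; elim: r => [|i r IH] x.
  by under eq_fun do rewrite big_nil; exact: cvg_cst.
by under eq_fun do rewrite big_cons; apply: cvgD; [exact: fc|exact: IH].
Qed.

Lemma prod_continuous r f : (forall i, continuous (f i)) ->
  continuous (fun x => \prod_(i <- r) f i x).
Proof.
move=> fc; elim: r => [|i r IH] x.
  by under eq_fun do rewrite big_nil; exact: cvg_cst.
by under eq_fun do rewrite big_cons; apply: cvgM; [exact: fc|exact: IH].
Qed.

End ContinuousBig.

(** * Polynomial functions and their critical points *)

Section Polynomials.
Context {R : realType} {N : nat}.
Implicit Types (x : 'rV[R]_N) (e : {ffun 'I_N -> nat}).

Definition mono e x : R := \prod_i x ord0 i ^+ e i.

(** [E] bounds the degree in each variable separately, so that these functions lie in the span of (E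
    + 1)^N monomials. *)
Definition polyfun (E : nat) (f : 'rV[R]_N -> R) :=
  exists2 s : seq (R * {ffun 'I_N -> nat}),
    (forall t, t \in s -> forall i, (t.2 i <= E)%N) &
    forall x, f x = \sum_(t <- s) t.1 * mono t.2 x.

Lemma polyfun_ext E f g : f =1 g -> polyfun E f -> polyfun E g.
Proof. by move=> fg [s sE sf]; exists s => // x; rewrite -fg. Qed.

Lemma polyfunW E E' f : (E <= E')%N -> polyfun E f -> polyfun E' f.
Proof. by move=> EE' [s sE sf]; exists s => // t /sE h i; exact: leq_trans EE'. Qed.

Lemma polyfun_cst c : polyfun 0 (fun=> c).
Proof.
exists [:: (c, [ffun=> 0%N])] => [t|x].
  by rewrite inE => /eqP -> i; rewrite ffunE.
rewrite big_seq1 /mono big1 ?mulr1// => i _; by rewrite ffunE expr0.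
Qed.

Lemma polyfun_coord i : polyfun 1 (fun x => x ord0 i).
Proof.
exists [:: (1, [ffun j => (j == i) : nat])] => [t|x].
  by rewrite inE => /eqP -> j; rewrite ffunE leq_b1.
rewrite big_seq1 /mono (bigD1 i)//= ffunE eqxx expr1 big1 ?mulr1 ?mul1r//.
by move=> j /negbTE ji; rewrite ffunE ji expr0.
Qed.

Lemma polyfunD E f g :
  polyfun E f -> polyfun E g -> polyfun E (fun x => f x + g x).
Proof.
move=> [s sE sf] [t tE tf]; exists (s ++ t) => [u|x]; last by rewrite big_cat sf tf.
by rewrite mem_cat => /orP[/sE|/tE].
Qed.

Lemma polyfunM E E' f g :
  polyfun E f -> polyfun E' g -> polyfun (E + E') (fun x => f x * g x).
Proof.
move=> [s sE sf] [t tE tf].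
pose m (a b : R * {ffun 'I_N -> nat}) :=
  (a.1 * b.1, [ffun i => (a.2 i + b.2 i)%N]).
exists [seq m a b | a <- s, b <- t].
  move=> u /allpairsP[[a b] /= [/sE as_ /tE bt ->]] i /=.
  by rewrite ffunE leq_add.
move=> x; rewrite big_allpairs_dep sf mulr_suml; apply: eq_bigr => a _.
rewrite tf mulr_sumr; apply: eq_bigr => b _ /=.
rewrite mulrACA; congr (_ * _); rewrite /mono -big_split /=.
by apply: eq_bigr => i _; rewrite ffunE exprD.
Qed.

Lemma polyfunZ E c f : polyfun E f -> polyfun E (fun x => c * f x).
Proof. exact: polyfunM (polyfun_cst c). Qed.

Lemma polyfunB E f g :
  polyfun E f -> polyfun E g -> polyfun E (fun x => f x - g x).
Proof.
move=> pf pg; apply: polyfunD => //.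
by apply: polyfun_ext (polyfunZ (-1) pg) => x; rewrite mulN1r.
Qed.

Lemma polyfun_sum (I : Type) (r : seq I) (P : pred I) E f :
  (forall i, polyfun E (f i)) -> polyfun E (fun x => \sum_(i <- r | P i) f i x).
Proof.
move=> pf; elim: r => [|i r IH].
  by apply: polyfunW (polyfun_ext _ (polyfun_cst 0)) => // x; rewrite big_nil.
case Pi: (P i); last by apply: polyfun_ext IH => x; rewrite big_cons Pi.
by apply: polyfun_ext (polyfunD (pf i) IH) => x; rewrite big_cons Pi.
Qed.

Lemma polyfun_prod (I : Type) (r : seq I) E f :
  (forall i, polyfun E (f i)) ->
  polyfun (size r * E) (fun x => \prod_(i <- r) f i x).
Proof.
move=> pf; elim: r => [|i r IH].
  by apply: polyfun_ext (polyfun_cst 1) => x; rewrite big_nil.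
by rewrite mulSn; apply: polyfun_ext (polyfunM (pf i) IH) => x; rewrite big_cons.
Qed.

Lemma polyfunX E f n : polyfun E f -> polyfun (n * E) (fun x => f x ^+ n).
Proof.
move=> pf; elim: n => [|n IH].
  by apply: polyfun_ext (polyfun_cst 1) => x; rewrite expr0.
by rewrite mulSn; apply: polyfun_ext (polyfunM pf IH) => x; rewrite exprS.
Qed.

Lemma polyfun_det E m (A : 'rV[R]_N -> 'M[R]_m) :
  (forall i j, polyfun E (fun x => A x i j)) ->
  polyfun (m * E) (fun x => \det (A x)).
Proof.
move=> pA; apply: polyfun_sum => s; apply: polyfunZ.
rewrite -[X in (X * E)%N](card_ord m) cardE /index_enum -enumT.
exact: polyfun_prod.
Qed.

Lemma polyfun_coefs E f : polyfun E f ->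
  exists c : {ffun 'I_N -> 'I_E.+1} -> R,
    forall x, f x = \sum_e c e * mono [ffun i => e i : nat] x.
Proof.
move=> [s sE sf].
exists (fun e : {ffun 'I_N -> 'I_E.+1} =>
  \sum_(t <- s | t.2 == [ffun i => e i : nat]) t.1) => x.
rewrite sf; under [RHS]eq_bigr do rewrite mulr_suml.
rewrite (exchange_big_dep xpredT)//=; apply: eq_big_seq => t ts.
pose e := [ffun i => Ordinal (sE t ts i : t.2 i < E.+1)%N].
have te : t.2 = [ffun i => e i : nat].
  by apply/ffunP => i; rewrite !ffunE.
rewrite (bigD1 e)/= -te// big1 ?addr0// => e' /andP[/eqP te' /negP[]].
apply/eqP/ffunP => i; apply/val_inj => /=.
by move/ffunP: te' => /(_ i); rewrite te !ffunE => ->.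
Qed.

(** Dimension count: more functions than monomials leave a nonzero vector in the left kernel of the
    matrix of coefficients. *)
Lemma polyfun_dependent E (K : finType) (f : K -> 'rV[R]_N -> R) :
  (forall k, polyfun E (f k)) -> (E.+1 ^ N < #|K|)%N ->
  exists2 c : K -> R, exists k, c k != 0 & forall x, \sum_k c k * f k x = 0.
Proof.
move=> pf cK; have [c fc] := choice (fun k => polyfun_coefs (pf k)).
pose M := {ffun 'I_N -> 'I_E.+1}.
pose A := \matrix_(k < #|K|, e < #|{: M}|) c (enum_val k) (enum_val e).
have : kermx A != 0.
  rewrite kermx_eq0 /row_free neq_ltn; apply/orP; left.
  apply: leq_ltn_trans (rank_leq_col A) _.
  by rewrite card_ffun !card_ord.
move=> /rowV0Pn[v /sub_kermxP vA v0].
exists (fun k => v ord0 (enum_rank k)).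
  by move/rV0Pn: v0 => [k vk]; exists (enum_val k); rewrite enum_valK.
move=> x; under eq_bigr do rewrite fc mulr_sumr.
rewrite exchange_big/= big1// => e _.
under eq_bigr do rewrite mulrA.
rewrite -mulr_suml; have /rowP/(_ (enum_rank e)) := vA.
rewrite !mxE => vAe; rewrite [X in X * _](_ : _ = 0) ?mul0r//.
rewrite -[RHS]vAe (reindex (@enum_val K predT))/=; last first.
  by exists enum_rank => k _; rewrite ?enum_valK ?enum_rankK.
by apply: eq_bigr => k _; rewrite !mxE !enum_valK enum_rankK.
Qed.

Lemma polyfun_continuous E f : polyfun E f -> continuous f.
Proof.
move=> [s _ sf]; rewrite (_ : f = fun x => \sum_(t <- s) t.1 * mono t.2 x); last first.
  exact/funext.
apply: sum_continuous => t.
have mc : continuous (mono t.2).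
  rewrite /mono; apply: prod_continuous => i x.
  exact: (continuous_comp (@coord_continuous _ _ _ _ _ _) (@exprn_continuous _ _ _)).
by move=> x; apply: (@cvgM _ _ (nbhs x)); [exact: cvg_cst|exact: mc].
Qed.

(** Partial derivatives are taken formally along coordinate lines. This keeps the degree bound and
    reduces optimality conditions to polynomials in one variable. *)
Lemma polyfun_directional E f i : polyfun E f ->
  exists2 p, polyfun E p & forall x, exists2 q : {poly R},
    (forall s, f (x + s *: delta_mx ord0 i) = q.[s]) & q^`().[0] = p x.
Proof.
move=> [s sE sf].
(* At exponent 0 the predecessor is again 0, which is harmless since the coefficient then
   vanishes. *)
pose d (t : R * {ffun 'I_N -> nat}) :=
  (t.1 * (t.2 i)%:R, [ffun j => if j == i then (t.2 j).-1 else t.2 j]).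
exists (fun x => \sum_(t <- [seq d t | t <- s]) t.1 * mono t.2 x).
  exists [seq d t | t <- s] => // t /mapP[u us ->] j /=; rewrite ffunE.
  by case: ifP => _; [apply: leq_trans (leq_pred _) _|]; exact: sE.
move=> x.
pose r (t : R * {ffun 'I_N -> nat}) := \prod_(j | j != i) x ord0 j ^+ t.2 j.
exists (\sum_(t <- s) (t.1 * r t) *: ('X + (x ord0 i)%:P) ^+ t.2 i).
  move=> h; rewrite sf horner_sum; apply: eq_bigr => t _.
  rewrite !hornerE/= -mulrA; congr (_ * _); rewrite /mono (bigD1 i)//= mulrC.
  rewrite !mxE !eqxx mulr1 (addrC h); congr (_ * _); apply: eq_bigr => j /negbTE ji.
  by rewrite !mxE eqxx ji mulr0 addr0.
rewrite raddf_sum/= horner_sum big_map; apply: eq_bigr => t _.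
rewrite derivZ deriv_exp derivD derivX derivC addr0 mul1r.
rewrite hornerZ hornerMn horner_exp hornerD hornerX hornerC add0r -mulr_natr/=.
rewrite /mono (bigD1 i)//= !ffunE eqxx [X in _ = _ * (_ * X)](_ : _ = r t); last first.
  by apply: eq_bigr => j /negbTE ji; rewrite ffunE ji.
by ring.
Qed.

End Polynomials.

Lemma nonroot_small {R : realFieldType} (p : {poly R}) (eta : R) :
  p != 0 -> 0 < eta -> exists2 t, 0 < t < eta & p.[t] != 0.
Proof.
(* These are [size p] distinct points of the interval, one more than the degree of [p]. *)
move=> p0 eta0; pose s := [seq eta / j.+2%:R | j <- iota 0 (size p)].
have : ~~ all (root p) s.
  have us : uniq s.
    rewrite map_inj_uniq ?iota_uniq// => i j.
    by move=> /(mulfI (lt0r_neq0 eta0))/invr_inj/eqP; rewrite eqr_nat => /eqP[].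
  by apply/negP => rs; have := max_poly_roots p0 rs us; rewrite size_map size_iota ltnn.
case/allPn => _ /mapP[j _ ->] rj; exists (eta / j.+2%:R) => //.
by rewrite divr_gt0//= ltr_pdivrMr// ltr_pMr// ltr1n.
Qed.

(** Uniqueness of expansions in base [b], by splitting off the units digit modulo [b]. *)
Lemma digits_inj (b N : nat) (f g : 'I_N -> nat) :
  (forall i, f i < b)%N -> (forall i, g i < b)%N ->
  (\sum_(i < N) f i * b ^ i = \sum_(i < N) g i * b ^ i)%N -> f =1 g.
Proof.
elim: N f g => [|N IH] f g fb gb; first by move=> _ [].
have b0 : (0 < b)%N by apply: leq_ltn_trans (fb ord0).
have split (h : 'I_N.+1 -> nat) : (\sum_(i < N.+1) h i * b ^ i =
    (\sum_(i < N) h (lift ord0 i) * b ^ i) * b + h ord0)%N.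
  rewrite big_ord_recl expn0 muln1 addnC big_distrl/=; congr addn.
  by apply: eq_bigr => i _; rewrite expnS mulnCA mulnC -mulnA.
rewrite !split => e.
have e0 : f ord0 = g ord0.
  by move/(congr1 (modn^~ b)): (e); rewrite !modnMDl !modn_small.
move: e; rewrite e0 => /addIn /eqP; rewrite eqn_pmul2r// => /eqP e1 i.
case: (unliftP ord0 i) => [j|] -> //.
exact: (IH (fun j => f (lift ord0 j)) (fun j => g (lift ord0 j))).
Qed.

(* Kronecker's substitution x_i = t ^ (A + 1) ^ i makes all monomials with
   exponents at most A distinct powers of t. *)
Lemma common_nonzero {R : realType} {N A : nat} (S : finType)
    (c : S -> {ffun 'I_N -> 'I_A.+1} -> R) (eta : R) :
  0 < eta -> (forall s, exists e, c s e != 0) ->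
  exists2 a : 'rV[R]_N, forall i, `|a ord0 i| < eta &
    forall s, \sum_e c s e * mono [ffun i => e i : nat] a != 0.
Proof.
move=> eta0 c0.
pose K (e : {ffun 'I_N -> 'I_A.+1}) := (\sum_(i < N) e i * A.+1 ^ i)%N.
pose Q s : {poly R} := \sum_e c s e *: 'X^(K e).
have Q0 s : Q s != 0.
  have [e ce] := c0 s; apply: contraNneq ce => Qs0.
  have := coef0 R (K e); rewrite -Qs0 coef_sum (bigD1 e)//= coefZ coefXn eqxx.
  rewrite mulr1 big1 ?addr0 => [->//|e' e'e].
  rewrite coefZ coefXn; case: eqP => [KK|]; last by rewrite mulr0.
  case/eqP: e'e; apply/ffunP => i; apply/val_inj/esym.
  by apply: (digits_inj _ _ KK) => j; rewrite ltn_ord.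
(* With [t] also below 1, every power of positive exponent stays below [eta]. *)
have [t /andP[t0 te] tQ] : exists2 t : R, 0 < t < Num.min eta 1 &
    (\prod_s Q s).[t] != 0.
  apply: nonroot_small; last by rewrite lt_min eta0 ltr01.
  by apply/prodf_neq0.
exists (\row_i t ^+ (A.+1 ^ i)) => [i|s].
  rewrite mxE ger0_norm ?exprn_ge0 ?(ltW t0)//.
  move: te; rewrite lt_min => /andP[te t1]; apply: le_lt_trans te.
  by rewrite ler_iXnr ?(ltW t0) ?(ltW t1)// expn_gt0.
move: tQ; rewrite horner_prod => /prodf_neq0/(_ s isT).
rewrite horner_sum; congr (_ != _); apply: eq_bigr => e _.
rewrite hornerZ hornerXn; congr (_ * _); rewrite /mono /K expr_sum.
by apply: eq_bigr => i _; rewrite mxE ffunE -exprM mulnC.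
Qed.

(** The form with coefficients 1, s, ..., s^(N-1) confuses two points only if s is a root of the
    polynomial whose coefficients are those of their difference. The product over all pairs has
    fewer roots than there are candidates s. *)
Lemma separating_functional {R : realType} {N : nat} (T : finType)
    (x : T -> 'rV[R]_N) : injective x ->
  exists s : 'I_(#|{: T * T}| * N).+1,
    injective (fun t => \sum_(i < N) (s%:R : R) ^+ i * x t ord0 i).
Proof.
move=> xI; pose D (u : T * T) : {poly R} := \poly_(i < N)
  (if insub i is Some j then x u.1 ord0 j - x u.2 ord0 j else 0).
have DE u s : (D u).[s] = \sum_(i < N) s ^+ i * x u.1 ord0 i -
    \sum_(i < N) s ^+ i * x u.2 ord0 i.
  rewrite horner_poly -sumrB; apply: eq_bigr => i _.
  by rewrite valK mulrC mulrBr.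
pose P : {poly R} := \prod_(u | u.1 != u.2) D u.
have P0 : P != 0.
  apply/prodf_neq0 => -[t t'] /=; apply: contraNneq => D0; apply/eqP/xI.
  apply/rowP => i; have := coef0 R i; rewrite -D0 coef_poly ltn_ord valK/=.
  by move/eqP; rewrite subr_eq0 => /eqP.
have sP : (size P <= (#|{: T * T}| * N).+1)%N.
  apply: leq_trans (size_poly_prod_leq _ _) (leq_trans (leq_subr _ _) _).
  rewrite ltnS.
  apply: leq_trans (_ : \sum_(u : T * T | u.1 != u.2) N <= _)%N.
    by apply: leq_sum => u _; exact: size_poly.
  by rewrite sum_nat_const leq_mul2r max_card orbT.
pose r : seq R := [seq (nat_of_ord s)%:R | s <- enum 'I_(#|{: T * T}| * N).+1].
have ur : uniq r.
  by rewrite map_inj_uniq ?enum_uniq// => i j /eqP; rewrite eqr_nat => /eqP/val_inj.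
have : ~~ all (root P) r.
  apply/negP => rs; have := leq_trans (max_poly_roots P0 rs ur) sP.
  by rewrite size_map size_enum_ord ltnn.
case/allPn => _ /mapP[s _ ->] rs; exists s => t t' tt'.
apply/eqP/negPn/negP => ntt'; move/negP: rs; apply.
by rewrite rootE horner_prod (bigD1 (t, t'))//= DE tt' subrr mul0r.
Qed.

Lemma poly_local_max {R : realType} (q : {poly R}) (d : R) : 0 < d ->
  (forall s, `|s| < d -> q.[s] <= q.[0]) -> q^`().[0] = 0.
Proof.
move=> d0 qmax; have q'0 : is_derive (0 : R) 1 (horner q) q^`().[0] by exact: is_derive_poly.
have q00 : is_derive (0 : R) 1 (horner q) 0.
  apply: (@derive1_at_max _ _ (- d) d) => [|t _||t].
  - lra.
  - exact: derivable_horner.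
  - by rewrite in_itv/=; lra.
  - by rewrite in_itv/= => td; apply: qmax; rewrite ltr_norml.
by rewrite -(@derive_val _ _ _ _ _ _ _ q'0) (@derive_val _ _ _ _ _ _ _ q00).
Qed.

Lemma mx_norm_coord {R : realDomainType} {m n : nat} (x : 'M[R]_(m, n)) i j :
  `|x i j| <= `|x|.
Proof.
rewrite [leRHS]/Num.norm/= mx_normrE.
exact: (le_bigmax _ (fun ij : _ * _ => `|x ij.1 ij.2|) (i, j)).
Qed.

Lemma mx_norm_le {R : realDomainType} {m n : nat} (x : 'M[R]_(m, n)) (e : R) :
  0 <= e -> (forall i j, `|x i j| <= e) -> `|x| <= e.
Proof.
move=> e0 xe; rewrite [leLHS]/Num.norm/= mx_normrE.
by apply/bigmax_leP; split => // -[i j] _; exact: xe.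
Qed.

(** Maximize G - <a, x> over the compact set [K]. For small [a] the linear form stays below G(u) / 2
    on [K], so comparison with [u] forces G > 0 at the maximizer; the last hypothesis then makes it
    interior, and the gradient of G equals [a] there. *)
Lemma perturbed_critical {R : realType} {N : nat} (G : 'rV[R]_N -> R)
    (K : set 'rV[R]_N) (u : 'rV[R]_N) (p : 'I_N -> 'rV[R]_N -> R) :
  continuous G ->
  (forall i x, exists2 q : {poly R},
    (forall s, G (x + s *: delta_mx ord0 i) = q.[s]) & q^`().[0] = p i x) ->
  closed K -> bounded_set K -> K u -> 0 < G u ->
  (forall x, K x -> 0 < G x -> nbhs x K) ->
  exists2 eta, 0 < eta & forall a : 'rV[R]_N, (forall i, `|a ord0 i| < eta) ->
    exists x, [/\ K x, 0 < G x & forall i, p i x = a ord0 i].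
Proof.
move=> Gc pq Kc Kb Ku Gu Kn.
have [M [M0 KM]] : exists M : R, 0 < M /\ forall x i, K x -> `|x ord0 i| <= M.
  have [M0 [_ KM]] := Kb; exists (Num.max (M0 + 1) 1); split.
    by rewrite lt_max ltr01 orbT.
  move=> x i Kx; have := KM (M0 + 1); rewrite ltrDl ltr01 => /(_ isT x Kx) xM.
  rewrite le_max; apply/orP; left; apply: le_trans xM.
  exact: mx_norm_coord.
(* [M] bounds the coordinates on [K]; the factor N + 1 instead of N makes the bound G(u) / 2 strict
   and covers N = 0. *)
exists (G u / (2 * N.+1%:R * M)).
  by rewrite divr_gt0// !mulr_gt0.
move=> a ae; pose H x := G x - \sum_i a ord0 i * x ord0 i.
have lin_small x : K x -> `|\sum_i a ord0 i * x ord0 i| < G u / 2.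
  move=> Kx; apply: le_lt_trans (ler_norm_sum _ _ _) _.
  apply: (@le_lt_trans _ _ (\sum_(i < N) (G u / (2 * N.+1%:R)))).
    apply: ler_sum => i _; rewrite normrM.
    apply: le_trans (_ : G u / (2 * N.+1%:R * M) * M <= _).
      by apply: ler_pM => //; [exact: ltW|exact: KM].
    by rewrite invfM mulrA divfK// lt0r_neq0.
  rewrite sumr_const card_ord -[_ *+ N]mulr_natr invfM mulrA -[ltLHS]mulrA.
  rewrite gtr_pMr ?divr_gt0// mulrC ltr_pdivrMr ?ltr0n//.
  by rewrite mul1r ltr_nat.
have Hc : continuous H.
  move=> x; apply: (@cvgB _ _ _ (nbhs x)); first exact: Gc.
  suff : continuous (fun x : 'rV[R]_N => \sum_i a ord0 i * x ord0 i) by exact.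
  apply: sum_continuous => i {}x; apply: (@cvgM _ _ (nbhs x)); first exact: cvg_cst.
  exact: coord_continuous.
have [x xK xmax] : exists2 x, x \in K & forall t, t \in K -> H t <= H x.
  apply: EVT_max_rV; first by exists u.
    exact: bounded_closed_compact.
  exact: continuous_subspaceT.
have Kx : K x by rewrite inE in xK.
have Gx : 0 < G x.
  have := xmax u; rewrite inE => /(_ Ku); rewrite /H.
  have := lin_small x Kx; have := lin_small u Ku; rewrite !ltr_norml; lra.
exists x; split=> // i.
have [q qE <-] := pq i x.
have /nbhs_ballP[d /= d0 dK] := Kn x Kx Gx.
have := @poly_local_max R (q - (a ord0 i) *: 'X) d d0 => /(_ _)/eqP.
rewrite derivB derivZ derivX !hornerE subr_eq0.
move=> h; apply/eqP/h => s sd.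
have Kxs : K (x + s *: delta_mx ord0 i).
  apply: dK; rewrite -ball_normE /= opprD addNKr normrN.
  apply: le_lt_trans sd; apply: mx_norm_le => // j k; rewrite !mxE.
  by case: (_ && _); rewrite ?mulr1// mulr0 normr0.
have := xmax (x + s *: delta_mx ord0 i); rewrite inE => /(_ Kxs).
rewrite /H; have -> : G x = q.[0] by rewrite -qE scale0r addr0.
have -> : \sum_j a ord0 j * (x + s *: delta_mx ord0 i) ord0 j =
    \sum_j a ord0 j * x ord0 j + a ord0 i * s.
  rewrite (bigD1 i)//= [in RHS](bigD1 i)//= !mxE !eqxx mulr1 mulrDr addrAC.
  congr (_ + _ + _); apply: eq_bigr => j /negbTE ji.
  by rewrite !mxE eqxx ji mulr0 addr0.
by rewrite qE !hornerE/=; lra.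
Qed.

(* Choose in each K t a critical point of G - <a, x>, with a small, generic and
   independent of t, and a linear form l separating these points.  If there are
   more than (N E + 1)^N of them, a dimension count makes the products
   (prod_i p_i^e_i) l^j linearly dependent, p being the gradient of G.  As p = a
   at the chosen points, the relation is there a nonzero polynomial in l, with
   fewer roots than points. *)
Lemma crit_count {R : realType} {N E : nat} (T : finType) (G : 'rV[R]_N -> R)
    (K : T -> set 'rV[R]_N) (u : T -> 'rV[R]_N) :
  polyfun E G ->
  (forall t, closed (K t)) -> (forall t, bounded_set (K t)) ->
  (forall t, K t (u t)) -> (forall t, 0 < G (u t)) ->
  (forall t x, K t x -> 0 < G x -> nbhs x (K t)) ->
  (forall t t' x, K t x -> K t' x -> 0 < G x -> t = t') ->
  (#|T| <= (N * E).+1 ^ N)%N.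
Proof.
move=> pG Kc Kb Ku Gu Kn Kd.
rewrite leqNgt; apply/negP; set B := ((N * E).+1 ^ N).+1 => BT.
have /choice[p pP] : forall i, exists p, polyfun E p /\ forall x,
    exists2 q : {poly R}, (forall s, G (x + s *: delta_mx ord0 i) = q.[s]) &
      q^`().[0] = p x.
  by move=> i; have [p pE pq] := polyfun_directional i pG; exists p.
have /choice[eta etaP] : forall t, exists eta, 0 < eta /\
    forall a : 'rV[R]_N, (forall i, `|a ord0 i| < eta) ->
    exists x, [/\ K t x, 0 < G x & forall i, p i x = a ord0 i].
  move=> t; have [eta eta0 etaP] := perturbed_critical (polyfun_continuous pG)
    (fun i => (pP i).2) (Kc t) (Kb t) (Ku t) (Gu t) (Kn t).
  by exists eta.
pose S := 'I_(#|{: T * T}| * N).+1.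
pose l (s : S) (x : 'rV[R]_N) := \sum_(i < N) (s%:R : R) ^+ i * x ord0 i.
have pl s : polyfun 1 (l s).
  by apply: polyfun_sum => i; apply: polyfunZ; exact: polyfun_coord.
(* The second index is the power of the linear form; [B] powers give a polynomial of degree less
   than [B], hence with fewer roots than there are points. *)
pose J := ({ffun 'I_N -> 'I_B.+1} * 'I_B)%type.
pose F s (k : J) (x : 'rV[R]_N) := (\prod_i p i x ^+ k.1 i) * l s x ^+ k.2.
have pF s k : polyfun (N * (B * E) + B) (F s k).
  apply: polyfunM; last first.
    by apply: polyfunW (polyfunX k.2 (pl s)); rewrite muln1 ltnW.
  rewrite -[X in (X * (_ * _))%N](card_ord N) cardE /index_enum -enumT.
  apply: polyfun_prod => i; apply: polyfunW (polyfunX (k.1 i) (pP i).1).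
  by rewrite leq_mul2r -ltnS ltn_ord orbT.
(* N B E + B + 1 <= (N E + 1)(B + 1), and #|J| = (B + 1)^N B with B > (N E + 1)^N. Exponents of the
   gradient up to [B] serve to cancel the factor (B + 1)^N. *)
have cJ : ((N * (B * E) + B).+1 ^ N < #|{: J}|)%N.
  rewrite card_prod card_ffun !card_ord.
  apply: (@leq_ltn_trans ((N * E).+1 ^ N * B.+1 ^ N)); last first.
    by rewrite mulnC ltn_pmul2l// expn_gt0.
  rewrite -expnMn; case: (posnP N) => [->//|N0]; rewrite leq_exp2r//.
  by rewrite mulSn mulnS; nia.
have /choice[c cP] : forall s, exists c : J -> R, (exists k, c k != 0) /\
    forall x, \sum_k c k * F s k x = 0.
  by move=> s; have [c c0 cE] := polyfun_dependent (pF s) cJ; exists c.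
have /choice[k kP] : forall s, exists k, c s k != 0 by move=> s; have [] := cP s.
(* One [a] has to serve all [t]. *)
pose eta0 := \big[Num.min/1]_t eta t.
have eta00 : 0 < eta0.
  rewrite /eta0; elim/big_ind : _ => //= [y z y0 z0|t _]; last by have [] := etaP t.
  by rewrite lt_min y0.
(* Read the relation for [s] as a polynomial in the linear form, with coefficients polynomial in the
   gradient. The coefficient of degree [(k s).2] is not identically zero, and [a] avoids its zeros
   for all [s] at once. *)
have [a ae aC] := @common_nonzero R N B S (fun s e => c s (e, (k s).2)) eta0 eta00
  (fun s => ex_intro _ (k s).1 (etrans (congr1 (fun z => c s z != 0)
     (esym (surjective_pairing (k s)))) (kP s))).
have /choice[x xP] : forall t, exists x, [/\ K t x, 0 < G x & forall i, p i x = a ord0 i].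
  move=> t; apply: (etaP t).2 => i; apply: lt_le_trans (ae i) _.
  exact: bigmin_le_cond.
have xI : injective x.
  move=> t t' xt; have [Kt Gt _] := xP t; have [Kt' _ _] := xP t'.
  by apply: Kd Gt => //; rewrite xt.
have [s sI] := separating_functional xI.
pose D (j : 'I_B) := \sum_e c s (e, j) * mono [ffun i => e i : nat] a.
pose P : {poly R} := \sum_j D j *: 'X^j.
have P0 : P != 0.
  apply: contraNneq (aC s) => P0; have := coef0 R (k s).2.
  rewrite -P0 coef_sum (bigD1 (k s).2)//= coefZ coefXn eqxx mulr1.
  rewrite big1 ?addr0 => [/eqP//|j jk]; rewrite coefZ coefXn.
  by rewrite eq_sym (_ : (_ == _) = false) ?mulr0//; exact/negbTE.
have sP : (size P <= B)%N.
  apply: (leq_trans (size_sum _ _ _)); apply/bigmax_leqP => j _.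
  by apply: leq_trans (size_scale_leq _ _) _; rewrite size_polyXn.
pose r := [seq l s (x t) | t <- enum T].
have ur : uniq r by rewrite map_inj_uniq ?enum_uniq.
have rr : all (root P) r.
  apply/allP => _ /mapP[t _ ->]; rewrite rootE horner_sum; apply/eqP.
  rewrite -[RHS]((cP s).2 (x t)).
  under eq_bigr do rewrite hornerZ hornerXn mulr_suml.
  rewrite exchange_big pair_bigA/=; apply: eq_bigr => -[e j] _ /=.
  rewrite -mulrA; congr (_ * (_ * _)); apply: eq_bigr => i _.
  by have [_ _ ->] := xP t; rewrite ffunE.
have := leq_trans (max_poly_roots P0 rr ur) sP.
by rewrite size_map -cardE ltnNge BT.
Qed.

Lemma cvg_sumr {R : realType} (T : Type) (F : set_system T) {FF : Filter F}
    (I : Type) (r : seq I) (f : I -> T -> R) (l : I -> R) :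
  (forall i, f i x @[x --> F] --> l i) ->
  \sum_(i <- r) f i x @[x --> F] --> \sum_(i <- r) l i.
Proof.
move=> fl; elim: r => [|i r IH].
  by under eq_fun do rewrite big_nil; rewrite big_nil; exact: cvg_cst.
by under eq_fun do rewrite big_cons; rewrite big_cons; exact: cvgD.
Qed.

(** * Covering families of largest eigenvalues *)

Section QuadraticForms.
Context {R : realType} {m : nat}.
Implicit Types (A B M : 'M[R]_m) (v w : 'cV[R]_m).

Definition bf A w v : R := \sum_i \sum_j A i j * (w i ord0 * v j ord0).
Definition sqn v : R := \sum_i v i ord0 ^+ 2.
Definition pd A := forall v, v != 0 -> 0 < bf A v v.

Lemma bfE A v : (v^T *m A *m v) ord0 ord0 = bf A v v.
Proof.
rewrite mxE /bf exchange_big; apply: eq_bigr => j _.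
rewrite mxE mulr_suml; apply: eq_bigr => i _; rewrite mxE; ring.
Qed.

Lemma psdP A : psd A <-> forall v, 0 <= bf A v v.
Proof. by split=> h v; move: (h v); rewrite bfE. Qed.

Lemma bfDl A u w v : bf A (u + w) v = bf A u v + bf A w v.
Proof.
rewrite /bf -big_split; apply: eq_bigr => i _; rewrite -big_split.
by apply: eq_bigr => j _; rewrite mxE /=; ring.
Qed.

Lemma bfZl A a w v : bf A (a *: w) v = a * bf A w v.
Proof.
rewrite /bf mulr_sumr; apply: eq_bigr => i _; rewrite mulr_sumr.
by apply: eq_bigr => j _; rewrite mxE /=; ring.
Qed.

Lemma bfC A w v : A^T = A -> bf A w v = bf A v w.
Proof.
move=> As; rewrite /bf exchange_big; apply: eq_bigr => j _; apply: eq_bigr => i _.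
by rewrite -{1}As mxE; ring.
Qed.

Lemma bfDr A u w v : bf A v (u + w) = bf A v u + bf A v w.
Proof.
rewrite /bf -big_split; apply: eq_bigr => i _; rewrite -big_split.
by apply: eq_bigr => j _; rewrite mxE /=; ring.
Qed.

Lemma bfZr A a w v : bf A v (a *: w) = a * bf A v w.
Proof.
rewrite /bf mulr_sumr; apply: eq_bigr => i _; rewrite mulr_sumr.
by apply: eq_bigr => j _; rewrite mxE /=; ring.
Qed.

Lemma bf0l A v : bf A 0 v = 0.
Proof. by rewrite -(scale0r 0) bfZl mul0r. Qed.

Lemma sqn0 : sqn 0 = 0.
Proof. by rewrite /sqn big1// => i _; rewrite mxE expr0n. Qed.

Lemma bf_mulmx A w v : bf A w v = \sum_i w i ord0 * (A *m v) i ord0.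
Proof.
apply: eq_bigr => i _; rewrite mxE mulr_sumr.
by apply: eq_bigr => j _; ring.
Qed.

Lemma bfDm A B w v : bf (A + B) w v = bf A w v + bf B w v.
Proof.
rewrite /bf -big_split; apply: eq_bigr => i _; rewrite -big_split.
by apply: eq_bigr => j _; rewrite mxE /=; ring.
Qed.

Lemma bfZm a A w v : bf (a *: A) w v = a * bf A w v.
Proof.
rewrite /bf mulr_sumr; apply: eq_bigr => i _; rewrite mulr_sumr.
by apply: eq_bigr => j _; rewrite mxE /=; ring.
Qed.

Lemma bf_scalar a v : bf a%:M v v = a * sqn v.
Proof.
rewrite bf_mulmx mulr_sumr; apply: eq_bigr => i _.
by rewrite mul_scalar_mx mxE expr2; ring.
Qed.

Lemma bf_shift t M v : bf (t%:M - M) v v = t * sqn v - bf M v v.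
Proof. by rewrite bfDm bf_scalar -scaleN1r bfZm mulN1r. Qed.

Lemma sqn_ge0 v : 0 <= sqn v.
Proof. by apply: sumr_ge0 => i _; exact: sqr_ge0. Qed.

Lemma coord_sqn v i : v i ord0 ^+ 2 <= sqn v.
Proof.
by rewrite /sqn (bigD1 i)//= lerDl; apply: sumr_ge0 => j _; exact: sqr_ge0.
Qed.

Lemma sqn_gt0 v : v != 0 -> 0 < sqn v.
Proof.
case/cV0Pn => i vi; apply: lt_le_trans (coord_sqn v i).
by rewrite exprn_even_gt0.
Qed.

Lemma bf_bound A v : `|bf A v v| <= (\sum_i \sum_j `|A i j|) * sqn v.
Proof.
apply: le_trans (ler_norm_sum _ _ _) _; rewrite mulr_suml; apply: ler_sum => i _.
apply: le_trans (ler_norm_sum _ _ _) _; rewrite mulr_suml; apply: ler_sum => j _.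
rewrite normrM ler_wpM2l//.
have := coord_sqn v i; have := coord_sqn v j.
have := sqr_ge0 (v i ord0 + v j ord0); have := sqr_ge0 (v i ord0 - v j ord0).
by rewrite ler_norml; move=> ? ? ? ?; apply/andP; split; nra.
Qed.

(** Cauchy-Schwarz, from the nonnegativity of A along the line w + s v. If v is isotropic, the form
    is affine in s there, so its slope must vanish. *)
Lemma psd_bilinear A w v : A^T = A -> psd A ->
  bf A w v ^+ 2 <= bf A w w * bf A v v.
Proof.
move=> As /psdP Ap.
have h s : 0 <= bf A w w + 2 * s * bf A w v + s ^+ 2 * bf A v v.
  have := Ap (w + s *: v).
  by rewrite !(bfDl, bfDr, bfZl, bfZr) [bf A v w](bfC _ _ As); lra.
have [v0|v0] := eqVneq (bf A v v) 0.
  rewrite v0 mulr0 real_exprn_even_le0 ?num_real//.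
  apply/negPn/negP => wv.
  have := h (- (bf A w w + 1) / (2 * bf A w v)).
  rewrite v0 mulr0 addr0.
  have -> : 2 * (- (bf A w w + 1) / (2 * bf A w v)) * bf A w v = - (bf A w w + 1).
    by field.
  lra.
have vp : 0 < bf A v v by rewrite lt_def v0 Ap.
have := h (- bf A w v / bf A v v).
have -> : bf A w w + 2 * (- bf A w v / bf A v v) * bf A w v +
  (- bf A w v / bf A v v) ^+ 2 * bf A v v = bf A w w - bf A w v ^+ 2 / bf A v v.
  by field.
by rewrite subr_ge0 ler_pdivrMr.
Qed.

(** A lower bound playing the role of the smallest eigenvalue. With w = A v, Cauchy-Schwarz gives
    |w|^4 <= (w^T A w)(v^T A v), hence |w|^2 is at most a multiple of v^T A v; and |v|^2 is at most
    a multiple of |w|^2 because A is invertible. *)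
Lemma psd_unit_gap A : A^T = A -> psd A -> A \in unitmx ->
  exists2 eta, 0 < eta & forall v, eta * sqn v <= bf A v v.
Proof.
move=> As Ap Au; have Ap' := iffLR (psdP A) Ap.
pose c B : R := 1 + \sum_i \sum_j `|B i j|.
have c0 B : 0 < c B.
  by rewrite ltr_pwDl//; apply: sumr_ge0 => i _; apply: sumr_ge0.
have sqB B v : sqn (B *m v) <= c (B^T *m B) * sqn v.
  have -> : sqn (B *m v) = bf (B^T *m B) v v.
    rewrite -bfE !mulmxA -mulmxA -trmx_mul mxE; apply: eq_bigr => i _.
    by rewrite [X in _ = X * _]mxE expr2.
  apply: le_trans (ler_norm _) _; apply: le_trans (bf_bound _ _) _.
  by rewrite ler_wpM2r ?sqn_ge0// lerDr.
exists (c ((invmx A)^T *m invmx A) * c A)^-1; first by rewrite invr_gt0 mulr_gt0.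
move=> v; rewrite mulrC ler_pdivrMr ?mulr_gt0// [leRHS]mulrC -mulrA.
have -> : sqn v = sqn (invmx A *m (A *m v)) by rewrite mulKmx.
apply: le_trans (sqB _ _) _; rewrite ler_pM2l//.
set w := A *m v.
have [->|w0] := eqVneq (sqn w) 0; first by rewrite mulr_ge0 ?(ltW (c0 _)).
have wp : 0 < sqn w by rewrite lt_def w0 sqn_ge0.
have := psd_bilinear w v As Ap.
have -> : bf A w v = sqn w.
  by rewrite bf_mulmx; apply: eq_bigr => i _; rewrite expr2.
move=> /le_trans/(_ (ler_wpM2r _ (le_trans (ler_norm _) (bf_bound A w)))).
move=> /(_ (Ap' v)) h.
rewrite -(ler_pM2l wp) -expr2; apply: le_trans h _.
rewrite [leRHS]mulrCA mulrA; apply: ler_wpM2r; first exact: Ap'.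
by rewrite ler_wpM2r ?sqn_ge0// lerDr.
Qed.

Lemma pd_psd A : pd A -> psd A.
Proof.
move=> Ap; apply/psdP => v; have [->|/Ap/ltW//] := eqVneq v 0.
by rewrite bf0l.
Qed.

Lemma pd_unit A : pd A -> A \in unitmx.
Proof.
move=> Ap; rewrite -row_free_unit -kermx_eq0 -[_ == _]negbK; apply/negP => /rowV0Pn[v].
move=> /sub_kermxP vA v0; have := Ap v^T.
rewrite -bfE trmxK vA mul0mx mxE ltxx trmx_eq0 => /(_ v0).
by [].
Qed.

Lemma psd_unit_pd A : A^T = A -> psd A -> A \in unitmx -> pd A.
Proof.
move=> As Ap Au v v0; have [eta eta0 h] := psd_unit_gap As Ap Au.
by apply: lt_le_trans (h v); rewrite mulr_gt0 ?sqn_gt0.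
Qed.

(** A perturbation whose entries have total absolute value below the gap of [psd_unit_gap] preserves
    definiteness. *)
Lemma pd_open (T : topologicalType) (B : T -> 'M[R]_m) (x : T) :
  (forall i j, {for x, continuous (fun y => B y i j)}) ->
  (B x)^T = B x -> pd (B x) -> \forall y \near x, pd (B y).
Proof.
move=> Bc Bs Bp; have [eta eta0 h] := psd_unit_gap Bs (pd_psd Bp) (pd_unit Bp).
have : (\sum_i \sum_j `|B y i j - B x i j|) @[y --> x] -->
    \sum_i \sum_j `|B x i j - B x i j|.
  apply: cvg_sumr => i; apply: cvg_sumr => j.
  by apply: cvg_norm; apply: cvgB; [exact: Bc|exact: cvg_cst].
rewrite [X in _ --> X]big1; last first.
  by move=> i _; rewrite big1// => j _; rewrite subrr normr0.
move=> /cvgr_lt/(_ _ eta0); apply: filterS => y ye v v0.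
have -> : bf (B y) v v = bf (B x) v v + bf (B y - B x) v v.
  by rewrite -bfDm addrC subrK.
have := bf_bound (B y - B x) v; under eq_bigr do under eq_bigr do rewrite !mxE.
rewrite ler_norml => /andP[h1 _]; have := h v; have := sqn_gt0 v0.
nra.
Qed.

Lemma bf_continuous (T : topologicalType) (B : T -> 'M[R]_m) (x : T) v :
  (forall i j, {for x, continuous (fun y => B y i j)}) ->
  {for x, continuous (fun y => bf (B y) v v)}.
Proof.
move=> Bc; apply: cvg_sumr => i; apply: cvg_sumr => j.
by apply: cvgM; [exact: Bc|exact: cvg_cst].
Qed.

End QuadraticForms.

(** * Largest eigenvalues through the definiteness of t I - M *)

Section LambdaMax.
Context {R : realType} {m : nat}.
Implicit Types (M : 'M[R]_m) (v w : 'cV[R]_m).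

(* Characterizes the largest eigenvalue without diagonalization, in a form that
   support functions of spectratopes satisfy directly. *)
Definition is_lmax M (a : R) :=
  (forall t, a < t -> pd (t%:M - M)) /\ (forall t, t < a -> ~ psd (t%:M - M)).

Lemma shift_sym t M : M^T = M -> (t%:M - M)^T = t%:M - M.
Proof. by move=> Ms; rewrite linearB /= tr_scalar_mx Ms. Qed.

(** Let s be the infimum of the t with t I - M positive semidefinite; it is attained. If s I - M
    were invertible, [psd_unit_gap] would allow a smaller t, so s is an eigenvalue; evaluating the
    form at eigenvectors shows that no eigenvalue exceeds s. *)
Lemma is_lmax_lambda_max M : (0 < m)%N -> M^T = M -> is_lmax M (lambda_max M).
Proof.
move=> m0 Ms.
pose S := [set t : R | psd (t%:M - M)].
pose e : 'cV[R]_m := delta_mx (Ordinal m0) ord0.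
have e0 : e != 0.
  apply/cV0Pn; exists (Ordinal m0); by rewrite mxE !eqxx oner_neq0.
have S0 : S !=set0.
  exists (\sum_i \sum_j `|M i j|); apply/psdP => v; rewrite bf_shift subr_ge0.
  by apply: le_trans (ler_norm _) (bf_bound _ _).
have lbS v t : v != 0 -> S t -> bf M v v / sqn v <= t.
  move=> v0 /psdP/(_ v); rewrite bf_shift subr_ge0.
  by rewrite ler_pdivrMr// sqn_gt0.
have Slb : has_inf S by split => //; exists (bf M e e / sqn e) => t; exact: lbS.
pose s := inf S.
have Ss : S s.
  apply/psdP => v; rewrite bf_shift subr_ge0.
  have [->|v0] := eqVneq v 0.
    by rewrite bf0l sqn0 mulr0.
  rewrite -ler_pdivrMr ?sqn_gt0//; apply: lb_le_inf => // t; exact: lbS.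
have sE : eigenvalue M s.
  have : s%:M - M \notin unitmx.
    apply/negP => u; have [eta eta0 h] := psd_unit_gap (shift_sym s Ms) Ss u.
    suff : S (s - eta).
      by move=> /(ge_inf Slb.2); rewrite -/s; lra.
    apply/psdP => v; have := h v; rewrite !bf_shift; lra.
  rewrite -row_free_unit -kermx_eq0 => /rowV0Pn[v /sub_kermxP vA v0].
  apply/eigenvalueP; exists v => //; apply/eqP; rewrite -subr_eq0 -mul_mx_scalar.
  by rewrite -mulmxBr -opprB mulmxN vA oppr0.
have smax a : eigenvalue M a -> a <= s.
  move=> /eigenvalueP[v vM v0]; move/psdP/(_ v^T): Ss.
  rewrite bf_shift -bfE trmxK vM -scalemxAl mxE.
  have -> : (v *m v^T) ord0 ord0 = sqn v^T.
    by rewrite mxE; apply: eq_bigr => i _; rewrite !mxE expr2.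
  rewrite -mulrBl pmulr_lge0 ?subr_ge0// sqn_gt0// trmx_eq0//.
have -> : lambda_max M = s.
  apply/eqP; rewrite eq_le; apply/andP; split.
    by apply: ge_sup; [exists s|].
  by apply: ub_le_sup => //; exists s.
split=> t st.
  move=> v v0; rewrite bf_shift; move/psdP/(_ v): Ss; rewrite bf_shift.
  by have := sqn_gt0 v0; nra.
by move=> /(ge_inf Slb.2); rewrite -/s leNgt st.
Qed.

(** Both bounds are open conditions: definiteness slightly above the value persists nearby, and so
    does the negativity of the form at a fixed vector slightly below it. *)
Lemma is_lmax_continuous (T : topologicalType) (B : T -> 'M[R]_m) (h : T -> R) (x : T) :
  (forall i j, {for x, continuous (fun y => B y i j)}) ->
  (forall y, (B y)^T = B y) -> (forall y, is_lmax (B y) (h y)) ->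
  {for x, continuous h}.
Proof.
move=> Bc Bs Bh.
have Bct t i j : {for x, continuous (fun y => (t%:M - B y) i j)}.
  rewrite (_ : (fun y => _) = fun y => (t%:M : 'M[R]_m) i j - B y i j).
    by apply: cvgB; [exact: cvg_cst|exact: Bc].
  by apply/funext => y; rewrite !mxE.
apply/cvgrPdist_lt => eps eps0.
have near1 : \forall y \near x, h y < h x + eps.
  have hx : h x < h x + eps / 2 by lra.
  have := pd_open (Bct (h x + eps / 2)) (shift_sym _ (Bs x)) ((Bh x).1 _ hx).
  apply: filterS => y py.
  rewrite ltNge; apply/negP => hy; apply: ((Bh y).2 (h x + eps / 2)); last exact: pd_psd.
  lra.
have near2 : \forall y \near x, h x - eps < h y.
  have hx : h x - eps / 2 < h x by lra.
  have [v vlt] : exists v, bf ((h x - eps / 2)%:M - B x) v v < 0.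
    apply/not_existsP => h0; apply: ((Bh x).2 _ hx); apply/psdP => v.
    by rewrite leNgt; apply/negP.
  have := bf_continuous (v := v) (Bct (h x - eps / 2)) => /cvgr_lt/(_ 0 vlt).
  apply: filterS => y vy; rewrite ltNge; apply/negP => hy.
  have hye : h y < h x - eps / 2 by lra.
  by have /psdP/(_ v) := pd_psd ((Bh y).1 _ hye); rewrite leNgt vy.
near=> y; rewrite ltr_norml; apply/andP; split.
  have : h y < h x + eps by near: y. lra.
have : h x - eps < h y by near: y. lra.
Unshelve. all: by end_near. Qed.

End LambdaMax.

Lemma horner_char_poly {R : comNzRingType} {m : nat} (A : 'M[R]_m) (a : R) :
  (char_poly A).[a] = \det (a%:M - A).
Proof.
rewrite -horner_evalE -det_map_mx; congr (\det _); apply/matrixP => i j.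
by rewrite !mxE /= !horner_evalE !hornerE hornerMn hornerX.
Qed.

(** * Counting sign patterns, and the covering bound *)

Section PatternCount.
Context {R : realType} {m N : nat} (Z : finType).
Variables (M : Z -> 'rV[R]_N -> 'M[R]_m).
Hypothesis pM : forall z i j, polyfun 1 (fun x => M z x i j).
Hypothesis sM : forall z x, (M z x)^T = M z x.

(** The product over all indices of the characteristic polynomials, shifted by the levels, is a
    nonzero polynomial in [tau]. *)
Lemma generic_shift (T : finType) (L : finType) (th : T -> 'rV[R]_N)
    (s : L -> R) (d : R) : 0 < d ->
  exists2 tau, 0 < tau < d &
    forall t z l, \det ((s l + tau)%:M - M z (th t)) != 0.
Proof.
move=> d0.
pose P : {poly R} := \prod_(u : T * Z * L)
  (char_poly (M u.1.2 (th u.1.1)) \Po ('X + (s u.2)%:P)).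
have P0 : P != 0.
  apply/prodf_neq0 => u _; rewrite comp_poly2_eq0 ?size_XaddC//.
  by rewrite monic_neq0// char_poly_monic.
have [tau taud rt] := nonroot_small P0 d0; exists tau => // t z l.
move: rt; rewrite horner_prod => /prodf_neq0/(_ (t, z, l) isT)/=.
by rewrite horner_comp hornerD hornerX hornerC horner_char_poly [tau + _]addrC.
Qed.

Section Fixed.
Variables (T : finType) (L : finType) (th : T -> 'rV[R]_N) (thr : L -> R) (rad : R).
Hypothesis thr_generic : forall t z l, \det ((thr l)%:M - M z (th t)) != 0.
Hypothesis th_rad : forall t, \sum_i th t ord0 i ^+ 2 < rad.
Let B (u : Z * L) (x : 'rV[R]_N) := (thr u.2)%:M - M u.1 x.
Hypothesis th_separated : forall t t', t != t' ->
  exists u, psd (B u (th t)) /\ ~ psd (B u (th t')) \/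
            psd (B u (th t')) /\ ~ psd (B u (th t)).

(* Where g does not vanish, the thresholds see no difference between psd and pd,
   so that the sets K t below are both closed and open there. *)
Let g (x : 'rV[R]_N) := (rad - \sum_i x ord0 i ^+ 2) * \prod_u \det (B u x).

Lemma polyfun_threshold u i j : polyfun 1 (fun x => B u x i j).
Proof.
rewrite /B; apply: (polyfun_ext (f := fun x => (thr u.2)%:M i j - M u.1 x i j)).
  by move=> x; rewrite !mxE.
apply: polyfunB; first by apply: polyfunW (polyfun_cst _).
exact: pM.
Qed.

Lemma threshold_continuous u i j : continuous (fun x => B u x i j).
Proof. exact: polyfun_continuous (polyfun_threshold u i j). Qed.

Lemma threshold_sym u x : (B u x)^T = B u x.
Proof. by apply: shift_sym. Qed.

Lemma polyfun_discriminant : polyfun (2 + #|{: Z * L}| * m) g.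
Proof.
apply: polyfunM.
  apply: polyfunB; first by apply: polyfunW (polyfun_cst _).
  by apply: polyfun_sum => i; exact: polyfunX 2 (polyfun_coord i).
rewrite cardE /index_enum -enumT; apply: polyfun_prod => u.
apply: (@polyfunW _ _ (m * 1)); first by rewrite muln1.
by apply: polyfun_det => i j; exact: polyfun_threshold.
Qed.

(** The ball makes the sets bounded. Its boundary lies in the zero set of [g], thanks to the factor
    [rad] - |x|^2. *)
Let K t := [set x : 'rV[R]_N | \sum_i x ord0 i ^+ 2 <= rad] `&`
  \bigcap_u (if `[< psd (B u (th t)) >] then [set x | psd (B u x)]
             else [set x | ~ pd (B u x)]).

Lemma closed_psd u : closed [set x | psd (B u x)].
Proof.
rewrite (_ : [set x | _] = \bigcap_v [set x | 0 <= bf (B u x) v v]).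
  apply: closed_bigI => v _.
  apply: (@preimage_closed _ _ (fun x => bf (B u x) v v) [set y | 0 <= y]).
    by move=> x _; apply: bf_continuous => i j; exact: threshold_continuous.
  exact: closed_ge.
by apply/seteqP; split=> x /= => [/psdP h v _|h]; [exact: h|apply/psdP => v; exact: h].
Qed.

Lemma closed_npd u : closed [set x | ~ pd (B u x)].
Proof.
rewrite (_ : [set x | _] = ~` [set x | pd (B u x)])//.
apply: open_closedC; rewrite openE => x px.
suff: \forall y \near x, pd (B u y) by [].
apply: pd_open => [i j||//]; first exact: threshold_continuous.
exact: threshold_sym.
Qed.

(** [crit_count] applied to g^2, which is positive exactly off the zeros of [g] and has twice its
    degree. Distinct indices are separated by a threshold, which makes their sets disjoint there. *)
Lemma pattern_count : (#|T| <= (N * (2 * (2 + #|{: Z * L}| * m))).+1 ^ N)%N.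
Proof.
have sqr_cont : continuous (fun x : 'rV[R]_N => \sum_i x ord0 i ^+ 2).
  apply: sum_continuous => i x.
  exact: (continuous_comp (@coord_continuous _ _ _ _ _ _) (@exprn_continuous _ _ _)).
have gP t x : K t x -> 0 < g x ^+ 2 -> \sum_i x ord0 i ^+ 2 < rad /\
    forall u, B u x \in unitmx.
  rewrite exprn_even_gt0//= => -[Kx _]; rewrite mulf_eq0 negb_or subr_eq0.
  move=> /andP[xr /prodf_neq0 xu]; split; last by move=> u; rewrite unitmxE unitfE xu.
  by rewrite lt_neqAle eq_sym xr.
apply: (@crit_count R N _ T (fun x => g x ^+ 2) K th).
- exact: polyfunX 2 polyfun_discriminant.
- move=> t; apply: closedI.
    apply: (@preimage_closed _ _ (fun x : 'rV[R]_N => \sum_i x ord0 i ^+ 2) [set y | y <= rad]).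
      by move=> x _; exact: sqr_cont.
    exact: closed_le.
  by apply: closed_bigI => u _; case: ifP => _; [exact: closed_psd|exact: closed_npd].
- move=> t; exists (1 + rad); split; first exact: num_real.
  move=> r rr x [Kx _]; apply: le_trans (ltW rr); apply: mx_norm_le.
    by rewrite addr_ge0// (le_trans _ Kx)//; apply: sumr_ge0 => i _; exact: sqr_ge0.
  move=> i j; rewrite ord1.
  have : x ord0 j ^+ 2 <= rad.
    apply: le_trans Kx; rewrite (bigD1 j)//= lerDl.
    by apply: sumr_ge0 => k _; exact: sqr_ge0.
  by rewrite ler_norml; have := sqr_ge0 (x ord0 j - 1); have := sqr_ge0 (x ord0 j + 1); nra.
- move=> t; split; first exact: ltW (th_rad t).
  move=> u _; case: ifPn => [/asboolP//|/asboolP n] /= p.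
  by apply: n; exact: pd_psd.
- move=> t; rewrite exprn_even_gt0//= mulf_neq0//.
    by rewrite subr_eq0 gt_eqF.
  by apply/prodf_neq0 => u _; exact: thr_generic.
- move=> t x Ktx gx; have [xr xu] := gP t x Ktx gx.
  apply: filterI.
    apply: filterS (cvgr_lt _ (sqr_cont x) _ xr) => y; exact: ltW.
  pose C u := if `[< psd (B u (th t)) >] then [set x | psd (B u x)]
    else [set x | ~ pd (B u x)].
  have : \forall y \near x, forall u, C u y.
    apply: (@filter_forall _ _ C (nbhs x) _) => u; rewrite /C.
    have := Ktx.2 u I; case: ifP => _ /= h.
      apply: filterS (pd_open _ (threshold_sym u x) _) => [y|i j|].
      - exact: pd_psd.
      - exact: threshold_continuous.
      - by apply: psd_unit_pd => //; exact: threshold_sym.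
    have [v vlt] : exists v, bf (B u x) v v < 0.
      apply/not_existsP => h0; apply: h; apply: psd_unit_pd => //.
        exact: threshold_sym.
      by apply/psdP => v; rewrite leNgt; apply/negP.
    apply: filterS (cvgr_lt _ (bf_continuous (v := v) _) _ vlt) => [y vy py|i j].
      by have /psdP/(_ v) := pd_psd py; rewrite leNgt vy.
    exact: threshold_continuous.
  by apply: filterS => y h u _; exact: h.
- move=> t t' x Ktx Kt'x gx; apply/eqP/negPn/negP => /th_separated[u].
  have [_ /(_ u) xu] := gP t x Ktx gx.
  have h s s' : K s x -> K s' x -> psd (B u (th s)) -> ~ psd (B u (th s')) -> False.
    move=> Ks Ks' ps ps'.
    have := Ks.2 u I; rewrite asboolT//= => px.
    have := Ks'.2 u I; rewrite asboolF//=; apply.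
    by apply: psd_unit_pd => //; exact: threshold_sym.
  by case=> -[]; exact: h.
Qed.

End Fixed.

Section Cover.
Variables (T : finType) (th : T -> 'rV[R]_N) (val : T -> Z -> R) (Gamma : R) (J : nat).
Hypothesis Gamma0 : 0 < Gamma.
Hypothesis J0 : (0 < J)%N.
Hypothesis val_lmax : forall t z, is_lmax (M z (th t)) (val t z).
Hypothesis val_bounded : forall t z, `|val t z| <= Gamma.

(** Levels with spacing [d] = 2 Gamma / J, shifted by a generic [tau] in (0, d): two values more
    than [d] apart have a level strictly between them, where exactly one of the two matrices is
    positive semidefinite. *)
Lemma separated_count : (forall t t', t != t' ->
    exists z, 2 * Gamma / J%:R < `|val t z - val t' z|) ->
  (#|T| <= (N * (2 * (2 + #|Z| * J.+1 * m))).+1 ^ N)%N.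
Proof.
move=> sep; pose d := 2 * Gamma / J%:R.
have d0 : 0 < d by rewrite divr_gt0 ?ltr0n// mulr_gt0.
pose s (l : 'I_J.+1) : R := - Gamma + l%:R * d.
have [tau /andP[tau0 taud] det0] := @generic_shift T _ th s d d0.
rewrite -[X in (_ * X * m)%N]card_ord -card_prod.
pose rad := 1 + \sum_t \sum_i th t ord0 i ^+ 2.
have q0 t : 0 <= \sum_i th t ord0 i ^+ 2 by apply: sumr_ge0 => i _; exact: sqr_ge0.
apply: (@pattern_count T _ th (fun l => s l + tau) rad) => [t z l|t|t t' tt'].
- exact: det0.
- rewrite /rad (bigD1 t)//= addrCA ltrDl ltr_pwDl//.
  by apply: sumr_ge0 => u _.
have [z dz] := sep t t' tt'.
have main a b : val a z + d < val b z ->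
    exists u : Z * 'I_J.+1, psd ((s u.2 + tau)%:M - M u.1 (th a)) /\
      ~ psd ((s u.2 + tau)%:M - M u.1 (th b)).
  move=> ab.
  suff [l [la lb]] : exists l : 'I_J.+1, val a z < s l + tau /\ s l + tau < val b z.
    exists (z, l); split; first by apply: pd_psd; apply: (val_lmax a z).1.
    exact: (val_lmax b z).2.
  (* The least level above the smaller value. It exists since the top level is Gamma + [tau], and it
     lies below the larger value, being at most one mesh above the smaller one or equal to the
     bottom level -Gamma + [tau]. *)
  have ex : exists k, val a z < - Gamma + k%:R * d + tau.
    exists J; rewrite /d mulrC divfK ?pnatr_eq0 -?lt0n//.
    by have := val_bounded a z; rewrite ler_norml => /andP[_ ?]; lra.
  case: (ex_minnP ex) => k ka kmin.
  have kJ : (k < J.+1)%N.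
    rewrite ltnS; apply: kmin; rewrite /d mulrC divfK ?pnatr_eq0 -?lt0n//.
    by have := val_bounded a z; rewrite ler_norml => /andP[_ ?]; lra.
  exists (Ordinal kJ); split => //=; rewrite /s/=.
  case: k {kJ} ka kmin => [|k] ka kmin.
    by have := val_bounded a z; rewrite ler_norml mul0r => /andP[? _]; lra.
  have : ~~ (val a z < - Gamma + k%:R * d + tau).
    by apply/negP => /kmin; rewrite ltnn.
  by rewrite -leNgt mulrS mulrDl mul1r; lra.
move: dz; rewrite -/d ltr_normr => /orP[] h.
  by have [|u uP] := main t' t; [lra|exists u; right].
by have [|u uP] := main t t'; [lra|exists u; left].
Qed.

End Cover.

(** A maximal separated subset is a net, of size bounded by [separated_count]. The net consists of
    members of the family, so its functions keep the bound [Gamma]. *)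
Lemma lmax_cover (T : finType) (th : T -> 'rV[R]_N) (val : T -> Z -> R)
    (Gamma : R) (J : nat) :
  0 < Gamma -> (0 < J)%N ->
  (forall t z, is_lmax (M z (th t)) (val t z)) ->
  (forall t z, `|val t z| <= Gamma) ->
  exists2 pi : T -> T,
    (#|pi @: T| <= (N * (2 * (2 + #|Z| * J.+1 * m))).+1 ^ N)%N &
    forall t z, `|val t z - val (pi t) z| <= 2 * Gamma / J%:R.
Proof.
move=> G0 J0 vl vb; pose d := 2 * Gamma / J%:R.
have d0 : 0 < d by rewrite divr_gt0 ?ltr0n// mulr_gt0.
pose far t t' := [exists z, d < `|val t z - val t' z|].
have farC t t' : far t t' = far t' t.
  by apply: eq_existsb => z; rewrite distrC.
pose P (A : {set T}) := [forall t in A, forall t' in A, (t != t') ==> far t t'].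
have P0 : P finset.set0 by apply/forall_inP => t; rewrite inE.
have [A /maxsetP[PA Amax] _] := maxset_exists P0.
have near t : exists t', (t' \in A) && ~~ far t t'.
  have [tA|tA] := boolP (t \in A).
    exists t; rewrite tA; apply/existsPn => z.
    by rewrite subrr normr0 -leNgt ltW.
  apply/existsP; apply: contraT => /existsPn h.
  have tfar t' : t' \in A -> far t t'.
    by move=> t'A; have := h t'; rewrite t'A negbK.
  suff PtA : P (t |: A).
    by move: tA; rewrite -(Amax _ PtA (finset.subsetUr _ _)) finset.setU11.
  apply/forall_inP => a; rewrite !inE => aA; apply/forall_inP => b; rewrite !inE => bA.
  apply/implyP => ab; case/predU1P: aA ab => [->|aA]; case/predU1P: bA => [->|bA].
  - by rewrite eqxx.
  - by move=> _; exact: tfar.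
  - by move=> _; rewrite farC; exact: tfar.
  - move=> ab; move/forall_inP/(_ a aA)/forall_inP/(_ b bA)/implyP: PA; exact.
have [pi piP] := choice near.
exists pi; last first.
  move=> t z; have /andP[_ /existsPn/(_ z)] := piP t.
  by rewrite -leNgt.
apply: (@leq_trans #|A|).
  by apply/subset_leq_card/fintype.subsetP => _ /imsetP[t _ ->]; have /andP[] := piP t.
rewrite -card_sig.
apply: (@separated_count _ (fun t : {t | t \in A} => th (sval t))
  (fun t => val (sval t)) Gamma J) => // t t' tt'.
move/forall_inP/(_ _ (valP t))/forall_inP/(_ _ (valP t'))/implyP: PA.
by move=> /(_ tt')/existsP.
Qed.

End PatternCount.

Local Open Scope ereal_scope.

(** * Ghost samples and maximal inequalities *)

(** Completing the square: exp(t x) times the density of N(0, s^2) is exp(s^2 t^2 / 2) times the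
    density of N(s^2 t, s^2). *)
Lemma normal_mgf {R : realType} (s t : R) : (0 < s)%R ->
  \int[normal_prob 0%R s]_x (expR (t * x))%:E = (expR (s ^+ 2 * t ^+ 2 / 2))%:E.
Proof.
move=> s0; have s0' : s != 0%R by rewrite gt_eqF.
set nu := normal_prob 0%R s; set leb := @lebesgue_measure R.
have mexp : measurable_fun [set: R] (fun x => (expR (t * x))%:E).
  by apply/measurable_EFinP; apply: measurableT_comp => //; exact: mulrl_measurable.
have numu : nu `<< leb by exact: normal_prob_dominates.
rewrite -(Radon_Nikodym_SigmaFinite.change_of_variables numu)//.
(* [normal_pdf] is a version of the Radon-Nikodym derivative, the integrals over all measurable sets
   being equal. *)
have aeq : ae_eq leb [set: R] (fun x => (normal_pdf 0 s x)%:E)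
    (Radon_Nikodym_SigmaFinite.f nu leb).
  apply: integral_ae_eq => //.
  - exact: integrable_normal_pdf.
  - exact: measurable_int (Radon_Nikodym_SigmaFinite.f_integrable numu).
  - by move=> A _ mA; rewrite -Radon_Nikodym_SigmaFinite.f_integral.
transitivity (\int[leb]_x ((expR (s ^+ 2 * t ^+ 2 / 2))%:E *
    (normal_pdf (s ^+ 2 * t) s x)%:E)); last first.
  rewrite ge0_integralZl//; last 2 first.
  - by apply/measurable_EFinP; exact: measurable_normal_pdf.
  - by move=> x _; rewrite lee_fin normal_pdf_ge0.
  by rewrite integral_normal_pdf mule1.
apply: ge0_ae_eq_integral => //.
- apply: emeasurable_funM => //.
  exact: measurable_int (Radon_Nikodym_SigmaFinite.f_integrable numu).
- apply: emeasurable_funM => //.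
  by apply/measurable_EFinP; exact: measurable_normal_pdf.
- move=> x _; rewrite mule_ge0//.
  exact: Radon_Nikodym_SigmaFinite.f_ge0.
- by move=> x _; rewrite mule_ge0// lee_fin ?expR_ge0// normal_pdf_ge0.
apply: filterS aeq => x /= /(_ I) <- _.
rewrite -!EFinM /normal_pdf (negbTE s0') /normal_fun; congr EFin.
rewrite mulrCA [RHS]mulrCA -!expRD; congr (_ * expR _)%R; field.
exact: s0'.
Qed.

(** * Laws of finite families of pairs *)

Section Rectangles.
Context d1 d2 (S1 : measurableType d1) (S2 : measurableType d2) (n : nat).

(** The pi-system generating the product sigma-algebra on n-tuples of pairs. The pairs are either
    (covariate, noise) or (sample point, ghost point). *)
Definition rectangles : set (set ('I_n -> S1 * S2)) :=
  [set C | exists (A : 'I_n -> set S1) (B : 'I_n -> set S2),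
    [/\ forall i, measurable (A i), forall i, measurable (B i) &
        C = [set z | forall i, A i (z i).1 /\ B i (z i).2]]].

Local Notation V := (g_sigma_algebraType rectangles).

Lemma rectanglesI : setI_closed rectangles.
Proof.
move=> _ _ [A [B [mA mB ->]]] [A' [B' [mA' mB' ->]]].
exists (fun i => A i `&` A' i), (fun i => B i `&` B' i); split.
- by move=> i; exact: measurableI.
- by move=> i; exact: measurableI.
- apply/seteqP; split=> z /=; first by move=> [h h'] i; have [] := h i; have [] := h' i.
  by move=> h; split=> i; have [[] ? ? []] := h i.
Qed.

Lemma rectanglesT : rectangles setT.
Proof. by exists (fun=> setT), (fun=> setT); split => //; apply/seteqP; split. Qed.

Lemma measurable_eval1 i : measurable_fun [set: V] (fun z : V => (z i).1).
Proof.
move=> _ A mA; rewrite setTI; apply: sub_sigma_algebra.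
exists (fun j => if j == i then A else setT), (fun=> setT); split => //.
  by move=> j; case: ifP.
apply/seteqP; split=> z /=; last by move=> /(_ i) []; rewrite eqxx.
by move=> Az j; split => //; case: eqVneq => // ->.
Qed.

Lemma measurable_eval2 i : measurable_fun [set: V] (fun z : V => (z i).2).
Proof.
move=> _ A mA; rewrite setTI; apply: sub_sigma_algebra.
exists (fun=> setT), (fun j => if j == i then A else setT); split => //.
  by move=> j; case: ifP.
apply/seteqP; split=> z /=; last by move=> /(_ i) []; rewrite eqxx.
by move=> Az j; split => //; case: eqVneq => // ->.
Qed.

Lemma measurable_family d (Om : measurableType d) (Z : Om -> 'I_n -> S1 * S2) :
  (forall i, measurable_fun setT (fun w => (Z w i).1)) ->
  (forall i, measurable_fun setT (fun w => (Z w i).2)) ->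
  measurable_fun setT (Z : Om -> V).
Proof.
move=> m1 m2; apply: (@measurability _ _ Om V setT Z rectangles erefl).
move=> _ [_ [A [B [mA mB ->]]] <-].
rewrite setTI.
have -> : Z @^-1` [set z | forall i, A i (z i).1 /\ B i (z i).2] =
    \bigcap_(i in [set: 'I_n]) (((fun w => (Z w i).1) @^-1` A i) `&`
       ((fun w => (Z w i).2) @^-1` B i)).
  by apply/seteqP; split=> w /= h i; [move=> _; exact: h|exact: h].
apply: fin_bigcap_measurable => // i _; apply: measurableI.
  by rewrite -[X in measurable X]setTI; exact: m1.
by rewrite -[X in measurable X]setTI; exact: m2.
Qed.

(** Two laws that agree on a generating pi-system coincide, and integrals depend on the law only.
    [P] and [P'] may live on different spaces, so a design can be compared with its copies on
    [P \x P]. *)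
Lemma rectangles_transfer {R : realType} d d' (Om : measurableType d)
    (Om' : measurableType d') (P : probability Om R) (P' : probability Om' R)
    (Z : Om -> 'I_n -> S1 * S2) (Z' : Om' -> 'I_n -> S1 * S2) (F : V -> \bar R) :
  (forall i, measurable_fun setT (fun w => (Z w i).1)) ->
  (forall i, measurable_fun setT (fun w => (Z w i).2)) ->
  (forall i, measurable_fun setT (fun w => (Z' w i).1)) ->
  (forall i, measurable_fun setT (fun w => (Z' w i).2)) ->
  (forall (A : 'I_n -> set S1) (B : 'I_n -> set S2),
     (forall i, measurable (A i)) -> (forall i, measurable (B i)) ->
     P [set w | forall i, A i (Z w i).1 /\ B i (Z w i).2] =
     P' [set w | forall i, A i (Z' w i).1 /\ B i (Z' w i).2]) ->
  measurable_fun setT F -> (forall z, 0 <= F z) ->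
  \int[P]_w F (Z w) = \int[P']_w F (Z' w).
Proof.
move=> m1 m2 m1' m2' PP' mF F0.
have mZ := measurable_family m1 m2; have mZ' := measurable_family m1' m2'.
pose W : {RV P >-> V} := HB.pack (Z : Om -> V) (isMeasurableFun.Build _ _ _ _ _ mZ).
pose W' : {RV P' >-> V} :=
  HB.pack (Z' : Om' -> V) (isMeasurableFun.Build _ _ _ _ _ mZ').
have WW' (C : set V) : measurable C -> distribution P W C = distribution P' W' C.
  move: C; apply: (@measure_unique _ R V rectangles (fun=> setT)) => //.
  - exact: rectanglesI.
  - by move=> _; exact: rectanglesT.
  - by apply/seteqP; split => // z _; exists 0%N.
  - by move=> _ [A [B [mA mB ->]]]; exact: PP'.
  - by move=> _; rewrite (le_lt_trans (probability_le1 _ _)) ?ltry.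
have -> : \int[P]_w F (Z w) = \int[distribution P W]_z F z.
  by rewrite ge0_integral_distribution.
have -> : \int[P']_w F (Z' w) = \int[distribution P' W']_z F z.
  by rewrite ge0_integral_distribution.
by apply: eq_measure_integral => C mC _; exact: WW'.
Qed.

End Rectangles.

Local Close Scope ereal_scope.

Local Open Scope ereal_scope.

(** * Independence, exchangeability and Gaussian moments *)

Section Design.
Context {R : realType} {dT : measure_display} {T : measurableType dT}
  {disp : measure_display} {Om : measurableType disp} (P : probability Om R)
  (n : nat) (mu : probability T R) (sigma : R)
  (X : 'I_n -> {RV P >-> T}) (eps : 'I_n -> {RV P >-> R}).

(** [regression_design] over an arbitrary measurable space of covariates, all that the concentration
    argument uses. *)
Definition iid_design :=
  [/\ forall i (A : set T), measurable A -> P (X i @^-1` A) = mu A,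
      forall i (B : set R), measurable B ->
        P (eps i @^-1` B) = normal_prob 0%R sigma B
    & forall (A : 'I_n -> set T) (B : 'I_n -> set R),
        (forall i, measurable (A i)) -> (forall i, measurable (B i)) ->
        P [set w | forall i, A i (X i w) /\ B i (eps i w)] =
        (\prod_(i < n) P (X i @^-1` A i)) * \prod_(i < n) P (eps i @^-1` B i)].

Hypothesis des : iid_design.

Let HX := let: And3 h _ _ := des in h.
Let HE := let: And3 _ h _ := des in h.
Let Hind := let: And3 _ _ h := des in h.

Let measurable_preX i (A : set T) : measurable A -> measurable (X i @^-1` A).
Proof. by move=> mA; rewrite -[X in measurable X]setTI; exact: measurable_funP. Qed.

Let measurable_preE i (A : set R) : measurable A -> measurable (eps i @^-1` A).
Proof. by move=> mA; rewrite -[X in measurable X]setTI; exact: measurable_funP. Qed.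

Lemma measurable_design_event (A : 'I_n -> set T) (B : 'I_n -> set R) :
  (forall i, measurable (A i)) -> (forall i, measurable (B i)) ->
  measurable [set w | forall i, A i (X i w) /\ B i (eps i w)].
Proof.
move=> mA mB.
have -> : [set w | forall i, A i (X i w) /\ B i (eps i w)] =
    \bigcap_(i in [set: 'I_n]) ((X i @^-1` A i) `&` (eps i @^-1` B i)).
  by apply/seteqP; split=> w /= h i; [move=> _; exact: h|exact: h].
by apply: fin_bigcap_measurable => // i _; apply: measurableI; auto.
Qed.

Let measurable_copyX i (b : bool) :
  measurable_fun setT (fun u : Om * Om => X i (if b then u.2 else u.1)).
Proof.
by case: b; [exact: (measurableT_comp (measurable_funP (X i)) measurable_snd)
  |exact: (measurableT_comp (measurable_funP (X i)) measurable_fst)].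
Qed.

Let measurable_copyE i (b : bool) :
  measurable_fun setT (fun u : Om * Om => eps i (if b then u.2 else u.1)).
Proof.
by case: b; [exact: (measurableT_comp (measurable_funP (eps i)) measurable_snd)
  |exact: (measurableT_comp (measurable_funP (eps i)) measurable_fst)].
Qed.

(* Independence: each covariate and each noise variable may be replaced by an
   independent copy of itself. *)
Lemma mixed_law (a e : 'I_n -> bool)
    (F : g_sigma_algebraType (@rectangles _ _ T (measurableTypeR R) n) -> \bar R) :
  measurable_fun setT F -> (forall z, 0 <= F z) ->
  \int[P]_w F (fun i => (X i w, eps i w)) =
  \int[P \x P]_u F (fun i => (X i (if a i then u.2 else u.1),
                             eps i (if e i then u.2 else u.1))).
Proof.
move=> mF F0.
apply: (@rectangles_transfer _ _ T (measurableTypeR R) n R _ _ Om _ P (P \x P)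
  (fun w i => (X i w, eps i w))
  (fun u i => (X i (if a i then u.2 else u.1), eps i (if e i then u.2 else u.1)))
  F) => //=.
- by move=> i; exact: measurable_funP (eps i).
- by move=> i; exact: (measurable_copyE i (e i)).
move=> A B mA mB.
(* Each constraint is assigned to the copy that it concerns, the other copy receiving the whole
   space; the event becomes a product set. *)
pose A1 i := if a i then setT else A i; pose A2 i := if a i then A i else setT.
pose B1 i := if e i then setT else B i; pose B2 i := if e i then B i else setT.
have mA1 i : measurable (A1 i) by rewrite /A1; case: ifP.
have mA2 i : measurable (A2 i) by rewrite /A2; case: ifP.
have mB1 i : measurable (B1 i) by rewrite /B1; case: ifP.
have mB2 i : measurable (B2 i) by rewrite /B2; case: ifP.
have -> : [set u : Om * Om | forall i, A i (X i (if a i then u.2 else u.1)) /\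
      B i (eps i (if e i then u.2 else u.1))] =
    [set w | forall i, A1 i (X i w) /\ B1 i (eps i w)] `*`
    [set w | forall i, A2 i (X i w) /\ B2 i (eps i w)].
  apply/seteqP; split=> -[w w'] /=.
    move=> h; split=> i; have := h i; rewrite /A1 /A2 /B1 /B2;
    by case: (a i); case: (e i) => -[].
  move=> [h h'] i; have := h i; have := h' i; rewrite /A1 /A2 /B1 /B2;
  by case: (a i); case: (e i) => -[? ?] [? ?]; split.
rewrite product_measure1E//; [|exact: measurable_design_event..].
rewrite (Hind mA mB) [X in _ = X * _](Hind mA1 mB1) [X in _ = _ * X](Hind mA2 mB2) muleACA.
congr (_ * _); rewrite -big_split/=; apply: eq_bigr => i _.
  by rewrite /A1 /A2; case: ifP; rewrite preimage_setT probability_setT ?mule1 ?mul1e.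
by rewrite /B1 /B2; case: ifP; rewrite preimage_setT probability_setT ?mule1 ?mul1e.
Qed.

(* Exchangeability of the sample X(w) and the ghost sample X(w'). *)
Lemma swap_law (s : 'I_n -> bool)
    (F : g_sigma_algebraType (@rectangles _ _ T T n) -> \bar R) :
  measurable_fun setT F -> (forall z, 0 <= F z) ->
  \int[P \x P]_u F (fun i => (X i u.1, X i u.2)) =
  \int[P \x P]_u F (fun i => (X i (if s i then u.2 else u.1),
                             X i (if s i then u.1 else u.2))).
Proof.
move=> mF F0.
apply: (@rectangles_transfer _ _ T T n R _ _ _ _ (P \x P) (P \x P)
  (fun u i => (X i u.1, X i u.2))
  (fun u i => (X i (if s i then u.2 else u.1), X i (if s i then u.1 else u.2)))
  F) => //=.
- by move=> i; exact: (measurable_copyX i false).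
- by move=> i; exact: (measurable_copyX i true).
- move=> i; case: (s i); [exact: (measurable_copyX i false)
  |exact: (measurable_copyX i true)].
move=> A B mA mB.
have event (C D : 'I_n -> set T) : (forall i, measurable (C i)) ->
    (forall i, measurable (D i)) ->
    (P \x P) [set u : Om * Om | forall i, C i (X i u.1) /\ D i (X i u.2)] =
    \prod_(i < n) (mu (C i) * mu (D i)).
  move=> mC mD.
  have -> : [set u : Om * Om | forall i, C i (X i u.1) /\ D i (X i u.2)] =
      [set w | forall i, C i (X i w) /\ setT (eps i w)] `*`
      [set w | forall i, D i (X i w) /\ setT (eps i w)].
    apply/seteqP; split=> -[w w'] /= h; first by split=> i; have [] := h i.
    by move=> i; have [] := h.1 i; have [] := h.2 i.
  rewrite product_measure1E//; [|exact: (@measurable_design_event _ (fun=> setT))..].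
  rewrite [X in X * _ = _](Hind mC (fun=> measurableT)).
  rewrite [X in _ * X = _](Hind mD (fun=> measurableT)).
  rewrite muleACA -big_split/= [X in _ * X](_ : _ = 1) ?mule1.
    by apply: eq_bigr => i _; rewrite !HX.
  rewrite -big_split big1// => i _.
  by rewrite preimage_setT probability_setT; exact: mule1.
rewrite event//.
have -> : [set u : Om * Om | forall i, A i (X i (if s i then u.2 else u.1)) /\
      B i (X i (if s i then u.1 else u.2))] =
    [set u : Om * Om | forall i, (if s i then B i else A i) (X i u.1) /\
      (if s i then A i else B i) (X i u.2)].
  by apply/seteqP; split=> u /= h i; have := h i; case: ifP => _ [].
rewrite (event (fun i => if s i then B i else A i) (fun i => if s i then A i else B i));
  [|by move=> i; case: ifP..].
by apply: eq_bigr => i _; case: ifP => // _; rewrite muleC.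
Qed.

(** Induction on the factors: [mixed_law] moves the noise of index [k] to an independent copy, and
    Tonelli's theorem splits off its integral. *)
Lemma expectation_prod_noise (phi : 'I_n -> R -> R) (r : seq 'I_n) :
  (forall i, measurable_fun setT (phi i)) -> (forall i x, (0 <= phi i x)%R) ->
  uniq r ->
  \int[P]_w (\prod_(i <- r) phi i (eps i w))%:E =
  \prod_(i <- r) \int[P]_w (phi i (eps i w))%:E.
Proof.
move=> mphi phi0; elim: r => [_|k r IH /= /andP[kr ur]].
  under eq_integral do rewrite big_nil.
  by rewrite big_nil integral_cst// mul1e; exact: probability_setT.
pose F (z : g_sigma_algebraType (@rectangles _ _ T (measurableTypeR R) n)) :=
  (\prod_(i <- k :: r) phi i (z i).2)%:E.
have mF : measurable_fun setT F.
  apply/measurable_EFinP; apply: measurable_prod => i _.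
  exact: (measurableT_comp (mphi i) (@measurable_eval2 _ _ T (measurableTypeR R) n i)).
have F0 z : 0 <= F z by rewrite lee_fin prodr_ge0.
have mr : measurable_fun setT (fun w => (\prod_(i <- r) phi i (eps i w))%:E).
  apply/measurable_EFinP; apply: measurable_prod => i _.
  exact: measurableT_comp.
have mk : measurable_fun setT (fun w => (phi k (eps k w))%:E).
  by apply/measurable_EFinP; exact: measurableT_comp.
rewrite (mixed_law (fun=> false) (pred1 k) mF F0) fubini_tonelli1; last 2 first.
- apply: (measurableT_comp mF); apply: measurable_family => i /=.
    exact: (measurable_copyX i false).
  exact: (measurable_copyE i (i == k)).
- by move=> u; exact: F0.
rewrite big_cons -IH// muleC -ge0_integralZr//; last 2 first.
- by move=> w _; rewrite lee_fin prodr_ge0.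
- by apply: integral_ge0 => w _; rewrite lee_fin.
apply: eq_integral => w _; rewrite /fubini_F -ge0_integralZl//; last 2 first.
- by move=> w' _; rewrite lee_fin.
- by rewrite lee_fin prodr_ge0.
apply: eq_integral => w' _; rewrite /F big_cons/= eqxx -EFinM mulrC; congr (_ * _)%:E.
by apply: eq_big_seq => i ir; case: eqVneq => // ik; rewrite -ik ir in kr.
Qed.

Lemma noise_mgf (c : 'I_n -> R) : (0 < sigma)%R ->
  \int[P]_w (expR (\sum_i c i * eps i w))%:E =
  (expR (sigma ^+ 2 / 2 * \sum_i c i ^+ 2))%:E.
Proof.
move=> s0.
under eq_integral do rewrite expR_sum.
rewrite (expectation_prod_noise (phi := fun i x => expR (c i * x))); last 3 first.
- by move=> i; apply: measurableT_comp => //; exact: mulrl_measurable.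
- by move=> i x; exact: expR_ge0.
- exact: index_enum_uniq.
rewrite mulr_sumr expR_sum -prodEFin; apply: eq_bigr => i _.
have -> : (sigma ^+ 2 / 2 * c i ^+ 2 = sigma ^+ 2 * c i ^+ 2 / 2)%R by rewrite mulrAC.
transitivity (\int[normal_prob 0 sigma]_x (expR (c i * x))%:E); last exact: normal_mgf.
have meps : measurable_fun setT (eps i : Om -> measurableTypeR R).
  by move=> mT Y mY; apply: (measurable_funP (eps i) mT Y mY).
pose W : {RV P >-> measurableTypeR R} :=
  HB.pack (eps i : Om -> measurableTypeR R) (isMeasurableFun.Build _ _ _ _ _ meps).
transitivity (\int[distribution P W]_x (expR (c i * x))%:E).
  rewrite ge0_integral_distribution//.
    by apply/measurable_EFinP; apply: measurableT_comp => //; exact: mulrl_measurable.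
by apply: eq_measure_integral => A mA _; exact: HE.
Qed.

End Design.

Local Close Scope ereal_scope.

(** * Exponential inequalities and averages over random signs *)

Section MaximalInequalities.
Context {R : realType}.

(** From exp(-u) >= 1 - u one gets exp(u) <= 1 / (1 - u), and (1 - u)(1 + u + 2 u^2) = 1 + u^2 (1 -
    2 u) >= 1. *)
Lemma expR_quadratic (u : R) : `|u| <= 2^-1 -> expR u <= 1 + u + 2 * u ^+ 2.
Proof.
rewrite ler_norml => /andP[u1 u2].
have h : 1 - u <= expR (- u) by rewrite expR_ge1Dx.
have u0 : 0 < 1 - u by lra.
have : expR u <= (1 - u)^-1.
  by rewrite -[expR u]invrK -expRN lef_pV2// posrE expR_gt0.
move=> /le_trans; apply.
rewrite -[(1 - u)^-1]mul1r ler_pdivrMr//; nra.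
Qed.

(* The gain of 2 over 1 in front of the subtracted term absorbs the second order
   terms of the exponentials. *)
Lemma expR_swap (a b : R) : 0 <= a <= 10^-1 -> 0 <= b <= 10^-1 ->
  expR (a - 2 * b) + expR (b - 2 * a) <= 2.
Proof.
move=> /andP[a0 a1] /andP[b0 b1].
have h1 : expR (a - 2 * b) <= 1 + (a - 2 * b) + 2 * (a - 2 * b) ^+ 2.
  by apply: expR_quadratic; rewrite ler_norml; lra.
have h2 : expR (b - 2 * a) <= 1 + (b - 2 * a) + 2 * (b - 2 * a) ^+ 2.
  by apply: expR_quadratic; rewrite ler_norml; lra.
nra.
Qed.

(** A linearized log-sum-exp bound, from exp(x) >= 1 + x at x = u_k - ln tau. Being linear in the
    exponentials, it can be averaged term by term; at most [tau] terms of mean at most 1 contribute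
    at most 1. *)
Lemma softmax_bound (K : finType) (A : {set K}) (tau : nat) (u : K -> R) k :
  (0 < tau)%N -> k \in A ->
  u k <= ln tau%:R + tau%:R^-1 * \sum_(j in A) expR (u j).
Proof.
move=> t0 kA; have t0' : 0 < (tau%:R : R) by rewrite ltr0n.
have := expR_ge1Dx (u k - ln tau%:R); rewrite expRD expRN lnK ?posrE// => h.
have : expR (u k) <= \sum_(j in A) expR (u j).
  rewrite (bigD1 k)//= lerDl; apply: sumr_ge0 => j _; exact: expR_ge0.
move=> /(ler_wpM2l (ltW _ : 0 <= tau%:R^-1)) => /(_ _); rewrite invr_gt0 => /(_ t0').
lra.
Qed.

Lemma prodr_const_one (n : nat) : \prod_(i < n) (1 : R) = 1.
Proof. by rewrite big1. Qed.

(** The signs are uniform on a finite set, so their independence is the distributivity of products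
    over sums. *)
Lemma avg_prod (n : nat) (phi : 'I_n -> bool -> R) :
  (2 ^+ n)^-1 * \sum_(s : {ffun 'I_n -> bool}) \prod_i phi i (s i) =
  \prod_i ((phi i true + phi i false) / 2).
Proof.
rewrite big_split/= prodr_const card_ord exprVn mulrC; congr (_ * _).
rewrite -(bigA_distr_bigA (fun i b => phi i b)).
by apply: eq_bigr => i _; rewrite big_bool.
Qed.

End MaximalInequalities.

Section Chaos.
Context {R : realType} {T : Type} (n : nat) (K : finType) (Gamma delta : R)
  (fs : T -> R) (g : K -> T -> R) (pi : K -> K) (tau : nat).
Hypothesis n0 : (0 < n)%N.
Hypothesis G0 : 0 < Gamma.
Hypothesis fs_le : forall y, `|fs y| <= Gamma.
Hypothesis g_le : forall k y, `|g k y| <= Gamma.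
Hypothesis tau0 : (0 < tau)%N.
Hypothesis card_pi : (#|pi @: K| <= tau)%N.

(** [x] is the sample and [x'] the ghost sample. *)
Definition deviation k (x x' : 'I_n -> T) : R :=
  n%:R^-1 * \sum_i ((g k (x' i) - fs (x' i)) ^+ 2 - 2 * (g k (x i) - fs (x i)) ^+ 2).

Let n0' : 0 < (n%:R : R). Proof. by rewrite ltr0n. Qed.

Let sq_le k y : 0 <= (g k y - fs y) ^+ 2 <= 4 * Gamma ^+ 2.
Proof.
have := fs_le y; have := g_le k y; rewrite !ler_norml => /andP[a b] /andP[c d].
by rewrite sqr_ge0/=; nra.
Qed.

Lemma max_avg_le (u : {ffun 'I_n -> bool} -> K -> R) (lam rho : R) :
  0 < lam -> 0 <= rho ->
  (forall s k, u s k <= u s (pi k) + rho) ->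
  (forall k, (2 ^+ n)^-1 * \sum_s expR (lam * u s k) <= 1) ->
  (2 ^+ n)^-1 * \sum_s \big[Num.max/0]_k u s k <= (ln tau%:R + 1) / lam + rho.
Proof.
move=> l0 r0 up ue.
have lt0 : 0 <= ln (tau%:R : R) by rewrite ln_ge0// ler1n.
have step s : \big[Num.max/0]_k u s k <=
    (ln tau%:R + tau%:R^-1 * \sum_(j in pi @: K) expR (lam * u s j)) / lam + rho.
  apply/bigmax_leP; split=> [|k _].
    rewrite addr_ge0// divr_ge0 ?(ltW l0)// addr_ge0// mulr_ge0 ?invr_ge0//.
    by apply: sumr_ge0 => j _; exact: expR_ge0.
  apply: le_trans (up s k) _; rewrite lerD2r ler_pdivlMr// mulrC.
  by apply: (softmax_bound (fun k => lam * u s k)) => //; exact: imset_f.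
have p0 : 0 < (2 ^+ n : R)^-1 by rewrite invr_gt0 exprn_gt0.
have cs (c : R) : (2 ^+ n)^-1 * \sum_(s : {ffun 'I_n -> bool}) c = c.
  rewrite sumr_const card_ffun card_bool card_ord -[c *+ _]mulr_natl natrX mulKf//.
apply: le_trans (ler_wpM2l (ltW p0) (ler_sum _ (fun s _ => step s))) _.
rewrite big_split/= mulrDr cs lerD2r -mulr_suml mulrA ler_wpM2r ?invr_ge0 ?(ltW l0)//.
rewrite big_split/= mulrDr cs lerD2l -mulr_sumr mulrCA exchange_big/= mulr_sumr.
rewrite ler_pdivrMl ?ltr0n// mulr1.
apply: le_trans (ler_sum _ (fun k _ => ue k)) _.
by rewrite sumr_const ler_nat.
Qed.

(** The exponential scale n / (40 Gamma^2) brings the squares, at most 4 Gamma^2, below 1/10, as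
    [expR_swap] requires. Passing to the net changes each square by at most 4 Gamma delta, hence the
    deviation by at most (1 + 2) * 4 Gamma delta. *)
Lemma deviation_swap_max (x x' : 'I_n -> T) :
  0 <= delta ->
  (forall k i, `|g k (x i) - g (pi k) (x i)| <= delta) ->
  (forall k i, `|g k (x' i) - g (pi k) (x' i)| <= delta) ->
  (2 ^+ n)^-1 * \sum_(s : {ffun 'I_n -> bool})
    \big[Num.max/0]_k deviation k (fun i => if s i then x' i else x i)
                                  (fun i => if s i then x i else x' i) <=
  40 * Gamma ^+ 2 / n%:R * (ln tau%:R + 1) + 12 * Gamma * delta.
Proof.
move=> d0 xd xd'.
have close k y : `|g k y - g (pi k) y| <= delta ->
    `|(g k y - fs y) ^+ 2 - (g (pi k) y - fs y) ^+ 2| <= 4 * Gamma * delta.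
  move=> h; rewrite subr_sqr normrM mulrC.
  have -> : g k y - fs y - (g (pi k) y - fs y) = g k y - g (pi k) y by ring.
  apply: ler_pM => //.
  have := fs_le y; have := g_le k y; have := g_le (pi k) y; rewrite !ler_norml; lra.
have -> : 40 * Gamma ^+ 2 / n%:R * (ln tau%:R + 1) =
    (ln tau%:R + 1) / (n%:R / (40 * Gamma ^+ 2)).
  by field; rewrite ?gt_eqF.
apply: max_avg_le => [|||k].
- by rewrite divr_gt0// mulr_gt0// exprn_gt0.
- by rewrite !mulr_ge0// ltW.
- move=> s k; rewrite -lerBlDl -mulrBr -sumrB ler_pdivrMl// [leRHS]mulr_natl.
  rewrite [leRHS](_ : _ = \sum_(i < n) 12 * Gamma * delta); last first.
    by rewrite sumr_const card_ord.
  apply: ler_sum => i _.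
  have := close k _ (xd k i); have := close k _ (xd' k i); rewrite !ler_norml.
  by case: (s i) => /andP[? ?] /andP[? ?]; lra.
under eq_bigr do rewrite mulrA mulr_sumr expR_sum.
pose q i (b : bool) := (g k (if b then x i else x' i) - fs (if b then x i else x' i)) ^+ 2.
pose phi i (b : bool) := expR ((40 * Gamma ^+ 2)^-1 * (q i b - 2 * q i (~~ b))).
rewrite [X in _ * X](eq_bigr (fun s : {ffun 'I_n -> bool} => \prod_i phi i (s i))).
  rewrite avg_prod -[leRHS](prodr_const_one n); apply: ler_prod => i _.
  rewrite divr_ge0 ?addr_ge0 ?expR_ge0//= ler_pdivrMr// mul1r /phi/= !mulrBr.
  rewrite ![_ * (2 * _)]mulrCA.
  have G20 : 0 < 40 * Gamma ^+ 2 by rewrite mulr_gt0// exprn_gt0.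
  have qs b : 0 <= (40 * Gamma ^+ 2)^-1 * q i b <= 10^-1.
    have /andP[q0 q1] := sq_le k (if b then x i else x' i).
    rewrite mulr_ge0 ?invr_ge0 ?(ltW G20)//= ler_pdivrMl//.
    by apply: le_trans q1 _; lra.
  by apply: expR_swap; exact: qs.
move=> s _; apply: eq_bigr => i _; rewrite /phi /q.
have -> : n%:R / (40 * Gamma ^+ 2) / n%:R = (40 * Gamma ^+ 2)^-1.
  by field; rewrite !gt_eqF.
by rewrite !if_neg.
Qed.

End Chaos.

Lemma measurable_bigmaxr {R : realType} d (Om : measurableType d) (K : Type)
    (r : seq K) (h : K -> Om -> R) : (forall k, measurable_fun setT (h k)) ->
  measurable_fun setT (fun w => \big[Num.max/0]_(k <- r) h k w).
Proof.
move=> mh; elim: r => [|k r IH].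
  by under eq_fun do rewrite big_nil; exact: measurable_cst.
by under eq_fun do rewrite big_cons; exact: measurable_maxr.
Qed.

(** * The Gaussian term with its quadratic penalty *)

Section Noise.
Context {R : realType} {dT : measure_display} {T : measurableType dT}
  {disp : measure_display} {Om : measurableType disp} (P : probability Om R)
  (n : nat) (mu : probability T R) (sigma : R)
  (X : 'I_n -> {RV P >-> T}) (eps : 'I_n -> {RV P >-> R}).
Hypothesis des : iid_design mu sigma X eps.
Hypothesis sigma0 : 0 < sigma.
Context (K : finType) (Gamma delta : R) (f0 : T -> R) (g : K -> T -> R) (tau : nat).
Hypothesis n0 : (0 < n)%N.
Hypothesis G0 : 0 < Gamma.
Hypothesis d0 : 0 <= delta.
Hypothesis f0_le : forall y, `|f0 y| <= Gamma.
Hypothesis g_le : forall k y, `|g k y| <= Gamma.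
Hypothesis tau0 : (0 < tau)%N.

Definition noise k (x : 'I_n -> T) (e : 'I_n -> R) : R :=
  n%:R^-1 * \sum_i (2 * e i * (g k (x i) - f0 (x i)) -
                    (g k (x i) - f0 (x i)) ^+ 2 / 4).

Let n0' : 0 < (n%:R : R). Proof. by rewrite ltr0n. Qed.

(** With v = g_k - f0, the scale n / (8 sigma^2) turns the linear part into eps v / (4 sigma^2),
    whose exponential has mean exp(v^2 / (32 sigma^2)); the penalty contributes exactly the
    inverse. *)
Lemma expectation_exp_noise k x :
  (\int[P]_w (expR (n%:R / (8 * sigma ^+ 2) * noise k x (fun i => eps i w)))%:E = 1)%E.
Proof.
have s2 : sigma ^+ 2 != 0 by rewrite expf_neq0// gt_eqF.
pose v i := g k (x i) - f0 (x i).
pose c i := v i / (4 * sigma ^+ 2).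
have mexp : measurable_fun setT (fun w => (expR (\sum_i c i * eps i w))%:E).
  apply/measurable_EFinP; apply: measurableT_comp => //.
  apply: measurable_sum => i; apply: measurable_funM => //; exact: measurable_funP.
rewrite (eq_integral (fun w => ((expR (- (sigma ^+ 2 / 2 * \sum_i c i ^+ 2)))%:E *
    (expR (\sum_i c i * eps i w))%:E)%E)).
  rewrite ge0_integralZl_EFin ?expR_ge0//.
  by rewrite (noise_mgf des)// -EFinM -expRD addrC subrr expR0.
move=> w _; rewrite -EFinM -expRD; congr (expR _)%:E.
rewrite /noise mulrA; have -> : n%:R / (8 * sigma ^+ 2) * n%:R^-1 = (8 * sigma ^+ 2)^-1.
  by field; rewrite !gt_eqF.
rewrite !mulr_sumr -sumrN -big_split/=; apply: eq_bigr => i _.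
by rewrite /c -/(v i); field; rewrite gt_eqF.
Qed.

(** From |u| <= exp(u) + exp(-u) with u = eps / sigma, each exponential having mean exp(1/2) <= 2.
    This controls the discretization error, in which the unbounded noise appears. *)
Lemma expectation_abs_noise i : (\int[P]_w (`|eps i w|)%:E <= (4 * sigma)%:E)%E.
Proof.
have mgf (a : R) : a ^+ 2 = 1 ->
    (\int[P]_w (expR (a / sigma * eps i w))%:E <= 2%:E)%E.
  move=> a1; pose c j := if j == i then a / sigma else 0.
  rewrite (eq_integral (fun w => (expR (\sum_j c j * eps j w))%:E)); last first.
    move=> w _; congr (expR _)%:E; rewrite (bigD1 i)//= /c eqxx big1 ?addr0//.
    by move=> j /negbTE ->; rewrite mul0r.
  rewrite (noise_mgf des)// (bigD1 i)//= /c eqxx big1 ?addr0; last first.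
    by move=> j /negbTE ->; rewrite expr0n.
  have -> : sigma ^+ 2 / 2 * (a / sigma) ^+ 2 = 2^-1.
    by rewrite expr_div_n a1; field; rewrite gt_eqF.
  rewrite lee_fin -[leRHS]invrK -[expR _]invrK -expRN lef_pV2 ?posrE ?invr_gt0 ?expR_gt0//.
  by apply: le_trans (expR_ge1Dx _); lra.
have mexp (a : R) : measurable_fun setT (fun w => (expR (a / sigma * eps i w))%:E).
  apply/measurable_EFinP; apply: measurableT_comp => //.
  by apply: measurable_funM => //; exact: measurable_funP.
apply: (@le_trans _ _ (\int[P]_w (sigma%:E * ((expR (1 / sigma * eps i w))%:E +
    (expR (- 1 / sigma * eps i w))%:E)))%E).
  apply: ge0_le_integral => //=.
  - apply/measurable_EFinP; apply: measurableT_comp => //; exact: measurable_funP.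
  - by apply: measurable_funeM; exact: emeasurable_funD.
  move=> w _; rewrite -EFinD -EFinM lee_fin -ler_pdivrMl//.
  rewrite mul1r mulN1r mulNr; set u := sigma^-1 * eps i w.
  have -> : sigma^-1 * `|eps i w| = `|u| by rewrite normrM gtr0_norm// invr_gt0.
  have := expR_ge0 u; have := expR_ge0 (- u).
  have := expR_ge1Dx u; have := expR_ge1Dx (- u); rewrite ler_norml; lra.
rewrite ge0_integralZl_EFin ?(ltW sigma0)//; last 2 first.
- by move=> w _; rewrite adde_ge0 ?lee_fin ?expR_ge0.
- exact: emeasurable_funD.
rewrite ge0_integralD//; try by move=> w _; rewrite lee_fin expR_ge0.
apply: (@le_trans _ _ (sigma%:E * (2%:E + 2%:E))%E).
  apply: lee_wpmul2l; first by rewrite lee_fin ltW.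
  apply: leeD; apply: mgf; first by rewrite expr1n.
  by rewrite sqrrN expr1n.
by rewrite -EFinD -EFinM lee_fin; lra.
Qed.

(** The sample points are fixed here, so the net does not depend on the noise. Replacing g_k by its
    net point costs 2 delta |eps_i| + Gamma delta per observation. *)
Lemma expectation_max_noise x (pi : K -> K) : (#|pi @: K| <= tau)%N ->
  (forall k i, `|g k (x i) - g (pi k) (x i)| <= delta) ->
  (\int[P]_w (\big[Num.max/0]_k noise k x (fun i => eps i w))%:E <=
   (8 * sigma ^+ 2 / n%:R * (ln tau%:R + 1) + 8 * delta * sigma + Gamma * delta)%:E)%E.
Proof.
move=> cpi xd; set lam := n%:R / (8 * sigma ^+ 2).
have lam0 : 0 < lam by rewrite divr_gt0// mulr_gt0// exprn_gt0.
have lt0 : 0 <= ln (tau%:R : R) by rewrite ln_ge0// ler1n.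
have mnoise k : measurable_fun setT (fun w => noise k x (fun i => eps i w)).
  apply: measurable_funM => //; apply: measurable_sum => i; apply: measurable_funB => //.
  by apply: measurable_funM => //; apply: measurable_funM => //; exact: measurable_funP.
have mexp k : measurable_fun setT (fun w =>
    (expR (lam * noise k x (fun i => eps i w)))%:E).
  apply/measurable_EFinP; apply: measurableT_comp => //.
  exact: measurable_funM.
have mabs i : measurable_fun setT (fun w => (`|eps i w|)%:E).
  apply/measurable_EFinP; apply: measurableT_comp => //; exact: measurable_funP.
pose c0 := ln tau%:R / lam + Gamma * delta.
have c00 : 0 <= c0 by rewrite addr_ge0// ?divr_ge0 ?mulr_ge0// ltW.
pose c1 := (lam * tau%:R)^-1.
have c10 : 0 <= c1 by rewrite invr_ge0 mulr_ge0// ltW.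
pose c2 := 2 * delta / n%:R.
have c20 : 0 <= c2 by rewrite divr_ge0// mulr_ge0.
have pointwise w : (\big[Num.max/0]_k noise k x (fun i => eps i w)) <=
    c0 + (c1 * (\sum_(j <- enum (pi @: K)) expR (lam * noise j x (fun i => eps i w))) +
          c2 * \sum_i `|eps i w|).
  set e := fun i => eps i w.
  have se : 0 <= \sum_(j <- enum (pi @: K)) expR (lam * noise j x e).
    by apply: sumr_ge0 => j _; exact: expR_ge0.
  apply/bigmax_leP; split=> [|k _].
    by apply: addr_ge0 => //; apply: addr_ge0; apply: mulr_ge0 => //; apply: sumr_ge0.
  have close : noise k x e <= noise (pi k) x e +
      (c2 * \sum_i `|eps i w| + Gamma * delta).
    rewrite -lerBlDl /noise -[leLHS]mulrBr -sumrB ler_pdivrMl//.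
    have -> : n%:R * (c2 * (\sum_i `|eps i w|) + Gamma * delta) =
        \sum_i (2 * delta * `|eps i w| + Gamma * delta).
      rewrite big_split/= sumr_const card_ord -[_ * _ *+ n]mulr_natl mulrDr; congr (_ + _).
      by rewrite -mulr_sumr mulrA; congr (_ * _); rewrite /c2; field; rewrite gt_eqF.
    apply: ler_sum => i _.
    have -> : 2 * e i * (g k (x i) - f0 (x i)) - (g k (x i) - f0 (x i)) ^+ 2 / 4 -
       (2 * e i * (g (pi k) (x i) - f0 (x i)) - (g (pi k) (x i) - f0 (x i)) ^+ 2 / 4) =
       2 * (e i * (g k (x i) - g (pi k) (x i))) -
       (g k (x i) - g (pi k) (x i)) * ((g k (x i) + g (pi k) (x i) - 2 * f0 (x i)) / 4).
      by field.
    apply: lerD.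
      rewrite -mulrA ler_wpM2l//; apply: le_trans (ler_norm _) _.
      by rewrite normrM mulrC ler_wpM2r.
    apply: le_trans (ler_norm _) _; rewrite normrN normrM mulrC.
    apply: ler_pM => //.
    have := f0_le (x i); have := g_le k (x i); have := g_le (pi k) (x i).
    rewrite !ler_norml; lra.
  apply: le_trans close _.
  have : lam * noise (pi k) x e <= _ := softmax_bound
    (fun j => lam * noise j x e) tau0 (imset_f pi (isT : k \in K)).
  rewrite -big_enum/= mulrC -ler_pdivlMr// => h.
  apply: le_trans (lerD h (lexx _)) _.
  rewrite mulrDl le_eqVlt; apply/orP; left; apply/eqP.
  rewrite /c0 /c1 (invfM lam); ring.
apply: (@le_trans _ _ (\int[P]_w (c0%:E + (c1%:E *
   (\sum_(j <- enum (pi @: K)) (expR (lam * noise j x (fun i => eps i w)))%:E) +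
   c2%:E * \sum_i (`|eps i w|)%:E)))%E).
  apply: ge0_le_integral => //=.
  - by move=> w _; rewrite lee_fin; exact: bigmax_ge_id.
  - by apply/measurable_EFinP; exact: measurable_bigmaxr.
  - apply: emeasurable_funD => //; apply: emeasurable_funD; apply: measurable_funeM.
      exact: emeasurable_sum.
    exact: emeasurable_sum.
  by move=> w _; rewrite !sumEFin -!EFinM -!EFinD lee_fin; exact: pointwise.
have sE0 w : (0 <= \sum_(j <- enum (pi @: K)) (expR (lam * noise j x (fun i => eps i w)))%:E)%E.
  by apply: sume_ge0 => j _; rewrite lee_fin expR_ge0.
have sA0 w : (0 <= \sum_i (`|eps i w|)%:E)%E.
  by apply: sume_ge0 => j _; rewrite lee_fin.
have msE : measurable_fun setT (fun w =>
    \sum_(j <- enum (pi @: K)) (expR (lam * noise j x (fun i => eps i w)))%:E)%E.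
  exact: emeasurable_sum.
have msA : measurable_fun setT (fun w => \sum_i (`|eps i w|)%:E)%E.
  exact: emeasurable_sum.
rewrite ge0_integralD//; [|by move=> w _; rewrite adde_ge0// mule_ge0// lee_fin
  |by apply: emeasurable_funD; apply: measurable_funeM].
rewrite ge0_integralD//; [|by move=> w _; rewrite mule_ge0// lee_fin
  |exact: measurable_funeM|by move=> w _; rewrite mule_ge0// lee_fin
  |exact: measurable_funeM].
rewrite !ge0_integralZl_EFin// !ge0_integral_sum//.
rewrite integral_cst// [X in (c0%:E * X)%E]probability_setT mule1.
apply: (@le_trans _ _ (c0%:E + (c1%:E * (tau%:R)%:E + c2%:E * (n%:R * (4 * sigma))%:E))%E).
  apply: leeD => //; apply: leeD; apply: lee_wpmul2l; rewrite ?lee_fin//.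
    under eq_bigr do rewrite expectation_exp_noise.
    by rewrite sumEFin lee_fin big_enum/= sumr_const ler_nat.
  apply: (le_trans (lee_sum _ (fun i _ => expectation_abs_noise i))).
  by rewrite sumEFin lee_fin sumr_const card_ord -[_ *+ n]mulr_natl.
rewrite -!EFinM -!EFinD lee_fin /c0 /c1 /c2 /lam.
rewrite le_eqVlt; apply/orP; left; apply/eqP; field.
by rewrite !gt_eqF// ltr0n.
Qed.

End Noise.

(** * Expectations over covariates and noise *)

Section Expectations.
Context {R : realType} {dT : measure_display} {T : measurableType dT}
  {disp : measure_display} {Om : measurableType disp} (P : probability Om R)
  (n : nat) (mu : probability T R) (sigma : R)
  (X : 'I_n -> {RV P >-> T}) (eps : 'I_n -> {RV P >-> R}).
Hypothesis des : iid_design mu sigma X eps.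
Hypothesis sigma0 : 0 < sigma.
Context (Gamma delta : R) (fs : T -> R) (tau : nat).
Hypothesis n0 : (0 < n)%N.
Hypothesis G0 : 0 < Gamma.
Hypothesis d0 : 0 <= delta.
Hypothesis fs_le : forall y, `|fs y| <= Gamma.
Hypothesis mfs : measurable_fun setT fs.
Hypothesis tau0 : (0 < tau)%N.

Let n0' : 0 < (n%:R : R). Proof. by rewrite ltr0n. Qed.

Lemma expectation_covariate (h : T -> R) i : measurable_fun setT h ->
  (forall y, 0 <= h y) ->
  (\int[P]_w (h (X i w))%:E = \int[mu]_y (h y)%:E)%E.
Proof.
move=> mh h0; transitivity (\int[distribution P (X i)]_y (h y)%:E)%E.
  by rewrite ge0_integral_distribution//; exact/measurable_EFinP.
apply: eq_measure_integral => A mA _; case: des => HX _ _; exact: HX.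
Qed.

Lemma expectation_empirical (h : T -> R) : measurable_fun setT h ->
  (forall y, 0 <= h y) ->
  (\int[P]_w (n%:R^-1 * \sum_i h (X i w))%:E = \int[mu]_y (h y)%:E)%E.
Proof.
move=> mh h0.
rewrite (eq_integral (fun w => (n%:R^-1%:E * \sum_i (h (X i w))%:E)%E)); last first.
  by move=> w _; rewrite sumEFin.
have mhX i : measurable_fun setT (fun w => (h (X i w))%:E).
  by apply/measurable_EFinP; apply: measurableT_comp => //; exact: measurable_funP.
rewrite ge0_integralZl_EFin//; [|by move=> w _; apply: sume_ge0 => i _; rewrite lee_fin
  |exact: emeasurable_sum].
rewrite ge0_integral_sum//; last by move=> i w _; rewrite lee_fin.
under eq_bigr do rewrite expectation_covariate//.
rewrite (eq_bigr (fun=> (1%:E * \int[mu]_y (h y)%:E)%E)); last by move=> i _; rewrite mul1e.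
rewrite -ge0_sume_distrl; last by move=> i _; rewrite lee_fin.
by rewrite sumEFin sumr_const card_ord muleA -EFinM mulVf ?mul1e// gt_eqF.
Qed.

Section Finite.
Context (K : finType) (f0 : T -> R) (g : K -> T -> R).
Hypothesis f0_le : forall y, `|f0 y| <= Gamma.
Hypothesis g_le : forall k y, `|g k y| <= Gamma.
Hypothesis mf0 : measurable_fun setT f0.
Hypothesis mg : forall k, measurable_fun setT (g k).
Hypothesis cover : forall z : 'I_n + 'I_n -> T, exists2 pi : K -> K,
  (#|pi @: K| <= tau)%N & forall k i, `|g k (z i) - g (pi k) (z i)| <= delta.

(** [mixed_law] puts the noise on an independent copy, and the bound for fixed covariates is
    integrated. *)
Lemma expectation_joint_noise :
  (\int[P]_w (\big[Num.max/0]_k noise f0 g k (fun i => X i w) (fun i => eps i w))%:E <=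
   (8 * sigma ^+ 2 / n%:R * (ln tau%:R + 1) + 8 * delta * sigma + Gamma * delta)%:E)%E.
Proof.
pose F (z : g_sigma_algebraType (@rectangles _ _ T (measurableTypeR R) n)) :=
  (\big[Num.max/0]_k noise f0 g k (fun i => (z i).1) (fun i => (z i).2))%:E.
have mF : measurable_fun setT F.
  apply/measurable_EFinP; apply: measurable_bigmaxr => k.
  have m1 i := @measurable_eval1 _ _ T (measurableTypeR R) n i.
  have m2 i := @measurable_eval2 _ _ T (measurableTypeR R) n i.
  have mv i : measurable_fun setT
    (fun z : g_sigma_algebraType (@rectangles _ _ T (measurableTypeR R) n) =>
       g k (z i).1 - f0 (z i).1).
    by apply: measurable_funB; [exact: (measurableT_comp (mg k) (m1 i))
      |exact: (measurableT_comp mf0 (m1 i))].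
  apply: measurable_funM => //; apply: measurable_sum => i; apply: measurable_funB.
    by apply: measurable_funM => //; apply: measurable_funM => //; exact: m2.
  by apply: measurable_funM => //; exact: measurable_funX.
have F0 z : (0 <= F z)%E by rewrite lee_fin; exact: bigmax_ge_id.
have mFX : measurable_fun setT
    (fun u : Om * Om => F (fun i => (X i u.1, eps i u.2))).
  apply: (measurableT_comp mF); apply: measurable_family => i /=.
    exact: (measurableT_comp (measurable_funP (X i)) measurable_fst).
  exact: (measurableT_comp (measurable_funP (eps i)) measurable_snd).
rewrite (mixed_law des (fun=> false) (fun=> true) mF F0) fubini_tonelli1//.
set c := (X in (_ <= X%:E)%E).
apply: (@le_trans _ _ (\int[P]_w c%:E)%E).
  apply: ge0_le_integral => //.
  - by move=> w _; apply: integral_ge0.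
  - exact: measurable_fun_fubini_tonelli_F.
  move=> w _; rewrite /fubini_F /F/=.
  (* The covering hypothesis speaks of 2n points; the sample is listed twice. *)
  have [pi cpi ppi] := cover (fun i => X (match i with inl j => j | inr j => j end) w).
  by apply: (expectation_max_noise des _ _ _ _ f0_le g_le tau0 cpi) => // k i; exact: (ppi k (inl i)).
by rewrite integral_cst// [X in (c%:E * X)%E]probability_setT mule1.
Qed.

Lemma expectation_deviation :
  (\int[P]_w (\big[Num.max/0]_k
     (fine (\int[mu]_y ((g k y - fs y) ^+ 2)%:E) -
      2 * (n%:R^-1 * \sum_i (g k (X i w) - fs (X i w)) ^+ 2)))%:E <=
   (40 * Gamma ^+ 2 / n%:R * (ln tau%:R + 1) + 12 * Gamma * delta)%:E)%E.
Proof.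
pose V := g_sigma_algebraType (@rectangles _ _ T T n).
pose F (z : V) := (\big[Num.max/0]_k
  deviation fs g k (fun i => (z i).1) (fun i => (z i).2))%:E.
have mq k : measurable_fun setT (fun y => (g k y - fs y) ^+ 2).
  by apply: measurable_funX; exact: measurable_funB.
have mF : measurable_fun setT F.
  apply/measurable_EFinP; apply: measurable_bigmaxr => k.
  apply: measurable_funM => //; apply: measurable_sum => i; apply: measurable_funB.
    exact: (measurableT_comp (mq k) (@measurable_eval2 _ _ T T n i)).
  apply: measurable_funM => //.
  exact: (measurableT_comp (mq k) (@measurable_eval1 _ _ T T n i)).
have F0 z : (0 <= F z)%E by rewrite lee_fin; exact: bigmax_ge_id.
have mX1 i : measurable_fun setT (fun u : Om * Om => X i u.1).
  exact: (measurableT_comp (measurable_funP (X i)) measurable_fst).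
have mX2 i : measurable_fun setT (fun u : Om * Om => X i u.2).
  exact: (measurableT_comp (measurable_funP (X i)) measurable_snd).
have mFs (s : 'I_n -> bool) : measurable_fun setT (fun u : Om * Om =>
    F (fun i => (X i (if s i then u.2 else u.1), X i (if s i then u.1 else u.2)))).
  apply: (measurableT_comp mF); apply: measurable_family => i /=.
    by case: (s i); [exact: mX2|exact: mX1].
  by case: (s i); [exact: mX1|exact: mX2].
have mFX : measurable_fun setT (fun u : Om * Om => F (fun i => (X i u.1, X i u.2))).
  exact: (mFs (fun=> false)).
have q_le k y : 0 <= (g k y - fs y) ^+ 2 <= 4 * Gamma ^+ 2.
  have := fs_le y; have := g_le k y; rewrite !ler_norml => /andP[a b] /andP[c d].
  by rewrite sqr_ge0/=; nra.
have q_fin k : (\int[mu]_y ((g k y - fs y) ^+ 2)%:E)%E \is a fin_num.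
  rewrite ge0_fin_numE; last by apply: integral_ge0 => y _; rewrite lee_fin sqr_ge0.
  apply: (@le_lt_trans _ _ (\int[mu]_y (4 * Gamma ^+ 2)%:E)%E).
    apply: ge0_le_integral => //.
    - by move=> y _; rewrite lee_fin sqr_ge0.
    - exact/measurable_EFinP.
    - by move=> y _; rewrite lee_fin; have /andP[] := q_le k y.
  by rewrite integral_cst// [X in (_ * X)%E]probability_setT mule1 ltry.
(* Jensen: the population loss is the expected empirical loss on a ghost sample. *)
have ghost w : ((\big[Num.max/0]_k
     (fine (\int[mu]_y ((g k y - fs y) ^+ 2)%:E) -
      2 * (n%:R^-1 * \sum_i (g k (X i w) - fs (X i w)) ^+ 2)))%:E <=
    \int[P]_w' F (fun i => (X i w, X i w')))%E.
  apply: (big_ind (fun a : R => (a%:E <= \int[P]_w' F (fun i => (X i w, X i w')))%E)).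
  - by apply: integral_ge0.
  - by move=> a b ha hb; rewrite EFin_max ge_max ha hb.
  move=> k _; set c := 2 * _.
  have c0 : 0 <= c.
    by rewrite !mulr_ge0 ?invr_ge0 ?(ltW n0')//; apply: sumr_ge0 => i _; exact: sqr_ge0.
  rewrite EFinB leeBlDr// fineK//.
  rewrite -(expectation_empirical (mq k)); last by move=> y; exact: sqr_ge0.
  have -> : c%:E = (\int[P]_w' c%:E)%E.
    by rewrite integral_cst// [X in (_ * X)%E]probability_setT mule1.
  have mFw : measurable_fun setT (fun w' => F (fun i => (X i w, X i w'))).
    exact: (measurable_fun_pair2 w mFX).
  rewrite -ge0_integralD//.
  apply: ge0_le_integral => //.
  - move=> w' _; rewrite lee_fin mulr_ge0 ?invr_ge0 ?(ltW n0')//.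
    by apply: sumr_ge0 => i _; exact: sqr_ge0.
  - apply/measurable_EFinP; apply: measurable_funM => //; apply: measurable_sum => i.
    exact: (measurableT_comp (mq k) (measurable_funP (X i))).
  - exact: emeasurable_funD.
  move=> w' _; rewrite -EFinD lee_fin -lerBlDr.
  apply: le_trans (le_bigmax _ _ k).
  rewrite /deviation /c mulrCA -mulrBr mulr_sumr -sumrB.
  by rewrite le_eqVlt; apply/orP; left; apply/eqP.
set c := (X in (_ <= X%:E)%E).
apply: (@le_trans _ _ (\int[P]_w \int[P]_w' F (fun i => (X i w, X i w')))%E).
  apply: ge0_le_integral => //.
  - by move=> w _; rewrite lee_fin; exact: bigmax_ge_id.
  - apply/measurable_EFinP; apply: measurable_bigmaxr => k; apply: measurable_funB => //.
    apply: measurable_funM => //; apply: measurable_funM => //; apply: measurable_sum => i.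
    exact: (measurableT_comp (mq k) (measurable_funP (X i))).
  - exact: (measurable_fun_fubini_tonelli_F _ mFX (fun=> F0 _)).
have -> : (\int[P]_w \int[P]_w' F (fun i => (X i w, X i w')) =
    \int[P \x P]_u F (fun i => (X i u.1, X i u.2)))%E.
  by rewrite (fubini_tonelli1 _ mFX (fun=> F0 _)).
pose N : R := 2 ^+ n.
have N0 : 0 < N by rewrite exprn_gt0.
(* By [swap_law] all 2^n swaps give the same integral, which is therefore the integral of their
   average. *)
have -> : (\int[P \x P]_u F (fun i => (X i u.1, X i u.2)) =
  \int[P \x P]_u (N^-1%:E * \sum_(s : {ffun 'I_n -> bool})
    F (fun i => (X i (if s i then u.2 else u.1), X i (if s i then u.1 else u.2)))))%E.
  rewrite ge0_integralZl_EFin//; [|by move=> u _; apply: sume_ge0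
    |exact: emeasurable_sum|by rewrite invr_ge0 ltW].
  rewrite ge0_integral_sum//.
  under [in RHS]eq_bigr do rewrite -(swap_law des _ mF F0).
  set I := (\int[_]_u _)%E.
  rewrite (eq_bigr (fun=> (1%:E * I)%E)); last by move=> s _; rewrite mul1e.
  rewrite -ge0_sume_distrl; last by move=> s _; rewrite lee_fin.
  rewrite sumEFin sumr_const card_ffun card_bool card_ord natrX muleA -EFinM mulVf ?mul1e//.
  by rewrite gt_eqF.
apply: (@le_trans _ _ (\int[P \x P]_u c%:E)%E); last first.
  by rewrite integral_cst// [X in (_ * X)%E]probability_setT mule1.
apply: ge0_le_integral => //.
- by move=> u _; rewrite mule_ge0 ?sume_ge0// lee_fin invr_ge0 ltW.
- by apply: measurable_funeM; exact: emeasurable_sum.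
move=> u _; rewrite /F sumEFin -EFinM lee_fin.
(* The net is taken for both samples together: swaps permute these 2n points, so it does not depend
   on the signs. *)
have [pi cpi ppi] := cover (fun i => match i with inl j => X j u.1 | inr j => X j u.2 end).
have := deviation_swap_max n0 G0 fs_le g_le tau0 cpi d0
  (fun k i => ppi k (inl i)) (fun k i => ppi k (inr i)).
congr (_ <= _); congr (_ * _); apply: eq_bigr => s _.
by apply: eq_bigr => k _; congr deviation; apply/funext => i; case: (s i).
Qed.

End Finite.
End Expectations.

(** * From finite maxima to a countable family *)

Section Oracle.
Context {R : realType} {dT : measure_display} {T : measurableType dT}
  {disp : measure_display} {Om : measurableType disp} (P : probability Om R)
  (n : nat) (mu : probability T R) (sigma : R)
  (X : 'I_n -> {RV P >-> T}) (eps : 'I_n -> {RV P >-> R}).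
Hypothesis des : iid_design mu sigma X eps.
Hypothesis sigma0 : 0 < sigma.
Context (Gamma : R) (fs f0 : T -> R) (g : nat -> T -> R) (tau : nat).
Hypothesis n0 : (0 < n)%N.
Hypothesis G0 : 0 < Gamma.
Hypothesis fs_le : forall y, `|fs y| <= Gamma.
Hypothesis f0_le : forall y, `|f0 y| <= Gamma.
Hypothesis g_le : forall k y, `|g k y| <= Gamma.
Hypothesis mfs : measurable_fun setT fs.
Hypothesis mf0 : measurable_fun setT f0.
Hypothesis mg : forall k, measurable_fun setT (g k).
Hypothesis tau0 : (0 < tau)%N.
Hypothesis cover : forall J (z : 'I_n + 'I_n -> T), exists2 pi : 'I_J -> 'I_J,
  (#|pi @: 'I_J| <= tau)%N &
  forall (k : 'I_J) i, `|g k (z i) - g (pi k) (z i)| <= Gamma / n%:R.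

Definition excess (h : T -> R) (w : Om) : R :=
  fine (\int[mu]_y ((h y - fs y) ^+ 2)%:E) -
  2 * (n%:R^-1 * \sum_i (h (X i w) - fs (X i w)) ^+ 2).

Definition noise_fun (h : T -> R) (w : Om) : R :=
  n%:R^-1 * \sum_i (2 * eps i w * (h (X i w) - f0 (X i w)) -
                    (h (X i w) - f0 (X i w)) ^+ 2 / 4).

Definition emp_loss (h : T -> R) (w : Om) : R :=
  n%:R^-1 * \sum_i (h (X i w) - fs (X i w)) ^+ 2.

Let n0' : 0 < (n%:R : R). Proof. by rewrite ltr0n. Qed.

(** The suprema are increasing limits of maxima over k < J, which are measurable and whose
    expectation is bounded independently of J; monotone convergence concludes. The slack [eta]
    admits estimators that are only limits of the family. *)
Lemma oracle_countable (L : Om -> \bar R) :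
  measurable_fun setT L -> (forall w, 0 <= L w)%E ->
  {ae P, forall w, forall eta, 0 < eta -> exists k,
     (L w <= (6 * emp_loss f0 w + 4 * noise_fun (g k) w + excess (g k) w + eta)%:E)%E} ->
  (\int[P]_w L w <= 6%:E * \int[mu]_y ((f0 y - fs y) ^+ 2)%:E +
    (120 * Num.max (sigma ^+ 2) (Gamma ^+ 2) * (ln tau%:R + 1) / n%:R)%:E)%E.
Proof.
move=> mL L0 aeL.
pose NS J w := \big[Num.max/0]_(k < J) noise_fun (g k) w.
pose DS J w := \big[Num.max/0]_(k < J) excess (g k) w.
pose V J w : \bar R := (6 * emp_loss f0 w + 4 * NS J w + DS J w)%:E.
have emp0 w : 0 <= emp_loss f0 w.
  by rewrite mulr_ge0 ?invr_ge0 ?(ltW n0')//; apply: sumr_ge0 => i _; exact: sqr_ge0.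
have NS0 J w : 0 <= NS J w by exact: bigmax_ge_id.
have DS0 J w : 0 <= DS J w by exact: bigmax_ge_id.
have V0 J w : (0 <= V J w)%E by rewrite lee_fin !addr_ge0// mulr_ge0.
have mX (h : T -> R) i : measurable_fun setT h -> measurable_fun setT (fun w => h (X i w)).
  by move=> mh; exact: (measurableT_comp mh (measurable_funP (X i))).
have memp h : measurable_fun setT h -> measurable_fun setT (emp_loss h).
  move=> mh; apply: measurable_funM => //; apply: measurable_sum => i.
  by apply: measurable_funX; apply: measurable_funB; exact: mX.
have mNS J : measurable_fun setT (NS J).
  apply: measurable_bigmaxr => k.
  apply: measurable_funM => //; apply: measurable_sum => i.
  have mv : measurable_fun setT (fun w => g k (X i w) - f0 (X i w)).
    by apply: measurable_funB; exact: mX.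
  apply: measurable_funB; last by apply: measurable_funM => //; exact: measurable_funX.
  by apply: measurable_funM => //; apply: measurable_funM => //; exact: measurable_funP.
have mDS J : measurable_fun setT (DS J).
  apply: measurable_bigmaxr => k; apply: measurable_funB => //.
  by apply: measurable_funM => //; exact: memp.
have mV J : measurable_fun setT (V J).
  apply/measurable_EFinP; apply: measurable_funD => //; apply: measurable_funD.
    by apply: measurable_funM => //; exact: memp.
  exact: measurable_funM.
have mono (a : nat -> R) J J' : (J <= J')%N ->
    \big[Num.max/0]_(k < J) a k <= \big[Num.max/0]_(k < J') a k.
  move=> JJ'; apply/bigmax_leP; split=> [|k _]; first exact: bigmax_ge_id.
  exact: (le_bigmax _ (fun j : 'I_J' => a j) (widen_ord JJ' k)).
have ndV w : {homo V ^~ w : J J' / (J <= J')%N >-> (J <= J')%E}.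
  move=> J J' JJ'; rewrite lee_fin -!addrA lerD2l; apply: lerD.
    by rewrite ler_pM2l//; exact: (mono (fun k => noise_fun (g k) w)).
  exact: (mono (fun k => excess (g k) w)).
set B := (120 * _ * _ / _).
pose V' := Num.max (sigma ^+ 2) (Gamma ^+ 2).
have bound J : (\int[P]_w V J w <=
    6%:E * \int[mu]_y ((f0 y - fs y) ^+ 2)%:E + B%:E)%E.
  have d0 : 0 <= Gamma / n%:R by rewrite divr_ge0// ltW.
  have -> : (\int[P]_w V J w = 6%:E * \int[P]_w (emp_loss f0 w)%:E +
      (4%:E * \int[P]_w (NS J w)%:E + \int[P]_w (DS J w)%:E))%E.
    rewrite (eq_integral (fun w => 6%:E * (emp_loss f0 w)%:E +
      (4%:E * (NS J w)%:E + (DS J w)%:E))%E); last first.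
      by move=> w _; rewrite -!EFinM -!EFinD addrA.
    have m1 : measurable_fun setT (fun w => (emp_loss f0 w)%:E).
      by apply/measurable_EFinP; exact: memp.
    have m2 : measurable_fun setT (fun w => (NS J w)%:E) by exact/measurable_EFinP.
    have m3 : measurable_fun setT (fun w => (DS J w)%:E) by exact/measurable_EFinP.
    rewrite ge0_integralD//; [|by move=> w _; rewrite mule_ge0 ?lee_fin
      |exact: measurable_funeM|by move=> w _; rewrite adde_ge0 ?mule_ge0 ?lee_fin
      |by apply: emeasurable_funD => //; exact: measurable_funeM].
    rewrite ge0_integralD//; [|by move=> w _; rewrite mule_ge0 ?lee_fin
      |exact: measurable_funeM|by move=> w _; rewrite lee_fin].
    rewrite ge0_integralZl_EFin//; last by move=> w _; rewrite lee_fin.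
    by rewrite ge0_integralZl_EFin// => w _; rewrite lee_fin.
  rewrite (expectation_empirical des n0 (h := fun y => (f0 y - fs y) ^+ 2)); last 2 first.
  - by apply: measurable_funX; exact: measurable_funB.
  - by move=> y; exact: sqr_ge0.
  apply: leeD => //.
  have hN := expectation_joint_noise des sigma0 n0 G0 d0 tau0 f0_le
    (fun k : 'I_J => g_le k) mf0 (fun k : 'I_J => mg k) (cover J).
  have hD := expectation_deviation des n0 G0 d0 fs_le mfs tau0
    (fun k : 'I_J => g_le k) (fun k : 'I_J => mg k) (cover J).
  apply: le_trans (leeD (lee_wpmul2l _ hN) hD) _; first by rewrite lee_fin.
  rewrite -EFinM -EFinD lee_fin /B -/V'.
  have V1 : sigma ^+ 2 <= V' by rewrite le_max lexx.
  have V2 : Gamma ^+ 2 <= V' by rewrite le_max lexx orbT.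
  have l0 : 0 <= ln (tau%:R : R) by rewrite ln_ge0// ler1n.
  have V3 : Gamma * sigma <= V' by have := sqr_ge0 (Gamma - sigma); nra.
  (* The coefficients are 32 + 40 on [ln tau + 1] and 32 + 16 on the rest, and [ln tau + 1] is at
     least 1; they add up to 120. *)
  rewrite ler_pdivlMr// /B.
  have -> : (4 * (8 * sigma ^+ 2 / n%:R * (ln tau%:R + 1) + 8 * (Gamma / n%:R) * sigma +
      Gamma * (Gamma / n%:R)) +
      (40 * Gamma ^+ 2 / n%:R * (ln tau%:R + 1) + 12 * Gamma * (Gamma / n%:R))) * n%:R =
     (32 * sigma ^+ 2 + 40 * Gamma ^+ 2) * (ln tau%:R + 1) +
     (32 * (Gamma * sigma) + 16 * Gamma ^+ 2).
    by field; rewrite gt_eqF.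
  nra.
apply: (@le_trans _ _ (\int[P]_w limn (V ^~ w))%E).
  apply: ae_ge0_le_integral => //.
  - move=> w _; apply: lime_ge; first exact: ereal_nondecreasing_is_cvgn.
    by apply: nearW => J; exact: V0.
  - apply: (emeasurable_fun_cvg V) => // w _.
    exact: ereal_nondecreasing_is_cvgn.
  apply: filterS aeL => w hw _.
  apply/lee_addgt0Pr => eta eta0; have [k hk] := hw eta eta0.
  apply: le_trans hk _; rewrite EFinD leeD2r//.
  have : (V k.+1 w <= limn (V^~ w))%E.
    rewrite (cvg_lim _ (ereal_nondecreasing_cvgn (ndV w)))//.
    by apply: ereal_sup_ubound; exists k.+1.
  apply: le_trans; rewrite lee_fin -!addrA lerD2l lerD//.
    by rewrite ler_pM2l//; exact: (le_bigmax _ (fun j : 'I_k.+1 => noise_fun (g j) w) ord_max).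
  exact: (le_bigmax _ (fun j : 'I_k.+1 => excess (g j) w) ord_max).
rewrite monotone_convergence//.
apply: lime_le; last by apply: nearW => J; exact: bound.
apply: ereal_nondecreasing_is_cvgn => J J' JJ'.
by apply: ge0_le_integral => // w _; exact: ndV.
Qed.

End Oracle.

(** * Parametrization of the two classes *)

Section Trace.
Context {R : realType} {m : nat}.
Implicit Types (A M : 'M[R]_m) (v w : 'cV[R]_m).

Lemma bf_delta M i w : bf M (delta_mx i ord0) w = (M *m w) i ord0.
Proof.
rewrite bf_mulmx (bigD1 i)//= mxE !eqxx mul1r big1 ?addr0// => j /negbTE ji.
by rewrite mxE ji mul0r.
Qed.

(* Symmetric Gaussian elimination writes M as a sum of rank-one matrices v v^T. *)
Lemma psd_inner_ge0 A M : psd A -> psd M -> M^T = M ->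
  0 <= \sum_i \sum_j A i j * M i j.
Proof.
(* Induction on the number [r] of rows that may be nonzero; each step clears the last of them. *)
move=> Ap; suff h r : forall M, (forall i j : 'I_m, (r <= i)%N -> M i j = 0) ->
    psd M -> M^T = M -> 0 <= \sum_i \sum_j A i j * M i j.
  by apply: (h m) => i j; rewrite leqNgt ltn_ord.
elim: r => [|r IH] {}M Mr Mp Ms.
  by rewrite big1// => i _; rewrite big1// => j _; rewrite Mr// mulr0.
have [rm|rm] := ltnP r m; last first.
  by apply: IH => // i j ri; have := leq_trans rm ri; rewrite leqNgt ltn_ord.
pose i0 := Ordinal rm; pose e : 'cV[R]_m := delta_mx i0 ord0.
have Me w : bf M e w = \sum_j M i0 j * w j ord0 by rewrite bf_delta mxE.
have Mee : bf M e e = M i0 i0.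
  rewrite Me (bigD1 i0)//= mxE !eqxx mulr1 big1 ?addr0// => j /negbTE ji.
  by rewrite mxE ji mulr0.
have Msym i j : M i j = M j i by rewrite -{1}Ms mxE.
(* With a zero pivot, Cauchy-Schwarz makes the whole row vanish. *)
have [c0|c0] := eqVneq (M i0 i0) 0.
  apply: IH => // i j; rewrite leq_eqVlt => /predU1P[ri|]; last exact: Mr.
  have -> : i = i0 by exact/val_inj.
  have := psd_bilinear e (delta_mx j ord0) Ms Mp; rewrite Mee c0 mul0r => h.
  have : bf M e (delta_mx j ord0) = 0.
    by apply/eqP; rewrite -sqrf_eq0 eq_le h sqr_ge0.
  rewrite Me (bigD1 j)//= mxE !eqxx mulr1 big1 ?addr0// => k /negbTE kj.
  by rewrite mxE kj mulr0.
have cp : 0 < M i0 i0.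
  by rewrite lt_def c0 -Mee /=; move/psdP: Mp; exact.
(* The Schur complement, positive semidefinite by Cauchy-Schwarz; the subtracted rank-one term pairs
   with [A] to a value of its quadratic form. *)
pose M' := \matrix_(i, j) (M i j - M i i0 * M j i0 / M i0 i0).
have -> : \sum_i \sum_j A i j * M i j = \sum_i \sum_j A i j * M' i j +
    (M i0 i0)^-1 * bf A (col i0 M) (col i0 M).
  rewrite mulr_sumr -big_split; apply: eq_bigr => i _.
  by rewrite mulr_sumr -big_split; apply: eq_bigr => j _; rewrite !mxE /=; ring.
apply: addr_ge0; last by rewrite mulr_ge0 ?invr_ge0 ?(ltW cp)//; move/psdP: Ap; exact.
apply: IH.
- move=> i j; rewrite leq_eqVlt mxE => /predU1P[ri|ri]; last first.
    by rewrite (Mr i j)// (Mr i i0)// !mul0r subrr.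
  have -> : i = i0 by exact/val_inj.
  by rewrite mulrAC mulfV// mul1r Msym subrr.
- apply/psdP => w.
  have -> : bf M' w w = bf M w w - bf M e w ^+ 2 / M i0 i0.
    rewrite Me expr2 mulr_suml mulr_suml -sumrB; apply: eq_bigr => i _.
    rewrite mulr_sumr mulr_suml -sumrB; apply: eq_bigr => j _.
    by rewrite mxE (Msym i i0) (Msym j i0); field.
  by rewrite subr_ge0 ler_pdivrMr// mulrC -Mee; exact: psd_bilinear.
- by apply/matrixP => i j; rewrite !mxE Msym; ring.
Qed.

End Trace.

Section Spectratope.
Context {R : realType} {m k d : nat}.
Hypothesis m0 : (0 < m)%N.

Definition same_block (i j : 'I_m) := (i %/ k == j %/ k)%N.

(** The rank-one projection onto [v], cut down to its diagonal blocks. Against a block diagonal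
    matrix the cut is invisible, so the pairing is the Rayleigh quotient at [v]. *)
Definition block_proj (v : 'cV[R]_m) : 'M[R]_m :=
  \matrix_(i, j) (if same_block i j then v i ord0 * v j ord0 / sqn v else 0).

Lemma block_proj_spectraplex v : v != 0 -> spectraplex k (block_proj v).
Proof.
move=> v0; have vp := sqn_gt0 v0; split.
- split; first by apply/matrixP => i j; rewrite !mxE /same_block eq_sym [v j _ * _]mulrC.
  by move=> i j ij; rewrite mxE /same_block (negbTE ij).
- rewrite /mxtrace (eq_bigr (fun i => v i ord0 ^+ 2 / sqn v)).
    by rewrite -mulr_suml divff// gt_eqF.
  by move=> i _; rewrite mxE /same_block eqxx expr2.
- apply/psdP => w; pose blk b := \sum_(i < m | (i %/ k == b)%N) v i ord0 * w i ord0.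
  have -> : bf (block_proj v) w w = (\sum_(b < m.+1) blk b ^+ 2) / sqn v.
    rewrite mulr_suml.
    have lt_blk (i : 'I_m) : (i %/ k < m.+1)%N.
      by rewrite ltnS (leq_trans (leq_div _ _))// ltnW.
    transitivity (\sum_(i < m) v i ord0 * w i ord0 * blk (i %/ k)%N / sqn v).
      apply: eq_bigr => i _; rewrite /blk mulr_sumr mulr_suml [RHS]big_mkcond/=.
      apply: eq_bigr => j _; rewrite mxE /same_block eq_sym.
      by case: ifP => _; [field; rewrite gt_eqF|rewrite mul0r].
    rewrite (partition_big (fun i : 'I_m => Ordinal (lt_blk i)) xpredT)//=.
    apply: eq_bigr => b _; rewrite expr2 [X in X * _ / _]/blk mulr_suml mulr_suml.
    apply: eq_big => [i|i /eqP <-//]; by rewrite -val_eqE.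
  by rewrite divr_ge0 ?(ltW vp)//; apply: sumr_ge0 => b _; exact: sqr_ge0.
Qed.

Variable L : {linear 'M[R]_m -> 'rV[R]_d}.

(** The matrix representing coordinate [l] of [L] for the trace pairing, projected onto the
    symmetric block diagonal matrices, on which it gives the same values. *)
Definition coef_mx (l : 'I_d) : 'M[R]_m :=
  \matrix_(i, j) (if same_block i j then
    (L (delta_mx i j) ord0 l + L (delta_mx j i) ord0 l) / 2 else 0).

Lemma coef_mx_sym l : block_sym k (coef_mx l).
Proof.
split; first by apply/matrixP => i j; rewrite !mxE /same_block eq_sym addrC.
by move=> i j ij; rewrite mxE /same_block (negbTE ij).
Qed.

Lemma coef_mxE M l : block_sym k M ->
  L M ord0 l = \sum_i \sum_j coef_mx l i j * M i j.
Proof.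
move=> [Ms Mb]; have Msym i j : M i j = M j i by rewrite -{1}Ms mxE.
have LM : L M ord0 l = \sum_i \sum_j L (delta_mx i j) ord0 l * M i j.
  rewrite {1}(matrix_sum_delta M) linear_sum summxE; apply: eq_bigr => i _.
  rewrite linear_sum summxE; apply: eq_bigr => j _.
  by rewrite linearZ mxE mulrC.
have LM' : L M ord0 l = \sum_i \sum_j L (delta_mx j i) ord0 l * M i j.
  rewrite LM exchange_big; apply: eq_bigr => i _; apply: eq_bigr => j _.
  by rewrite (Msym j i).
have -> : L M ord0 l = (L M ord0 l + L M ord0 l) / 2 by field.
rewrite {1}LM LM' -big_split mulr_suml; apply: eq_bigr => i _.
rewrite -big_split mulr_suml; apply: eq_bigr => j _; rewrite mxE /=.
case: ifPn => [_|ij]; first by ring.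
by rewrite Mb//; ring.
Qed.

(** If t I - C is positive semidefinite, its pairing with a matrix of the spectraplex is
    nonnegative, so t bounds the supremum. Conversely the matrices [block_proj v] realize every
    Rayleigh quotient of C. *)
Lemma support_fun_lmax (u : 'rV[R]_d) :
  is_lmax (\sum_l u ord0 l *: coef_mx l) (support_fun (L @` spectraplex k) u).
Proof.
set C := \sum_l _.
have CE M : block_sym k M -> dotp u (L M) = \sum_i \sum_j C i j * M i j.
  move=> Mb; rewrite /dotp.
  under eq_bigr => l _ do rewrite (coef_mxE l Mb) mulr_sumr.
  rewrite exchange_big; apply: eq_bigr => i _.
  under eq_bigr do rewrite mulr_sumr.
  rewrite exchange_big; apply: eq_bigr => j _ /=.
  rewrite /C summxE mulr_suml; apply: eq_bigr => l _; rewrite !mxE; ring.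
pose S := [set dotp u x | x in L @` spectraplex k].
pose e : 'cV[R]_m := delta_mx (Ordinal m0) ord0.
have e0 : e != 0 by apply/cV0Pn; exists (Ordinal m0); rewrite mxE !eqxx oner_neq0.
have S0 : S !=set0.
  exists (dotp u (L (block_proj e))), (L (block_proj e)) => //.
  by exists (block_proj e) => //; exact: block_proj_spectraplex.
have Sle t : psd (t%:M - C) -> ubound S t.
  move=> tp _ [_ [M [Mb Mt Mp] <-] <-]; rewrite (CE _ Mb).
  have := psd_inner_ge0 tp Mp (proj1 Mb).
  have -> : \sum_i \sum_j (t%:M - C) i j * M i j = t - \sum_i \sum_j C i j * M i j.
    have tE : t = \sum_i \sum_j (t%:M : 'M[R]_m) i j * M i j.
      rewrite -[LHS]mulr1 -Mt mulr_sumr; apply: eq_bigr => i _.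
      rewrite (bigD1 i)//= mxE eqxx mulr1n big1 ?addr0// => j /negbTE ij.
      by rewrite mxE eq_sym ij mulr0n mul0r.
    rewrite [X in _ = X - _]tE -sumrB; apply: eq_bigr => i _; rewrite -sumrB.
    apply: eq_bigr => j _; by rewrite [(_ - C) i j]mxE [(- C) i j]mxE mulrBl.
  by rewrite subr_ge0.
have bfC v : v != 0 -> S (bf C v v / sqn v).
  move=> v0; have Pv := block_proj_spectraplex v0; have [Pb _ _] := Pv.
  exists (L (block_proj v)); first by exists (block_proj v).
  rewrite (CE _ Pb) mulr_suml; apply: eq_bigr => i _; rewrite mulr_suml.
  apply: eq_bigr => j _; rewrite [block_proj v i j]mxE; case: ifPn => [_|ij]; first by ring.
  suff -> : C i j = 0 by rewrite !mul0r.
  rewrite /C summxE big1// => l _; rewrite mxE.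
  by rewrite (proj2 (coef_mx_sym l) i j ij) mulr0.
have Sub : has_ubound S.
  exists (\sum_i \sum_j `|C i j|); apply: Sle; apply/psdP => v.
  rewrite bf_shift subr_ge0.
  by apply: le_trans (ler_norm _) (bf_bound _ _).
split=> t ts.
  move=> v v0; rewrite bf_shift subr_gt0 -ltr_pdivrMr ?sqn_gt0//.
  by apply: le_lt_trans ts; apply: ub_le_sup => //; exact: bfC.
by move=> /Sle/(ge_sup S0); rewrite leNgt ts.
Qed.

End Spectratope.

(** * Parametrized block diagonal pencils *)

Section Pencil.
Context {R : realType} {q m k : nat}.
Hypothesis m0 : (0 < m)%N.
Hypothesis k0 : (0 < k)%N.

(* The entry (i, j) of a block is stored at (i, j %% k): k parameters per row. *)
Definition pen_index : finType := ('I_q * 'I_m * 'I_k)%type.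
Local Notation N := #|{: pen_index}|.

Definition pen_coord (th : 'rV[R]_N) (l : 'I_q) (i j : 'I_m) : R :=
  th ord0 (enum_rank (l, i, Ordinal (ltn_pmod j k0))).

(** Averaging the two stored copies of an entry makes every parameter vector admissible, with
    entries linear in the parameters. *)
Definition pen_mx (c : 'I_q -> R) (th : 'rV[R]_N) : 'M[R]_m :=
  \matrix_(i, j) (if same_block (k := k) i j then
    \sum_l c l * ((pen_coord th l i j + pen_coord th l j i) / 2) else 0).

Lemma card_pen_index : N = (q * m * k)%N.
Proof. by rewrite !card_prod !card_ord. Qed.

Lemma pen_mx_polyfun c i j : polyfun 1 (fun th => pen_mx c th i j).
Proof.
apply: (polyfun_ext (f := fun th => if same_block (k := k) i j then
    \sum_l c l * ((pen_coord th l i j + pen_coord th l j i) / 2) else 0)).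
  by move=> th; rewrite mxE.
case: (same_block i j); last by apply: polyfunW (polyfun_cst 0).
apply: polyfun_sum => l; apply: polyfunZ.
apply: (polyfun_ext (f := fun th => 2^-1 * (pen_coord th l i j + pen_coord th l j i))).
  by move=> th; rewrite mulrC.
by apply: polyfunZ; apply: polyfunD; exact: polyfun_coord.
Qed.

Lemma pen_mx_sym c th : (pen_mx c th)^T = pen_mx c th.
Proof.
apply/matrixP => i j; rewrite !mxE /same_block eq_sym; case: ifP => // _.
by apply: eq_bigr => l _; rewrite [X in X / 2]addrC.
Qed.

Lemma pen_mx_surj (A : 'I_q -> 'M[R]_m) : (forall l, block_sym k (A l)) ->
  exists th, forall c, pen_mx c th = \sum_l c l *: A l.
Proof.
(* The default 0 is for columns beyond [m], which arise when the last block is incomplete. *)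
move=> Ab; pose val (u : pen_index) : R :=
  if insub (u.1.2 %/ k * k + u.2)%N is Some j then A u.1.1 u.1.2 j else 0.
exists (\row_t val (enum_val t)) => c; apply/matrixP => i j.
have co l (i' j' : 'I_m) : same_block (k := k) i' j' ->
    pen_coord (\row_t val (enum_val t)) l i' j' = A l i' j'.
  move=> /eqP ij; rewrite /pen_coord mxE enum_rankK /val /= ij -divn_eq.
  by rewrite valK.
rewrite mxE summxE; case: ifPn => ij.
  apply: eq_bigr => l _; rewrite mxE !co//; last by rewrite /same_block eq_sym.
  have -> : A l j i = A l i j by rewrite -{1}(proj1 (Ab l)) mxE.
  by congr (_ * _); field.
by rewrite big1// => l _; rewrite mxE (proj2 (Ab l) i j ij) mulr0.
Qed.

Lemma pen_mx_continuous (T : topologicalType) (c : T -> 'I_q -> R) th i j :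
  (forall l, continuous (c ^~ l)) -> continuous (fun x => pen_mx (c x) th i j).
Proof.
move=> cc; rewrite (_ : (fun x => _) = fun x => if same_block (k := k) i j then
    \sum_l c x l * ((pen_coord th l i j + pen_coord th l j i) / 2) else 0); last first.
  by apply/funext => x; rewrite mxE.
case: (same_block i j) => x; last exact: cvg_cst.
by apply: cvg_sumr => l; apply: cvgM; [exact: cc|exact: cvg_cst].
Qed.

Definition pen_fun (c : 'I_q -> R) (th : 'rV[R]_N) : R := lambda_max (pen_mx c th).

Lemma pen_fun_lmax c th : is_lmax (pen_mx c th) (pen_fun c th).
Proof. by apply: is_lmax_lambda_max => //; exact: pen_mx_sym. Qed.

Lemma pen_fun_continuous_arg (T : topologicalType) (c : T -> 'I_q -> R) th :
  (forall l, continuous (c ^~ l)) -> continuous (fun x => pen_fun (c x) th).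
Proof.
move=> cc x; apply: (is_lmax_continuous (B := fun x => pen_mx (c x) th)).
- by move=> i j; exact: pen_mx_continuous.
- by move=> y; exact: pen_mx_sym.
- by move=> y; exact: pen_fun_lmax.
Qed.

Lemma pen_fun_continuous_param c : continuous (pen_fun c).
Proof.
move=> th; apply: (is_lmax_continuous (B := fun th => pen_mx c th)).
- by move=> i j; exact: (polyfun_continuous (pen_mx_polyfun c i j)).
- by move=> y; exact: pen_mx_sym.
- by move=> y; exact: pen_fun_lmax.
Qed.

End Pencil.

Lemma is_lmax_unique {R : realType} {m : nat} (M : 'M[R]_m) (a b : R) :
  is_lmax M a -> is_lmax M b -> a = b.
Proof.
have h a' b' : is_lmax M a' -> is_lmax M b' -> a' <= b'.
  move=> [_ ha] [hb _]; rewrite leNgt; apply/negP => ba.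
  by apply: (ha ((a' + b') / 2)); [lra|apply: pd_psd; apply: hb; lra].
by move=> ha hb; apply/eqP; rewrite eq_le !h.
Qed.

(** * Measurability in R^d and the support of a measure *)

Section RowVectors.
Context {R : realType} {d : nat}.

Lemma rational_approx (x : 'rV[R]_d) (e : R) : 0 < e ->
  exists p : 'rV[rat]_d, `|x - map_mx ratr p| < e.
Proof.
move=> e0; have /choice[p pP] : forall i, exists p : rat, `|x ord0 i - ratr p| < e / 2.
  move=> i; have [|p] := @rat_in_itvoo R (x ord0 i - e / 2) (x ord0 i + e / 2).
    by lra.
  by rewrite in_itv/= => /andP[h1 h2]; exists p; rewrite ltr_norml; lra.
exists (\row_i p i); apply: (@le_lt_trans _ _ (e / 2)); last by lra.
apply: mx_norm_le => [|i j]; first by lra.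
by rewrite ord1 !mxE ltW.
Qed.

Lemma continuous_measurable_rV (f : 'rV[R]_d -> R) : continuous f ->
  measurable_fun setT (f : borel_rV R d -> R).
Proof.
move=> /continuousP cf; apply: (measurability _ (RGenOpens.measurableE R)).
move=> _ [_ [a [b ->] <-]]; rewrite setTI; apply: sub_sigma_algebra.
exact/cf/interval_open.
Qed.

Lemma closed_measurable_rV (A : set 'rV[R]_d) : closed A ->
  measurable (A : set (borel_rV R d)).
Proof.
move=> cA; rewrite -[A]setCK; apply: measurableC; apply: sub_sigma_algebra.
exact: closed_openC.
Qed.

Lemma closed_msupport (mu : set (borel_rV R d) -> \bar R) : closed (msupport mu).
Proof.
move=> x xcl U oU Ux.
have [y [yS Uy]] : msupport mu `&` U !=set0.
  by apply: xcl; exact: open_nbhs_nbhs.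
exact: yS.
Qed.

(** Second countability: a point off the support has a null neighbourhood, which contains a null
    ball with rational centre around the point, and there are countably many such balls. *)
Lemma msupport_full (mu : probability (borel_rV R d) R) : mu (msupport mu) = 1%E.
Proof.
pose I := ('rV[rat]_d * nat)%type.
pose B (u : I) : set 'rV[R]_d := ball (map_mx ratr u.1 : 'rV[R]_d) u.2.+1%:R^-1.
have mB u : measurable (B u : set (borel_rV R d)).
  by apply: sub_sigma_algebra; exact: ball_open.
pose F n : set (borel_rV R d) :=
  if unpickle n is Some u then (if mu (B u) == 0%E then B u else set0) else set0.
have mF n : measurable (F n).
  by rewrite /F; case: unpickle => // u; case: ifP.
have F0 n : mu (F n) = 0%E.
  by rewrite /F; case: unpickle => [u|]; [case: ifP => [/eqP//|_]|]; rewrite measure0.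
have sub : ~` (msupport mu) `<=` \bigcup_n F n.
  move=> x /existsNP[U /not_implyP[oU /not_implyP[Ux /negP]]]; rewrite -leNgt => U0.
  have [e /= e0 eU] := (iffLR (nbhs_ballP _ _) (open_nbhs_nbhs (conj oU Ux))).
  have [j ej] : exists j, (j.+1%:R^-1 : R) < e / 2.
    have e20 : 0 < e / 2 by lra.
    have := near_infty_natSinv_lt (PosNum e20) => -[j _ /(_ j)/(_ (leqnn _)) /= h].
    by exists j.
  have j0 : 0 < (j.+1%:R^-1 : R) by rewrite invr_gt0.
  have [p px] := rational_approx x j0.
  have BU : B (p, j) `<=` U.
    move=> y; rewrite /B -ball_normE => /= yb; apply: eU; rewrite -ball_normE /=.
    have -> : x - y = (x - map_mx ratr p) + (map_mx ratr p - y) by rewrite addrA subrK.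
    apply: le_lt_trans (ler_normD _ _) _.
    by rewrite [e]splitr ltrD// (lt_trans _ ej).
  have B0 : mu (B (p, j)) = 0%E.
    apply/eqP; rewrite eq_le measure_ge0 andbT; apply: le_trans U0.
    by apply: le_measure => //; rewrite inE//; exact: sub_sigma_algebra.
  exists (pickle (p, j)) => //; rewrite /F pickleK B0 eqxx.
  by rewrite /B -ball_normE /= distrC.
have mS : measurable (msupport mu : set (borel_rV R d)).
  by apply: closed_measurable_rV; exact: closed_msupport.
have C0 : mu (~` (msupport mu)) = 0%E.
  apply/eqP; rewrite eq_le measure_ge0 andbT.
  have -> : 0%E = mu (\bigcup_n F n).
    apply/esym/eqP; rewrite eq_le measure_ge0 andbT.
    apply: le_trans (measure_sigma_subadditive _ mF _ (@subset_refl _ _)) _.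
      exact: bigcupT_measurable.
    by rewrite eseries0// => i _ _; exact: F0.
  apply: le_measure => //; rewrite inE; first exact: measurableC.
  exact: bigcupT_measurable.
by have := probability_setC mu (measurableC mS); rewrite setCK C0 sube0.
Qed.

End RowVectors.

(** * Continuity of finite convex functions *)

Section ConvexContinuity.
Context {R : realType} {d : nat} (f : 'rV[R]_d -> R).
Hypothesis fconv : convex_function [set: 'rV[R]_d] f.

Lemma convex_functionP (t : R) (x y : 'rV[R]_d) : 0 <= t <= 1 ->
  f (t *: x + (1 - t) *: y) <= t * f x + (1 - t) * f y.
Proof.
move=> /andP[t0 t1]; by apply: (fconv (Itv01 t0 t1)); rewrite in_setE.
Qed.

Lemma convex_average n (y : nat -> 'rV[R]_d) :
  f (n.+1%:R^-1 *: \sum_(i < n.+1) y i) <= n.+1%:R^-1 * \sum_(i < n.+1) f (y i).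
Proof.
elim: n => [|n IH]; first by rewrite !big_ord1 invr1 scale1r mul1r.
pose t : R := n.+1%:R / n.+2%:R.
have t01 : 0 <= t <= 1.
  by rewrite divr_ge0//= ler_pdivrMr ?ltr0n// mul1r ler_nat.
have n1 : (n.+1%:R : R) != 0 by rewrite pnatr_eq0.
have n2 : (n.+2%:R : R) != 0 by rewrite pnatr_eq0.
have t1 : 1 - t = n.+2%:R^-1.
  by rewrite /t -(natr1 n.+1) in n2 *; field.
have tn : t * n.+1%:R^-1 = n.+2%:R^-1 by rewrite /t mulrAC mulfV// mul1r.
rewrite big_ord_recr/= [in leRHS]big_ord_recr/=.
have -> : n.+2%:R^-1 *: (\sum_(i < n.+1) y i + y n.+1) =
    t *: (n.+1%:R^-1 *: \sum_(i < n.+1) y i) + (1 - t) *: y n.+1.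
  by rewrite t1 scalerDr scalerA; rewrite tn.
apply: le_trans (convex_functionP _ _ t01) _; rewrite t1 mulrDr lerD2r.
by rewrite -[X in _ <= X * _]tn -[leRHS]mulrA ler_wpM2l//; case/andP: t01.
Qed.

Definition coord_variation (x : 'rV[R]_d) i : R :=
  `|f (x + delta_mx ord0 i) - f x| + `|f (x - delta_mx ord0 i) - f x|.

Lemma convex_coord_bound x i s : `|s| <= 1 ->
  f (x + s *: delta_mx ord0 i) - f x <= `|s| * coord_variation x i.
Proof.
move=> s1; have D1 := ler_norm (f (x + delta_mx ord0 i) - f x).
have D2 := ler_norm (f (x - delta_mx ord0 i) - f x).
have [s0|s0] := leP 0 s.
  have := convex_functionP (x + delta_mx ord0 i) x (t := s).
  rewrite s0 (le_trans (ler_norm s))// => /(_ isT).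
  have -> : s *: (x + delta_mx ord0 i) + (1 - s) *: x = x + s *: delta_mx ord0 i.
    by rewrite scalerDr addrAC -scalerDl [s + _]addrC subrK scale1r.
  rewrite ger0_norm// /coord_variation.
  have := normr_ge0 (f (x - delta_mx ord0 i) - f x); nra.
have s0' : 0 <= - s by lra.
have := convex_functionP (x - delta_mx ord0 i) x (t := - s).
rewrite s0' (le_trans (ler_norm (- s))) ?normrN// => /(_ isT).
have -> : (- s) *: (x - delta_mx ord0 i) + (1 - - s) *: x = x + s *: delta_mx ord0 i.
  by rewrite scalerDr addrAC -scalerDl [- s + _]addrC subrK scale1r scalerN scaleNr opprK.
rewrite ltr0_norm// /coord_variation.
have := normr_ge0 (f (x + delta_mx ord0 i) - f x); nra.
Qed.

End ConvexContinuity.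

(** Increments are bounded above by increments along the axes, which convexity bounds linearly;
    convexity at the midpoint of x + h and x - h turns this into a lower bound. The result is needed
    for the measurability of the regression function. *)
Lemma convex_continuous {R : realType} {d : nat} (f : 'rV[R]_d -> R) :
  convex_function [set: 'rV[R]_d] f -> continuous f.
Proof.
case: d f => [|n] g gconv x.
  suff -> : g = cst (g x) by exact: cst_continuous.
  by apply/funext => y; congr g; apply/rowP => -[].
have gP := convex_functionP gconv; have gavg := convex_average gconv.
have gcoord := convex_coord_bound gconv; pose E := coord_variation g.
pose C := 1 + \sum_i E x i.
have E0 i : 0 <= E x i by rewrite addr_ge0.
have C0 : 0 < C by apply: ltr_pwDl => //; apply: sumr_ge0 => i _; exact: E0.
have up h : `|h| <= n.+1%:R^-1 -> g (x + h) - g x <= `|h| * C.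
  move=> hs.
  (* x + h is the barycentre of its axis displacements, each enlarged by the dimension n + 1. *)
  have hsum : x + h = n.+1%:R^-1 *: \sum_(i < n.+1)
      (x + (n.+1%:R * h ord0 i) *: delta_mx ord0 i).
    rewrite big_split/= sumr_const card_ord -[x *+ _]scaler_nat scalerDr scalerA.
    rewrite mulVf ?pnatr_eq0// scale1r scaler_sumr; congr (_ + _).
    rewrite {1}(row_sum_delta h); apply: eq_bigr => i _.
    by rewrite scalerA mulrA mulVf ?pnatr_eq0// mul1r.
  have := gavg n (fun i => x + (n.+1%:R * h ord0 (inord i)) *: delta_mx ord0 (inord i)).
  under eq_bigr do rewrite inord_val; under [in X in _ <= X]eq_bigr do rewrite inord_val.
  rewrite -hsum => gle; rewrite lerBlDr; apply: le_trans gle _.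
  rewrite ler_pdivrMl// mulrDr mulr_natl -[in X in _ + X](card_ord n.+1) mulr_natl.
  rewrite -[X in _ + X](sumr_const 'I_n.+1) -lerBlDr -sumrB.
  apply: (@le_trans _ _ (\sum_i (n.+1%:R * `|h|) * E x i)).
    apply: ler_sum => i _.
    have hi : `|n.+1%:R * h ord0 i| <= n.+1%:R * `|h|.
      by rewrite normrM ger0_norm// ler_pM2l//; exact: mx_norm_coord.
    apply: le_trans (gcoord x i _ _) _; last by rewrite ler_wpM2r.
    by apply: le_trans hi _; rewrite -ler_pdivlMl// mulr1.
  rewrite -mulr_sumr -[leRHS]mulr_natl -mulrA !ler_wpM2l//.
  by rewrite /C lerDr.
have both h : `|h| <= n.+1%:R^-1 -> `|g x - g (x + h)| <= `|h| * C.
  move=> hs; rewrite ler_norml; have h1 := up h hs.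
  have h2 : g (x - h) - g x <= `|h| * C by rewrite -normrN; apply: up; rewrite normrN.
  have := gP 2^-1 (x + h) (x - h).
  have -> : 2^-1 *: (x + h) + (1 - 2^-1) *: (x - h) = x.
    have -> : 1 - 2^-1 = 2^-1 :> R by field.
    rewrite -scalerDr addrACA subrr addr0 -mulr2n -[x *+ 2]scaler_nat scalerA mulVf ?scale1r//.
  have h0 : 0 <= (2^-1 : R) <= 1 by lra.
  move=> /(_ h0); lra.
apply: (iffRL (@cvgrPdist_lt _ _ _ (nbhs x) _ g (g x))) => eps eps0; apply/nbhs_ballP.
exists (Num.min n.+1%:R^-1 (eps / C)); first by rewrite /= lt_min invr_gt0 ltr0n divr_gt0.
move=> y; rewrite -ball_normE /= lt_min => /andP[y1 y2].
have -> : y = x + (y - x) by rewrite addrC subrK.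
apply: le_lt_trans (both _ _) _; rewrite distrC; first exact: ltW.
by rewrite -ltr_pdivlMr.
Qed.

(** * Bounds and continuity of support functions *)

Section SupportFunction.
Context {R : realType} {d : nat} (K : set 'rV[R]_d) (Gamma : R).
Hypothesis G0 : 0 < Gamma.
Hypothesis K0 : K !=set0.
Hypothesis KG : K `<=` eball Gamma.

Let dotp_ge0 (x : 'rV[R]_d) : 0 <= dotp x x.
Proof. by apply: sumr_ge0 => i _; rewrite -expr2 sqr_ge0. Qed.

Let dotp_le x : K x -> dotp x x <= Gamma ^+ 2.
Proof.
move=> /KG; rewrite /eball /= /enorm => h.
rewrite -[dotp x x]sqr_sqrtr//; apply: lerXn2r => //; rewrite nnegrE ?sqrtr_ge0//.
exact: ltW.
Qed.

Let coord_le x i : K x -> `|x ord0 i| <= Gamma.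
Proof.
move=> Kx; have := dotp_le Kx; rewrite /dotp (bigD1 i)//=.
have : 0 <= \sum_(j | j != i) x ord0 j * x ord0 j.
  by apply: sumr_ge0 => j _; rewrite -expr2 sqr_ge0.
rewrite -[`|_| <= _]ler_sqr ?nnegrE ?(ltW G0)// real_normK ?num_real// expr2; lra.
Qed.

Let dotp_norm u x : K x -> `|dotp u x| <= (\sum_i `|u ord0 i|) * Gamma.
Proof.
move=> Kx; apply: le_trans (ler_norm_sum _ _ _) _; rewrite mulr_suml.
by apply: ler_sum => i _; rewrite normrM ler_wpM2l// coord_le.
Qed.

Let dotpB (u v x : 'rV[R]_d) : dotp u x = dotp v x + dotp (u - v) x.
Proof. by rewrite /dotp -big_split; apply: eq_bigr => i _; rewrite !mxE /=; ring. Qed.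

Let sup_dotp (u : 'rV[R]_d) : has_sup [set dotp u x | x in K].
Proof.
split; first by have [x Kx] := K0; exists (dotp u x), x.
exists ((\sum_i `|u ord0 i|) * Gamma) => _ [x Kx <-].
exact: le_trans (ler_norm _) (dotp_norm u Kx).
Qed.

Lemma support_fun_bound (u : 'rV[R]_d) : enorm u = 1 -> `|support_fun K u| <= Gamma.
Proof.
move=> u1; have uu : dotp u u = 1 by rewrite -[LHS]sqr_sqrtr// -/(enorm u) u1 expr1n.
have bnd x : K x -> `|dotp u x| <= Gamma.
  move=> Kx; have := dotp_le Kx.
  (* Cauchy-Schwarz for a unit vector u, from |Gamma s u - x|^2 >= 0 with s = 1 and s = -1. *)
  have h (s : R) : s ^+ 2 = 1 -> 0 <= Gamma ^+ 2 - 2 * Gamma * s * dotp u x + dotp x x.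
    move=> s1.
    have -> : Gamma ^+ 2 - 2 * Gamma * s * dotp u x + dotp x x =
       \sum_i (Gamma * s * u ord0 i - x ord0 i) ^+ 2.
      have -> : Gamma ^+ 2 = Gamma ^+ 2 * s ^+ 2 * dotp u u by rewrite s1 uu !mulr1.
      rewrite /dotp !mulr_sumr -sumrB -big_split; apply: eq_bigr => i _ /=; ring.
    by apply: sumr_ge0 => i _; exact: sqr_ge0.
  have h1 := h 1 (expr1n _ _); have h2 := h (- 1) _.
  have {}h2 : 0 <= Gamma ^+ 2 - 2 * Gamma * (- 1) * dotp u x + dotp x x.
    by apply: h2; rewrite sqrrN expr1n.
  by have g0 := G0; rewrite ler_norml => h3; apply/andP; split; nra.
have [[v [x Kx _]] ub] := sup_dotp u.
rewrite ler_norml; apply/andP; split.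
  apply: (@le_trans _ _ (dotp u x)); first by have := bnd x Kx; rewrite ler_norml => /andP[].
  by apply: ub_le_sup => //; exists x.
apply: ge_sup; first by exists (dotp u x), x.
by move=> _ [y Ky <-]; apply: le_trans (ler_norm _) (bnd y Ky).
Qed.

Lemma support_fun_continuous : continuous (support_fun K).
Proof.
move=> u.
have lip v w : support_fun K v <= support_fun K w + (\sum_i `|(v - w) ord0 i|) * Gamma.
  apply: ge_sup; first by have [] := sup_dotp v.
  move=> _ [x Kx <-]; rewrite (dotpB v w); apply: lerD.
    by apply: ub_le_sup; [have [] := sup_dotp w|exists x].
  exact: le_trans (ler_norm _) (dotp_norm _ Kx).
pose C := 1 + d%:R * Gamma.
have C0 : 0 < C by rewrite ltr_pwDl// mulr_ge0// ltW.
have lipC v w : support_fun K v - support_fun K w <= `|v - w| * C.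
  rewrite lerBlDl; apply: le_trans (lip v w) _; rewrite lerD2l.
  apply: (@le_trans _ _ ((\sum_(i < d) `|v - w|) * Gamma)).
    by rewrite ler_wpM2r ?(ltW G0)//; apply: ler_sum => i _; exact: mx_norm_coord.
  rewrite sumr_const card_ord -[_ *+ d]mulr_natl mulrAC mulrC ler_wpM2l//.
  by rewrite /C lerDr.
apply: (iffRL (@cvgrPdist_lt _ _ _ (nbhs u) _ (support_fun K) (support_fun K u))).
move=> eps eps0; apply/nbhs_ballP; exists (eps / C); first by rewrite /= divr_gt0.
move=> v; rewrite -ball_normE /= => uv.
have uvC : `|u - v| * C < eps by rewrite -ltr_pdivlMr.
have := lipC u v; have := lipC v u; rewrite (distrC v) ltr_norml.
by move=> h1 h2; apply/andP; split; lra.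
Qed.

End SupportFunction.

(** * Oracle inequalities *)

Section ParamOracle.
Context {R : realType} {d q m k : nat}.
Hypothesis m0 : (0 < m)%N.
Hypothesis k0 : (0 < k)%N.
Local Notation N := #|{: pen_index (q := q) (m := m) (k := k)}|.
Context (c : 'rV[R]_d -> 'I_q -> R).
Hypothesis cc : forall l, continuous (c ^~ l).
Context {disp : measure_display} {Om : measurableType disp} (P : probability Om R)
  (n : nat) (mu : probability (borel_rV R d) R) (sigma : R)
  (X : 'I_n -> {RV P >-> borel_rV R d}) (eps : 'I_n -> {RV P >-> R}).
Hypothesis des : regression_design mu sigma X eps.
Hypothesis sigma0 : 0 < sigma.
Context (Gamma : R) (S : set (borel_rV R d)) (fs : borel_rV R d -> R).
Hypothesis n0 : (0 < n)%N.
Hypothesis G0 : 0 < Gamma.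
Hypothesis mS : measurable S.
Hypothesis S1 : mu S = 1%E.
Hypothesis mfs : measurable_fun setT fs.
Hypothesis fs_le : forall x, S x -> `|fs x| <= Gamma.

Let h (th : 'rV[R]_N) (x : borel_rV R d) : R := pen_fun k0 (c x) th.
Let C (th : 'rV[R]_N) := forall x, S x -> `|h th x| <= Gamma.

(* S carries mu; setting functions to 0 off S makes their bounds hold everywhere. *)
Definition truncate (f : borel_rV R d -> R) x : R := \1_S x * f x.

Lemma truncateE f x : S x -> truncate f x = f x.
Proof. by move=> Sx; rewrite /truncate indicE mem_set// mul1r. Qed.

Lemma truncateN f x : ~ S x -> truncate f x = 0.
Proof. by move=> Sx; rewrite /truncate indicE memNset// mul0r. Qed.

Lemma truncate_le f x : (forall x, S x -> `|f x| <= Gamma) -> `|truncate f x| <= Gamma.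
Proof.
move=> fle; have [Sx|Sx] := pselect (S x); first by rewrite truncateE// fle.
by rewrite truncateN// normr0 ltW.
Qed.

Lemma measurable_truncate f : measurable_fun setT f -> measurable_fun setT (truncate f).
Proof. by move=> mf; apply: measurable_funM => //; exact: measurable_indic. Qed.

Lemma measurable_h th : measurable_fun setT (h th).
Proof.
have hc : continuous (fun x : 'rV[R]_d => pen_fun k0 (c x) th).
  by apply: pen_fun_continuous_arg.
exact: (continuous_measurable_rV hc).
Qed.

(** The admissible set may contain no rational point. In each rational ball that meets it, an
    admissible parameter is selected instead. *)
Lemma dense_params th0 : C th0 -> exists g : nat -> 'rV[R]_N,
  (forall j, C (g j)) /\ forall th, C th -> forall e, 0 < e -> exists j, `|th - g j| < e.
Proof.
move=> C0; pose I := ('rV[rat]_N * nat)%type.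
pose Q (u : I) th := C th /\ `|th - map_mx ratr u.1| < u.2.+1%:R^-1.
have /choice[f fP] : forall j, exists th, C th /\
    forall u : I, unpickle j = Some u -> (exists th', Q u th') -> Q u th.
  move=> j; case: unpickle => [u|]; last by exists th0.
  have [[th Qth]|nQ] := pselect (exists th', Q u th').
    by exists th; split => [|_ [<-]//]; case: Qth.
  by exists th0; split => // _ [<-].
exists f; split=> [j|th Cth e e0]; first by case: (fP j).
have [j ej] : exists j, (j.+1%:R^-1 : R) < e / 2.
  have e20 : 0 < e / 2 by lra.
  have := near_infty_natSinv_lt (PosNum e20) => -[j _ /(_ j)/(_ (leqnn _)) /= ej].
  by exists j.
have j0 : 0 < (j.+1%:R^-1 : R) by rewrite invr_gt0.
have [p px] := rational_approx th j0.
exists (pickle (p, j)); have [_ /(_ (p, j))] := fP (pickle (p, j)).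
rewrite pickleK => /(_ erefl)[|_ /= fp]; first by exists th; split.
set g := f _ in fp *.
have -> : th - g = (th - map_mx ratr p) - (g - map_mx ratr p).
  by rewrite opprB addrA subrK.
apply: le_lt_trans (ler_normB _ _) _.
by rewrite [e]splitr ltrD// (lt_trans _ ej).
Qed.

(** The bound of [lmax_cover] for the 2n points of both samples and J = 2n, which makes the mesh
    Gamma / n. *)
Definition cover_size := ((N * (2 * (2 + (n + n) * (2 * n).+1 * m))).+1 ^ N)%N.

(** Only the points in [S] enter the cover, since the bound [Gamma] is known only there; at the
    others all truncations are 0. *)
Lemma truncated_cover J (th : nat -> 'rV[R]_N) : (forall j, C (th j)) ->
  forall z : 'I_n + 'I_n -> borel_rV R d, exists2 pi : 'I_J -> 'I_J,
  (#|pi @: 'I_J| <= cover_size)%N &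
  forall (t : 'I_J) i, `|truncate (h (th t)) (z i) - truncate (h (th (pi t))) (z i)|
    <= Gamma / n%:R.
Proof.
move=> Cth z; pose Z : finType := {i : 'I_n + 'I_n | `[< S (z i) >]}.
have := @lmax_cover R m N Z (fun i => pen_mx k0 (c (z (sval i)))) _ _ 'I_J
  (fun t => th t) (fun t i => h (th t) (z (sval i))) Gamma (2 * n) G0.
case=> [i a b|i x||t i|t i|pi cpi ppi].
- exact: pen_mx_polyfun.
- exact: pen_mx_sym.
- by rewrite muln_gt0.
- exact: pen_fun_lmax.
- by apply: Cth; exact/asboolP/(valP i).
exists pi.
  apply: leq_trans cpi _; rewrite /cover_size.
  have cZ : (#|Z| <= n + n)%N.
    by rewrite card_sig (leq_trans (max_card _))// card_sum card_ord.
  case: (posnP N) => [->//|N0]; rewrite leq_exp2r// ltnS leq_mul2l leq_mul2l/=.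
  by rewrite leq_add2l !leq_mul// orbT.
move=> t i; have [Sz|Sz] := pselect (S (z i)).
  have Sz' : `[< S (z i) >] by exact/asboolP.
  rewrite !(truncateE _ Sz); have := ppi t (exist _ i Sz'); move=> /le_trans; apply.
  by rewrite le_eqVlt; apply/orP; left; apply/eqP; rewrite natrM; field; rewrite pnatr_eq0 -lt0n.
by rewrite !(truncateN _ Sz) subrr normr0 divr_ge0// ltW.
Qed.

Lemma des_iid : iid_design mu sigma X eps.
Proof. by case: des => h1 h2 h3; split. Qed.

Lemma ae_covariates : {ae P, forall w, forall i, S (X i w)}.
Proof.
apply: (@filter_forall _ _ (fun i w => S (X i w))) => i.
exists (X i @^-1` (~` S)); split => //.
- by rewrite -[X in measurable X]setTI; apply: measurable_funP => //; exact: measurableC.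
- case: des_iid => HX _ _; rewrite HX; last exact: measurableC.
  by rewrite probability_setC// S1 subee.
Qed.

Let tfs := truncate fs.
Let loss (f : borel_rV R d -> R) : \bar R := (\int[mu]_y ((truncate f y - tfs y) ^+ 2)%:E)%E.

Lemma loss_truncate (f : borel_rV R d -> R) :
  (\int[mu]_(y in S) ((f y - fs y) ^+ 2)%:E)%E = loss f.
Proof.
rewrite integral_mkcond; apply: eq_integral => y _; rewrite patchE.
case: ifPn => [/set_mem Sy|/negP Sy]; first by rewrite /tfs !truncateE.
rewrite /tfs !truncateN ?subrr ?expr0n//.
  by move=> Sy'; apply: Sy; exact: mem_set.
by move=> Sy'; apply: Sy; exact: mem_set.
Qed.

Let tr_le th : C th -> forall y, `|truncate (h th) y| <= Gamma.
Proof. by move=> Cth y; exact: truncate_le. Qed.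

Let tfs_le y : `|tfs y| <= Gamma.
Proof. exact: truncate_le. Qed.

Let mtfs : measurable_fun setT tfs.
Proof. exact: measurable_truncate. Qed.

Let mtr th : measurable_fun setT (truncate (h th)).
Proof. by apply: measurable_truncate; exact: measurable_h. Qed.

Let sq_bound th y : C th -> (truncate (h th) y - tfs y) ^+ 2 <= 4 * Gamma ^+ 2.
Proof.
move=> Cth; have := tr_le Cth y; have := tfs_le y; have g0 := G0.
by rewrite !ler_norml => /andP[a b] /andP[e f]; nra.
Qed.

Lemma loss_le th : C th -> (loss (h th) <= (4 * Gamma ^+ 2)%:E)%E.
Proof.
move=> Cth; apply: (@le_trans _ _ (\int[mu]_y (4 * Gamma ^+ 2)%:E)%E).
  apply: ge0_le_integral => //.
  - by move=> y _; rewrite lee_fin sqr_ge0.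
  - by apply/measurable_EFinP; apply: measurable_funX; exact: measurable_funB.
  - by move=> y _; rewrite lee_fin; exact: sq_bound.
by rewrite integral_cst// [X in (_ * X)%E]probability_setT mule1.
Qed.

Let loss_fin th : C th -> loss (h th) \is a fin_num.
Proof.
move=> Cth; rewrite ge0_fin_numE; last by apply: integral_ge0 => y _; rewrite lee_fin sqr_ge0.
by apply: le_lt_trans (loss_le Cth) (ltry _).
Qed.

Lemma loss_cvg (a : nat -> 'rV[R]_N) th : (forall r, C (a r)) -> C th ->
  (forall x, h (a r) x @[r --> \oo] --> h th x) ->
  fine (loss (h (a r))) @[r --> \oo] --> fine (loss (h th)).
Proof.
move=> Ca Cth ah; apply: fine_cvg; rewrite fineK ?loss_fin//.
have mf th' : measurable_fun setT (fun y => ((truncate (h th') y - tfs y) ^+ 2)%:E).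
  by apply/measurable_EFinP; apply: measurable_funX; exact: measurable_funB.
have [] := @dominated_convergence _ _ R mu setT measurableT
  (fun r y => ((truncate (h (a r)) y - tfs y) ^+ 2)%:E)
  (fun y => ((truncate (h th) y - tfs y) ^+ 2)%:E) (cst (4 * Gamma ^+ 2)%:E) => //.
- apply: nearW => y _; apply/cvg_EFin; first by apply: nearW.
  apply: (@cvg_comp _ _ _ _ (fun z : R => z ^+ 2)); last exact: exprn_continuous.
  apply: cvgB; last exact: cvg_cst.
  by apply: cvgM; [exact: cvg_cst|exact: ah].
- by apply: finite_measure_integrable_cst.
- apply: nearW => y r _; rewrite /= lee_fin ger0_norm ?sqr_ge0//; exact: sq_bound.
Qed.

(** The estimator need not belong to the countable dense family. Its loss is bounded pathwise by
    terms continuous in the parameter, so a nearby member of the family does as well up to [eta]. *)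
Lemma param_oracle (th0 : 'rV[R]_N) (fhat : Om -> borel_rV R d -> R) (L : Om -> \bar R) :
  C th0 -> measurable_fun setT L -> (forall w, 0 <= L w)%E ->
  {ae P, forall w, exists2 th, C th &
     [/\ fhat w = h th,
      \sum_i (fs (X i w) + eps i w - fhat w (X i w)) ^+ 2 <=
      \sum_i (fs (X i w) + eps i w - h th0 (X i w)) ^+ 2 &
      L w = (\int[mu]_(y in S) ((fhat w y - fs y) ^+ 2)%:E)%E]} ->
  (\int[P]_w L w <= 6%:E * \int[mu]_(y in S) ((h th0 y - fs y) ^+ 2)%:E +
    (120 * Num.max (sigma ^+ 2) (Gamma ^+ 2) * (ln cover_size%:R + 1) / n%:R)%:E)%E.
Proof.
have le_of_diff (a b b' e e' z : R) : b + e - (b' + e') < z -> a + b + e <= a + b' + e' + z.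
  by lra.
move=> C0 mL L0 aeL; have [g [Cg gdense]] := dense_params C0.
rewrite loss_truncate.
have cs0 : (0 < cover_size)%N by rewrite expn_gt0.
have n0' : (n%:R : R) != 0 by rewrite pnatr_eq0 -lt0n.
apply: (oracle_countable des_iid sigma0 n0 G0 tfs_le (tr_le C0)
  (fun j => tr_le (Cg j)) mtfs (mtr th0) (fun j => mtr (g j)) cs0
  (fun J => truncated_cover J Cg) mL L0).
apply: filterS2 aeL ae_covariates => w [th Cth [fE am ->]] SX eta eta0.
rewrite loss_truncate fE; rewrite fE in am.
pose T th := truncate (h th).
have Lle : (loss (h th) <= (6 * emp_loss X tfs (T th0) w +
    4 * noise_fun X eps (T th0) (T th) w + excess mu X tfs (T th) w)%:E)%E.
  rewrite -(fineK (loss_fin Cth)) lee_fin /excess -/(loss (h th)).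
  rewrite addrCA lerDl subr_ge0 /emp_loss /noise_fun.
  rewrite !(mulrCA _ n%:R^-1) -mulrDr ler_wpM2l ?invr_ge0// !mulr_sumr -big_split/=.
  have TE th' i : T th' (X i w) = h th' (X i w) by rewrite /T truncateE.
  have fsE i : tfs (X i w) = fs (X i w) by rewrite /tfs truncateE.
  (* Four times the minimizing inequality. Termwise, the claimed bound exceeds it by 2 (p - z)^2 + 2
     (y - z)^2 - (y - p)^2 = (y + p - 2 z)^2, the penalty of the noise term having become (y -
     p)^2. *)
  rewrite -subr_ge0 in am; rewrite -subr_ge0; apply: le_trans (mulr_ge0 (ler0n _ 4) am) _.
  rewrite -sumrB mulr_sumr -sumrB; apply: ler_sum => i _; rewrite !TE !fsE.
  set e := eps i w; set p := h th0 _; set y := h th _; set z := fs _.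
  have := sqr_ge0 (y + p - 2 * z); nra.
have /choice[ix ixP] : forall r : nat, exists j, `|th - g j| < r.+1%:R^-1.
  by move=> r; apply: gdense => //; rewrite invr_gt0.
have gth : g (ix r) @[r --> \oo] --> th.
  apply/cvgrPdist_lt => e e0; have := near_infty_natSinv_lt (PosNum e0).
  by apply: filterS => r re; exact: lt_trans (ixP r) re.
have hcvg x : h (g (ix r)) x @[r --> \oo] --> h th x.
  have hc : continuous (pen_fun (m := m) k0 (c x)) by exact: (pen_fun_continuous_param m0).
  exact: (cvg_comp _ _ gth (hc th)).
have Tcvg x : T (g (ix r)) x @[r --> \oo] --> T th x.
  by apply: cvgM; [exact: cvg_cst|exact: hcvg].
have Wcvg : 4 * noise_fun X eps (T th0) (T (g (ix r))) w + excess mu X tfs (T (g (ix r))) w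
    @[r --> \oo] --> 4 * noise_fun X eps (T th0) (T th) w + excess mu X tfs (T th) w.
  apply: cvgD.
    apply: cvgM; first exact: cvg_cst.
    apply: cvgM; first exact: cvg_cst.
    apply: cvg_sumr => i.
    have hi : T (g (ix r)) (X i w) - T th0 (X i w) @[r --> \oo] -->
        T th (X i w) - T th0 (X i w) by apply: cvgB; [exact: Tcvg|exact: cvg_cst].
    apply: cvgB; first by apply: cvgM; [exact: cvg_cst|exact: hi].
    apply: cvgM; last exact: cvg_cst.
    exact: (cvg_comp _ _ hi (@exprn_continuous _ 2 _)).
  apply: cvgB; first exact: (loss_cvg (fun r => Cg (ix r)) Cth hcvg).
  apply: cvgM; first exact: cvg_cst.
  apply: cvgM; first exact: cvg_cst.
  apply: cvg_sumr => i.
  have hi : T (g (ix r)) (X i w) - tfs (X i w) @[r --> \oo] -->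
      T th (X i w) - tfs (X i w) by apply: cvgB; [exact: Tcvg|exact: cvg_cst].
  exact: (cvg_comp _ _ hi (@exprn_continuous _ 2 _)).
have /cvgrPdist_lt/(_ eta eta0)[r _ /(_ r (leqnn r))] := Wcvg.
rewrite ltr_norml => /andP[_ Wr]; exists (ix r).
by apply: le_trans Lle _; rewrite lee_fin; exact: le_of_diff Wr.
Qed.

End ParamOracle.

(** Both the number N of parameters and [m] are at most n, so the base of the power is at most 2^5
    n^4 and its logarithm at most 5 + 4 ln n; the sixth unit absorbs the added 1. *)
Lemma ln_cover_size {R : realType} (q m k n : nat) :
  (0 < q)%N -> (0 < m)%N -> (0 < k)%N -> (q * m * k <= n)%N ->
  ln (cover_size (q := q) (m := m) (k := k) n)%:R + 1 <=
  6 * (q * m * k)%:R * (1 + ln n%:R) :> R.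
Proof.
move=> q0 m0 k0 Nn; rewrite /cover_size card_pen_index.
set N := (q * m * k)%N in Nn *.
have N0 : (0 < N)%N by rewrite !muln_gt0 q0 m0.
have n0 : (0 < n)%N by apply: leq_trans Nn.
have mn : (m <= n)%N.
  apply: leq_trans Nn; rewrite /N -mulnA mulnCA.
  by rewrite -[X in (X <= _)%N]muln1 leq_mul2l muln_gt0 q0 k0 orbT.
set B := (N * _).+1.
have Bn : (B <= 2 ^ 5 * n ^ 4)%N.
  apply: (@leq_trans (n * (2 * (2 + (n + n) * (2 * n).+1 * n))).+1).
    by rewrite ltnS leq_mul// leq_mul2l/= leq_add2l leq_mul2l mn orbT.
  nia.
have ln0 : 0 <= ln (n%:R : R) by rewrite ln_ge0// ler1n.
have lnB : ln (B%:R : R) <= 5 + 4 * ln n%:R.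
  apply: (@le_trans _ _ (ln ((2 : R) ^+ 5 * n%:R ^+ 4))).
    rewrite ler_ln ?posrE ?ltr0n ?mulr_gt0 ?exprn_gt0 ?ltr0n//.
    by rewrite -!natrX -natrM ler_nat.
  rewrite lnM ?posrE ?exprn_gt0 ?ltr0n// !lnXn ?ltr0n// -[_ *+ 4]mulr_natl lerD2r.
  have : ln (2 : R) <= 1 by apply: le_trans (le_ln1Dx _) _; lra.
  by rewrite -mulr_natl => ?; lra.
rewrite natrX lnXn ?ltr0n// -[_ *+ N]mulr_natl.
have N1 : 1 <= (N%:R : R) by rewrite ler1n.
nra.
Qed.

Section UniformOracle.
Context {R : realType} {d q m k : nat}.
Hypothesis q0 : (0 < q)%N.
Hypothesis m0 : (0 < m)%N.
Hypothesis k0 : (0 < k)%N.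
Local Notation N := #|{: pen_index (q := q) (m := m) (k := k)}|.
Context (c : 'rV[R]_d -> 'I_q -> R).
Hypothesis cc : forall l, continuous (c ^~ l).
Context {disp : measure_display} {Om : measurableType disp} (P : probability Om R)
  (n : nat) (mu : probability (borel_rV R d) R) (sigma : R)
  (X : 'I_n -> {RV P >-> borel_rV R d}) (eps : 'I_n -> {RV P >-> R}).
Hypothesis des : regression_design mu sigma X eps.
Hypothesis sigma0 : 0 < sigma.
Context (Gamma : R) (S : set (borel_rV R d)) (fs : borel_rV R d -> R).
Hypothesis n0 : (0 < n)%N.
Hypothesis G0 : 0 < Gamma.
Hypothesis mS : measurable S.
Hypothesis S1 : mu S = 1%E.
Hypothesis mfs : measurable_fun setT fs.
Hypothesis fs_le : forall x, S x -> `|fs x| <= Gamma.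

(** [ell] stands for the logarithmic factor, which differs in the two parts. It is compared with 1 +
    ln n only when there are at most n parameters. *)
Lemma uniform_oracle (th0 : 'rV[R]_N) (fhat : Om -> borel_rV R d -> R)
    (L : Om -> \bar R) (ell : R) :
  (forall x, S x -> `|pen_fun k0 (c x) th0| <= Gamma) ->
  measurable_fun setT L -> (forall w, 0 <= L w)%E ->
  {ae P, forall w, exists2 th : 'rV[R]_N,
     forall x, S x -> `|pen_fun k0 (c x) th| <= Gamma &
     [/\ fhat w = (fun x => pen_fun k0 (c x) th),
      \sum_i (fs (X i w) + eps i w - fhat w (X i w)) ^+ 2 <=
      \sum_i (fs (X i w) + eps i w - pen_fun k0 (c (X i w)) th0) ^+ 2 &
      L w = (\int[mu]_(y in S) ((fhat w y - fs y) ^+ 2)%:E)%E]} ->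
  1 <= ell -> ((q * m * k <= n)%N -> 1 + ln n%:R <= 2 * ell) ->
  (\int[P]_w L w <=
   1440%:E * (\int[mu]_(y in S) ((pen_fun k0 (c y) th0 - fs y) ^+ 2)%:E +
    (Num.max (sigma ^+ 2) (Gamma ^+ 2) * (q * m * k)%:R * (ell / n%:R))%:E))%E.
Proof.
move=> C0 mL L0 aeL ell1 elln.
have n0' : 0 < (n%:R : R) by rewrite ltr0n.
set V := Num.max _ _.
have V2 : Gamma ^+ 2 <= V by rewrite le_max lexx orbT.
have V0 : 0 <= V by apply: le_trans V2; exact: sqr_ge0.
have I0 : (0 <= \int[mu]_(y in S) ((pen_fun k0 (c y) th0 - fs y) ^+ 2)%:E)%E.
  by apply: integral_ge0 => y _; rewrite lee_fin sqr_ge0.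
have r0 : 0 <= V * (q * m * k)%:R * (ell / n%:R).
  by rewrite !mulr_ge0 ?invr_ge0 ?(ltW n0')//; lra.
have [Nn|nN] := leqP (q * m * k) n.
  have := param_oracle m0 cc des sigma0 n0 G0 mS S1 mfs fs_le C0 mL L0 aeL.
  move=> /le_trans; apply.
  rewrite [X in (_ <= X)%E]ge0_muleDr//; apply: leeD.
    by apply: lee_wpmul2r => //; rewrite lee_fin ler_nat.
  rewrite -EFinM lee_fin -/V.
  have h := ln_cover_size (R := R) q0 m0 k0 Nn; have h' := elln Nn.
  have -> : 1440 * (V * (q * m * k)%:R * (ell / n%:R)) =
      120 * V * (12 * (q * m * k)%:R * ell) / n%:R by field; rewrite gt_eqF.
  rewrite ler_wpM2r ?invr_ge0 ?(ltW n0')// ler_wpM2l ?mulr_ge0//.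
  apply: le_trans h _.
  have -> : 12 * (q * m * k)%:R * ell = 6 * (q * m * k)%:R * (2 * ell) by ring.
  by rewrite ler_wpM2l// mulr_ge0.
(* With more parameters than observations, the remainder exceeds 4 Gamma^2. *)
have N1 : 1 <= (q * m * k)%:R / (n%:R : R).
  by rewrite ler_pdivlMr// mul1r ler_nat ltnW.
apply: (@le_trans _ _ (\int[P]_w (4 * Gamma ^+ 2)%:E)%E).
  apply: ae_ge0_le_integral => //.
    by move=> w _; rewrite lee_fin mulr_ge0// sqr_ge0.
  apply: filterS aeL => w [th Cth [fE _ ->]] _; rewrite fE.
  rewrite (loss_truncate mu S fs (fun x => pen_fun k0 (c x) th)).
  exact: (loss_le m0 cc mu G0 mS mfs fs_le Cth).
rewrite integral_cst// [X in (_ * X)%E]probability_setT mule1.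
rewrite [X in (_ <= X)%E]ge0_muleDr//.
apply: (@le_trans _ _ (1440%:E * (V * (q * m * k)%:R * (ell / n%:R))%:E)%E); last first.
  by apply: leeDr; apply: mule_ge0 I0; rewrite lee_fin ler0n.
rewrite -EFinM lee_fin.
have -> : V * (q * m * k)%:R * (ell / n%:R) = V * ((q * m * k)%:R / n%:R * ell).
  by field; rewrite gt_eqF.
have : 1 <= (q * m * k)%:R / n%:R * ell by exact: mulr_ege1.
have := sqr_ge0 Gamma; set z := _ * ell; nra.
Qed.

End UniformOracle.

Lemma ereal_inf_bound {R : realType} (T : Type) (A : set T) (F : T -> \bar R)
    (x : \bar R) (c r : R) : 0 < c ->
  (forall t, A t -> x <= c%:E * (F t + r%:E))%E ->
  (x <= c%:E * (ereal_inf [set F t | t in A] + r%:E))%E.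
Proof.
move=> c0 h; rewrite -lee_pdivrMl// -leeBlDr//.
by apply: le_ereal_inf_tmp => _ [t At <-]; rewrite leeBlDr// lee_pdivrMl// h.
Qed.

Lemma integral_full {R : realType} d (T : measurableType d) (mu : probability T R)
    (S : set T) (f : T -> \bar R) : measurable S -> mu S = 1%E ->
  measurable_fun setT f -> (forall x, 0 <= f x)%E ->
  (\int[mu]_x f x = \int[mu]_(x in S) f x)%E.
Proof.
move=> mS S1 mf f0.
have C0 : mu (~` S) = 0%E by rewrite probability_setC// S1 subee.
rewrite (ge0_negligible_integral (measurableC mS) measurableT mf)//.
by rewrite setTD setCK.
Qed.

(** * The two classes as pencils, and the final bounds *)

Section ClassParametrization.
Context {R : realType} {d m k : nat}.
Hypothesis m0 : (0 < m)%N.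
Hypothesis k0 : (0 < k)%N.

(** The vector (x, 1): the last coordinate carries the constant matrix, whence q = d + 1. *)
Definition affine_coord (x : 'rV[R]_d) (l : 'I_(d + 1)) : R :=
  match fintype.split l with inl i => x ord0 i | inr _ => 1 end.

Lemma affine_coord_continuous l : continuous (affine_coord ^~ l).
Proof.
move=> x; rewrite /affine_coord; case: (fintype.split l) => [i|_]; last exact: cst_continuous.
exact: coord_continuous.
Qed.

Lemma spectrahedral_pen_fun f : spectrahedral_fun m k f ->
  exists th, f = (fun x : 'rV[R]_d => pen_fun (m := m) k0 (affine_coord x) th).
Proof.
move=> [A [B [As Bs fE]]].
pose A' (l : 'I_(d + 1)) := match fintype.split l with inl i => A i | inr _ => B end.
have [|th thE] := pen_mx_surj k0 (A := A').
  by move=> l; rewrite /A'; case: (fintype.split l).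
have El i : fintype.split (lshift 1 i) = inl i :> 'I_d + 'I_1 by exact: (unsplitK (inl i)).
have Er : fintype.split (rshift d ord0) = inr ord0 :> 'I_d + 'I_1.
  exact: (unsplitK (inr ord0)).
exists th; apply/funext => x; rewrite fE /pen_fun thE big_split_ord big_ord1/=.
rewrite {2}/affine_coord {2}/A' Er scale1r.
rewrite [in RHS](eq_bigr (fun i => x ord0 i *: A i))// => i _.
by rewrite /affine_coord /A' El.
Qed.

(** Both sides satisfy [is_lmax] for the same matrix, which determines the value. *)
Lemma support_fun_pen_fun (L : {linear 'M[R]_m -> 'rV[R]_d}) :
  exists th, support_fun (L @` spectraplex k) =
    (fun u : 'rV[R]_d => pen_fun (m := m) k0 (fun l => u ord0 l) th).
Proof.
have [th thE] := pen_mx_surj k0 (coef_mx_sym (k := k) L).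
exists th; apply/funext => u; apply: (is_lmax_unique (support_fun_lmax (k := k) m0 L u)).
by rewrite -thE; exact: pen_fun_lmax.
Qed.

Lemma spectraplex_neq0 : @spectraplex R m k !=set0.
Proof.
exists (block_proj (k := k) (delta_mx (Ordinal m0) ord0)); apply: block_proj_spectraplex.
by apply/cV0Pn; exists (Ordinal m0); rewrite mxE !eqxx oner_neq0.
Qed.

Lemma spectratope_bound (Gamma : R) (S : set 'rV[R]_d) : 0 < Gamma ->
  spectratope_class m k Gamma S -> forall u, esphere u -> `|support_fun S u| <= Gamma.
Proof.
move=> G0 [[L SE] SG] u; apply: support_fun_bound => //; rewrite SE.
by have [M SM] := spectraplex_neq0; exists (L M), M.
Qed.

End ClassParametrization.

Lemma closed_esphere {R : realType} {d : nat} : closed (@esphere R d).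
Proof.
have -> : @esphere R d = (fun u : 'rV[R]_d => dotp u u) @^-1` [set 1].
  have dotp_ge0 (x : 'rV[R]_d) : 0 <= dotp x x.
    by apply: sumr_ge0 => i _; rewrite -expr2 sqr_ge0.
  apply/seteqP; split=> u; rewrite /esphere /enorm /= => h.
    by rewrite -[LHS]sqr_sqrtr// h expr1n.
  by rewrite h sqrtr1.
apply: (@preimage_closed _ _ (fun u : 'rV[R]_d => dotp u u) [set 1]); last exact: closed_eq.
move=> u _; apply: (@cvg_sumr R _ (nbhs u)) => i.
by apply: (@cvgM _ _ (nbhs u)); exact: coord_continuous.
Qed.

Lemma esphere_dim_gt0 {R : realType} {d : nat} : @esphere R d !=set0 -> (0 < d)%N.
Proof.
case: d => // -[u]; rewrite /esphere /enorm /dotp /= big_ord0 sqrtr0 => /eqP.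
by rewrite eq_sym oner_eq0.
Qed.

(** k^2 <= n gives 2 ln k <= ln n, so at least half of ln n survives in ln(n / k). *)
Lemma ln_le_double_ln_div {R : realType} (k n : nat) : (0 < k)%N -> (k * k <= n)%N ->
  1 + ln (n%:R : R) <= 2 * ln (expR 1 * n%:R / k%:R).
Proof.
move=> k0 kn; have n0 : (0 < n)%N by apply: leq_trans kn; rewrite muln_gt0 k0.
rewrite ln_div ?posrE ?mulr_gt0 ?expR_gt0 ?ltr0n// lnM ?posrE ?expR_gt0 ?ltr0n// expRK.
have : ln (k%:R * k%:R : R) <= ln n%:R.
  by rewrite ler_ln ?posrE ?mulr_gt0 ?ltr0n// -natrM ler_nat.
rewrite lnM ?posrE ?ltr0n//; lra.
Qed.

Lemma spectrahedral_oracle {R : realType} (m k : nat) (m0 : (0 < m)%N) (k0 : (0 < k)%N)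
    (km : (k %| m)%N) (d n : nat) (disp : measure_display) (Omega : measurableType disp)
    (P : probability Omega R) (mu : probability (borel_rV R d) R)
    (sigma Gamma : R) (fstar : 'rV[R]_d -> R)
    (X : 'I_n -> {RV P >-> borel_rV R d}) (eps : 'I_n -> {RV P >-> R})
    (fhat : Omega -> 'rV[R]_d -> R) :
  (k <= n)%N -> 0 < sigma -> 0 < Gamma ->
  convex_function [set: 'rV[R]_d] fstar ->
  (forall x, msupport mu x -> `|fstar x| <= Gamma) ->
  regression_design mu sigma X eps ->
  {ae P, forall w, is_argmin (spectrahedral_class m k mu Gamma)
     (sum_sq (fun i => X i w) (fun i => fstar (X i w) + eps i w)) (fhat w)} ->
  measurable_fun [set: Omega] (fun w => loss_fun mu (fhat w) fstar) ->
  (\int[P]_w loss_fun mu (fhat w) fstar <=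
   1440%:E * (ereal_inf [set loss_fun mu f fstar
                     | f in spectrahedral_class m k mu Gamma] +
           (Num.max (sigma ^+ 2) (Gamma ^+ 2) * (k * m * (d + 1))%:R *
            (ln (expR 1 * n%:R / k%:R) / n%:R))%:E))%E.
Proof.
move=> kn s0 G0 fconv fstar_le des amin mL.
have n0 : (0 < n)%N by apply: leq_trans kn.
have mS : measurable (msupport mu : set (borel_rV R d)).
  by apply: closed_measurable_rV; exact: closed_msupport.
have S1 := msupport_full mu.
have mfs : measurable_fun setT (fstar : borel_rV R d -> R).
  by apply: continuous_measurable_rV; exact: convex_continuous.
have cc := @affine_coord_continuous R d.
have mpen th : measurable_fun setT
    ((fun x => pen_fun (m := m) k0 (affine_coord x) th) : borel_rV R d -> R).
  by apply: continuous_measurable_rV; apply: pen_fun_continuous_arg.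
have lossE th : loss_fun mu (fun x => pen_fun (m := m) k0 (affine_coord x) th) fstar =
    (\int[mu]_(y in (msupport mu : set (borel_rV R d)))
      ((pen_fun (m := m) k0 (affine_coord y) th - fstar y) ^+ 2)%:E)%E.
  rewrite /loss_fun (integral_full mS S1)//.
    by apply/measurable_EFinP; apply: measurable_funX; exact: measurable_funB.
  by move=> x; rewrite lee_fin sqr_ge0.
apply: ereal_inf_bound => [|f0 [F0 C0]]; first by rewrite ltr0n.
have [th0 f0E] := spectrahedral_pen_fun k0 F0; subst f0.
rewrite lossE (_ : (k * m * (d + 1))%N = ((d + 1) * m * k)%N); last by lia.
apply: (uniform_oracle _ m0 cc des s0 n0 G0 mS S1 mfs fstar_le C0 mL).
- by rewrite addn1.
- by move=> w; apply: integral_ge0 => y _; rewrite lee_fin sqr_ge0.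
- apply: filterS amin => w [[/(spectrahedral_pen_fun k0)[th fE] Cth] fmin].
  exists th; first by move=> x Sx; rewrite -[X in `|X|]/((fun x => pen_fun k0 _ _) x) -fE Cth.
  split; [exact: fE | exact: (fmin _ (conj F0 C0)) | by rewrite fE lossE].
(* The factor is 1 + ln(n / k), and k <= n. *)
- rewrite -mulrA lnM ?posrE ?expR_gt0 ?divr_gt0 ?ltr0n// expRK lerDl ln_ge0//.
  by rewrite ler_pdivlMr ?ltr0n// mul1r ler_nat.
(* k <= m by divisibility, so k^2 is at most the number of parameters. *)
- move=> Nn; apply: ln_le_double_ln_div => //; apply: leq_trans Nn.
  by rewrite leq_mul// -[k]mul1n leq_mul ?addn1// dvdn_leq.
Qed.

Lemma spectratope_oracle {R : realType} (m k : nat) (m0 : (0 < m)%N) (k0 : (0 < k)%N)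
    (d n : nat) (disp : measure_display) (Omega : measurableType disp)
    (P : probability Omega R) (nu : probability (borel_rV R d) R)
    (sigma Gamma : R) (Kstar : set 'rV[R]_d)
    (U : 'I_n -> {RV P >-> borel_rV R d}) (eps : 'I_n -> {RV P >-> R})
    (Khat : Omega -> set 'rV[R]_d) :
  (0 < n)%N -> 0 < sigma -> 0 < Gamma ->
  convex_body Kstar -> Kstar `<=` eball Gamma ->
  nu esphere = 1%E ->
  regression_design nu sigma U eps ->
  {ae P, forall w, is_argmin (spectratope_class m k Gamma)
     (fun S => sum_sq (fun i => U i w)
        (fun i => support_fun Kstar (U i w) + eps i w) (support_fun S)) (Khat w)} ->
  measurable_fun [set: Omega] (fun w => loss_set nu (Khat w) Kstar) ->
  (\int[P]_w loss_set nu (Khat w) Kstar <=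
   1440%:E * (ereal_inf [set loss_set nu S Kstar
                     | S in spectratope_class m k Gamma] +
           (Num.max (sigma ^+ 2) (Gamma ^+ 2) * ((m * k)%:R / n%:R) * d%:R *
            ln (expR 1 * n%:R))%:E))%E.
Proof.
move=> n0 s0 G0 [_ _ K0] KG S1 des amin mL.
(* In dimension 0 the sphere is empty and could not carry a probability. *)
have d0 : (0 < d)%N.
  apply: (@esphere_dim_gt0 R); apply/set0P/eqP => e0; move: S1.
  by rewrite e0 measure0 => /esym/eqP; rewrite onee_eq0.
have mS : measurable (esphere : set (borel_rV R d)).
  by apply: closed_measurable_rV; exact: closed_esphere.
have mfs : measurable_fun setT (support_fun Kstar : borel_rV R d -> R).
  by apply: continuous_measurable_rV; exact: (support_fun_continuous G0 K0 KG).
have fs_le u : esphere u -> `|support_fun Kstar u| <= Gamma.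
  exact: (support_fun_bound G0 K0 KG).
have cc (l : 'I_d) : continuous (fun u : 'rV[R]_d => u ord0 l) by exact: coord_continuous.
apply: ereal_inf_bound => [|S0 CS0]; first by rewrite ltr0n.
have [[L0 S0E] _] := CS0; have C0 := spectratope_bound m0 G0 CS0.
have [th0 th0E] := support_fun_pen_fun m0 k0 L0; rewrite -S0E in th0E.
rewrite [X in (_ <= _ * (X + _))%E]/loss_set th0E.
have -> : Num.max (sigma ^+ 2) (Gamma ^+ 2) * ((m * k)%:R / n%:R) * d%:R *
      ln (expR 1 * n%:R) =
    Num.max (sigma ^+ 2) (Gamma ^+ 2) * (d * m * k)%:R * (ln (expR 1 * n%:R) / n%:R).
  by rewrite !natrM; ring.
apply: (uniform_oracle d0 m0 cc des s0 n0 G0 mS S1 mfs fs_le _ mL).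
- by move=> u Su; rewrite -[X in `|X|]/((fun u => pen_fun k0 _ _) u) -th0E C0.
- by move=> w; apply: integral_ge0 => y _; rewrite lee_fin sqr_ge0.
- apply: filterS amin => w [Cw fmin].
  have [[L SE] _] := Cw; have bw := spectratope_bound m0 G0 Cw.
  have [th thE] := support_fun_pen_fun m0 k0 L; rewrite -SE in thE.
  exists th; first by move=> u Su; rewrite -[X in `|X|]/((fun u => pen_fun k0 _ _) u) -thE bw.
  split; [exact: thE | | by []].
  by have := fmin _ CS0; rewrite th0E.
- by rewrite lnM ?posrE ?expR_gt0 ?ltr0n// expRK lerDl ln_ge0// ler1n.
- move=> _; rewrite lnM ?posrE ?expR_gt0 ?ltr0n// expRK.
  have : 0 <= ln (n%:R : R) by rewrite ln_ge0// ler1n.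
  lra.
Qed.

Theorem theorem5 (R : realType) :
  exists c b : R, [/\ 0 < c, 0 < b &
  forall m k : nat, (0 < m)%N -> (0 < k)%N -> (k %| m)%N ->
  (forall (d n : nat) (disp : measure_display) (Omega : measurableType disp)
      (P : probability Omega R) (mu : probability (borel_rV R d) R)
      (sigma Gamma : R) (fstar : 'rV[R]_d -> R)
      (X : 'I_n -> {RV P >-> borel_rV R d}) (eps : 'I_n -> {RV P >-> R})
      (Y : 'I_n -> Omega -> R) (fhat : Omega -> 'rV[R]_d -> R),
    (k <= n)%N -> 0 < sigma -> 0 < Gamma ->
    convex_function [set: 'rV[R]_d] fstar ->
    (forall x, msupport mu x -> `|fstar x| <= Gamma) ->
    regression_design mu sigma X eps ->
    (forall i w, Y i w = fstar (X i w) + eps i w) ->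
    {ae P, forall w, is_argmin (spectrahedral_class m k mu Gamma)
                       (sum_sq (fun i => X i w) (fun i => Y i w)) (fhat w)} ->
    measurable_fun [set: Omega] (fun w => loss_fun mu (fhat w) fstar) ->
    (\int[P]_w loss_fun mu (fhat w) fstar <=
     c%:E * (ereal_inf [set loss_fun mu f fstar
                       | f in spectrahedral_class m k mu Gamma] +
             (Num.max (sigma ^+ 2) (Gamma ^+ 2) * (k * m * (d + 1))%:R *
              (ln (b * n%:R / k%:R) / n%:R))%:E))%E)
  /\
  (forall (d n : nat) (disp : measure_display) (Omega : measurableType disp)
      (P : probability Omega R) (nu : probability (borel_rV R d) R)
      (sigma Gamma : R) (Kstar : set 'rV[R]_d)
      (U : 'I_n -> {RV P >-> borel_rV R d}) (eps : 'I_n -> {RV P >-> R})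
      (Y : 'I_n -> Omega -> R) (Khat : Omega -> set 'rV[R]_d),
    (0 < n)%N -> 0 < sigma -> 0 < Gamma ->
    convex_body Kstar -> Kstar `<=` eball Gamma ->
    nu esphere = 1%E ->
    regression_design nu sigma U eps ->
    (forall i w, Y i w = support_fun Kstar (U i w) + eps i w) ->
    {ae P, forall w, is_argmin (spectratope_class m k Gamma)
                       (fun S => sum_sq (fun i => U i w) (fun i => Y i w)
                                        (support_fun S)) (Khat w)} ->
    measurable_fun [set: Omega] (fun w => loss_set nu (Khat w) Kstar) ->
    (\int[P]_w loss_set nu (Khat w) Kstar <=
     c%:E * (ereal_inf [set loss_set nu S Kstar
                       | S in spectratope_class m k Gamma] +
             (Num.max (sigma ^+ 2) (Gamma ^+ 2) * ((m * k)%:R / n%:R) * d%:R *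
              ln (b * n%:R))%:E))%E)].
Proof.
exists 1440, (expR 1); split; [by rewrite ltr0n | exact: expR_gt0 |].
move=> m k m0 k0 km; split.
- move=> d n disp Om P mu sigma Gamma fstar X eps Y fhat kn s0 G0 fconv fle des YE amin mL.
  apply: (spectrahedral_oracle m0 k0 km kn s0 G0 fconv fle des _ mL).
  apply: filterS amin => w.
  by have -> : (fun i => Y i w) = (fun i => fstar (X i w) + eps i w)
    by apply/funext => i; exact: YE.
- move=> d n disp Om P nu sigma Gamma Ks U eps Y Kh n0 s0 G0 cK KG S1 des YE amin mL.
  apply: (spectratope_oracle m0 k0 n0 s0 G0 cK KG S1 des _ mL).
  apply: filterS amin => w.
  by have -> : (fun i => Y i w) = (fun i => support_fun Ks (U i w) + eps i w)
    by apply/funext => i; exact: YE.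
Qed.
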